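(* Let $(X,\bar 0)\subset(\mathbb{C}^3,\bar 0)$ be a surface germ, let $\pi:\mathbb{C}^3\to\mathbb{C}^2$ be a linear projection with $\pi|_{(X,\bar 0)}$ finite, and let $\Delta$ be the discriminant of $\pi|_X$. If the tangent cone $C_{X,\bar 0}\subset\mathbb{CP}^2$ is not a line or a union of lines, and there is an irreducible arc-section over an arc $\gamma$ in $(\mathbb{C}^2,\bar 0)$, then the arc $\gamma$ is tangent to $\Delta$.
   Context: Finiteness of $\pi|_{(X,\bar 0)}$ means $\pi^{-1}(\bar 0)\cap X=\{\bar 0\}$ as germs. $C_{X,\bar 0}\subset\mathbb{CP}^2$ is the projectivized tangent cone (considered as a set). After a linear change of coordinates $\pi(x_1,x_2,x_3)=(x_1,x_2)$ and $X=\{F=0\}$ with $F$ a reduced Weierstrass polynomial in $x_3$; the discriminant $\Delta\subset(\mathbb{C}^2,\bar 0)$ is the zero set of the discriminant of $F$ with respect to $x_3$. An arc is a holomorphic map germ $\gamma:(\mathbb{C},0)\to(\mathbb{C}^2,\bar 0)$ with an injective representative. It is tangent to $\Delta$ if the tangent line at $\bar 0$ of its image (limit of secants through $\bar 0$) belongs to the tangent cone of $\Delta$ at $\bar 0$. The arc-section over $\gamma$ is $\pi^{-1}(\gamma(\mathbb{D}))\cap X$ where $\gamma:\mathbb{D}\to\mathbb{C}^2$ is an injective representative on a sufficiently small closed disk centered at $0$, such that either $\gamma(\mathbb{D})\subset\Delta$ or $\gamma(\mathbb{D})\cap\Delta=\{\bar 0\}$; it is irreducible if its germ at $\bar 0$,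 with reduced structure, is irreducible. *)

(* Defs.v *)
From HB Require Import structures.
From mathcomp Require Import all_boot all_order all_algebra.
From mathcomp Require Import complex.
From mathcomp Require Import all_classical all_reals all_analysis.

Set Implicit Arguments.
Unset Strict Implicit.
Unset Printing Implicit Defensive.

Import Order.TTheory GRing.Theory Num.Theory.
Import numFieldNormedType.Exports.

Local Open Scope classical_set_scope.
Local Open Scope ring_scope.

(* The alias gives R[i] its topology and norm: these are found through the
   numClosedFieldType structure, not on [complex R] itself. *)
Definition Cplx (R : realType) : numClosedFieldType := complex R.

(* Points of C^n are row vectors, and germs at the origin are given by
   representatives: sets (or functions) on the whole space of which only the
   behaviour near 0 matters. *)
Section Germs.
Context {R : realType}.
Local Notation C := (Cplx R).

Definition germ_eq (U : normedModType C) (A B : set U) : Prop :=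
  \forall x \near (0 : U), A x <-> B x.

(* The scalars being complex, [differentiable] is complex differentiability. *)
Definition holomorphic_germ (U V : normedModType C) (f : U -> V) : Prop :=
  \forall x \near (0 : U), differentiable f x.

Definition analytic_germ n (A : set 'rV[C]_n) : Prop :=
  exists (m : nat) (f : 'I_m -> 'rV[C]_n -> C),
    (forall i, holomorphic_germ (f i)) /\
    germ_eq A [set x | forall i, f i x = 0].

(* To be used for analytic germs A; the first clause excludes the empty germ. *)
Definition irreducible_germ n (A : set 'rV[C]_n) : Prop :=
  A 0 /\
  forall A1 A2 : set 'rV[C]_n, analytic_germ A1 -> analytic_germ A2 ->
    germ_eq A (A1 `|` A2) -> germ_eq A A1 \/ germ_eq A A2.

(* Surface germs in C^3 are analytic germs of pure dimension 2, that is,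
   hypersurface germs. *)
Definition surface_germ (X : set 'rV[C]_3) : Prop :=
  exists f : 'rV[C]_3 -> C,
    [/\ holomorphic_germ f, f 0 = 0,
        ~ (\forall x \near (0 : 'rV[C]_3), f x = 0)
      & germ_eq X [set x | f x = 0]].

(* Limits of secants through 0; this is a cone in C^n. *)
Definition tangent_cone n (A : set 'rV[C]_n) : set 'rV[C]_n :=
  [set v | exists (x : nat -> 'rV[C]_n) (c : nat -> C),
    [/\ forall k, A (x k),
        x k @[k --> \oo] --> (0 : 'rV[C]_n)
      & c k *: x k @[k --> \oo] --> v]].

(* Subsets of CP^2 are given by the homogeneous coordinates of their points:
   subsets of C^3 minus the origin which are stable under nonzero scalars. *)
Definition proj_tangent_cone (X : set 'rV[C]_3) : set 'rV[C]_3 :=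
  [set v | v != 0 /\ tangent_cone X v].

Definition proj_line (l : 'cV[C]_3) : set 'rV[C]_3 :=
  [set v | v != 0 /\ v *m l = 0].

Definition line_or_union_of_lines (E : set 'rV[C]_3) : Prop :=
  exists (m : nat) (l : 'I_m.+1 -> 'cV[C]_3),
    (forall i, l i != 0) /\ E = [set v | exists i, proj_line (l i) v].

Definition finite_projection (pr : 'rV[C]_3 -> 'rV[C]_2)
    (X : set 'rV[C]_3) : Prop :=
  germ_eq (pr @^-1` [set 0] `&` X) [set 0].

(* F y is the polynomial in x_3 obtained at y = (x_1, x_2). *)
Definition weierstrass (F : 'rV[C]_2 -> {poly C}) : Prop :=
  exists d : nat,
    [/\ \forall y \near (0 : 'rV[C]_2), F y \is monic /\ size (F y) = d.+1,
        forall i : nat, (i < d)%N -> holomorphic_germ (fun y => (F y)`_i : C)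
      & forall i : nat, (i < d)%N -> (F 0)`_i = 0].

Definition weierstrass_fun (F : 'rV[C]_2 -> {poly C}) (u : 'rV[C]_3) : C :=
  (F (lsubmx (u : 'rV[C]_(2 + 1)))).[u 0 ord_max].

(* No multiple factor in the ring of holomorphic germs, whose non-units are
   the germs vanishing at the origin. *)
Definition reduced_germ n (f : 'rV[C]_n -> C) : Prop :=
  forall g h : 'rV[C]_n -> C, holomorphic_germ g -> holomorphic_germ h ->
    (\forall x \near (0 : 'rV[C]_n), f x = g x ^+ 2 * h x) -> g 0 != 0.

Definition discriminant (p : {poly C}) : C :=
  (-1) ^+ 'C((size p).-1, 2) * resultant p p^`() / lead_coef p.

(* Delta is the discriminant of the restriction of pr to X: after the linear
   change of coordinates x |-> x *m A, pr is (x_1, x_2, x_3) |-> (x_1, x_2),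
   X is the zero set of F, and Delta that of the discriminant of F. *)
Definition is_discriminant (pr : 'rV[C]_3 -> 'rV[C]_2)
    (X : set 'rV[C]_3) (Delta : set 'rV[C]_2) : Prop :=
  exists (A : 'M[C]_3) (F : 'rV[C]_2 -> {poly C}),
    [/\ A \in unitmx /\
        (forall x, pr x = lsubmx (x *m A : 'rV[C]_(2 + 1))),
        weierstrass F,
        reduced_germ (weierstrass_fun F),
        germ_eq X [set x | weierstrass_fun F (x *m A) = 0]
      & germ_eq Delta [set y | discriminant (F y) = 0]].

Definition disk (r : R) : set C := [set t : C | `|t| <= (r%:C)%C].

Definition arc_germ (gamma : C -> 'rV[C]_2) : Prop :=
  [/\ holomorphic_germ gamma, gamma 0 = 0
    & exists2 r : R, 0 < r & {in disk r &, injective gamma}].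

(* gamma is an injective representative of its germ on [disk r]; the germ at 0
   of the arc-section below does not depend on such an r. *)
Definition arc_disk (gamma : C -> 'rV[C]_2) (Delta : set 'rV[C]_2)
    (r : R) : Prop :=
  [/\ 0 < r,
      forall t : C, disk r t -> \forall u \near t, differentiable gamma u,
      {in disk r &, injective gamma}
    & gamma @` disk r `<=` Delta \/ gamma @` disk r `&` Delta = [set 0]].

Definition arc_section (pr : 'rV[C]_3 -> 'rV[C]_2) (X : set 'rV[C]_3)
    (gamma : C -> 'rV[C]_2) (r : R) : set 'rV[C]_3 :=
  pr @^-1` (gamma @` disk r) `&` X.

(* The secant line through 0 and gamma t tends to the line spanned by v. *)
Definition tangent_vector (gamma : C -> 'rV[C]_2) (v : 'rV[C]_2) : Prop :=
  v != 0 /\ exists c : C -> C, c t *: gamma t @[t --> (0 : C)^'] --> v.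

Definition arc_tangent (gamma : C -> 'rV[C]_2) (Delta : set 'rV[C]_2) : Prop :=
  exists2 v, tangent_vector gamma v & tangent_cone Delta v.

End Germs.

(* Main.v *)
(* Let v be the tangent of the arc. If v is not in the tangent cone of Delta,
   then in coordinates y = t v + p v' the polynomial F y has simple roots in a
   punctured cone |p| < eps |t|, which contains the arc t = w^k, p = O(w^(k+1)).
   After the Tschirnhaus translation, let e i be the order at 0 of the
   coefficient of degree i. An irreducible arc-section forbids any splitting of
   the roots of F over the arc into two locally constant families.

   Put tau^f = t, where e/f = min (e i)/(d - i) <= 1, and divide the roots by
   tau^e. The rescaled polynomial has bounded coefficients, and cannot
   degenerate to 'X^d along the arc only: by a Harnack inequality for the
   differences of its roots, coalescence would spread from the arc to the whole
   cone. Hence some rescaled roots stay away from 0, so by irreducibility all of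
   them do. If e/f = 1, the rescaled polynomials along the arc tend to a
   polynomial with zero sum of roots other than 'X^d, hence with two distinct
   roots, and the roots split. So either all slopes are > 1, or the
   constant coefficient alone has the least degree n < d. The equation of X is
   then a nonzero product of linear forms plus terms of higher order, and the
   tangent cone is the union of the kernels of these forms. *)

Require Import Defs.
From HB Require Import structures.
From mathcomp Require Import all_boot all_order all_algebra.
From mathcomp Require Import complex separable ring lra zify.
From mathcomp Require Import all_classical all_reals all_analysis.
Set Implicit Arguments.
Unset Strict Implicit.
Unset Printing Implicit Defensive.
Import Order.TTheory GRing.Theory Num.Theory.
Import numFieldNormedType.Exports.
Local Open Scope classical_set_scope.
Local Open Scope ring_scope.
Import Normc.

(** * Moduli and complex differentiability *)

(** The leading form of a coefficient may vanish in the direction of the arc, so the orders [e i],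
    which are orders in both variables, cannot be read off the arc. The Harnack step repairs this:
    for fixed [t] the family is viewed over a disk of slopes [s = p / t], where one rescaled
    coefficient is close to a nonzero polynomial [Q] in [s]. [Q] is nonzero at some [s1] close to 0,
    and smallness of all coefficients on the arc would propagate to [s1]. For this, roots must be
    holomorphic on a fixed fraction of the given disk, independent of the polynomial and of its
    degree.

    The root [tau] of [t] has no holomorphic choice. Statements therefore hold for every [tau] with
    the right power, and only moduli, or powers that are single-valued in [w], are used.

    The analysis rests on the maximum principle: applied to difference quotients it gives the Cauchy
    estimates and removable singularities, applied to the inverse of a function it gives zeros. *)

Section ComplexModulus.
Context {R : realType}.
Local Notation C := (Cplx R).
Implicit Types (z w : C) (f g : C -> C).

(* The norm of C takes its values in C itself; [cabs] is the same norm with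
   values in the ordered field R. *)
Definition cabs z : R := complex.Re `|z|.

Lemma cabsE z : `|z| = ((cabs z)%:C)%C.
Proof.
by rewrite /cabs RRe_real // normr_real.
Qed.

Lemma cabs_normc z : cabs z = normc z.
Proof. by []. Qed.

Lemma cabs_ge0 z : 0 <= cabs z.
Proof. by rewrite -ler0c -cabsE normr_ge0. Qed.

Lemma cabsM z w : cabs (z * w) = cabs z * cabs w.
Proof. exact: normcM. Qed.

Lemma cabs0 : cabs 0 = 0. Proof. exact: normc0. Qed.

Lemma cabs1 : cabs 1 = 1. Proof. exact: normc1. Qed.

Lemma cabsN z : cabs (- z) = cabs z. Proof. exact: normcN. Qed.

Lemma cabsV z : cabs z^-1 = (cabs z)^-1. Proof. exact: normcV. Qed.

Lemma cabsX z n : cabs (z ^+ n) = cabs z ^+ n.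
Proof. by elim: n => [|n IH]; rewrite ?cabs1 // !exprS cabsM IH. Qed.

Lemma cabsD z w : cabs (z + w) <= cabs z + cabs w.
Proof. exact: le_normcD. Qed.

Lemma cabsB z w : cabs (z - w) <= cabs z + cabs w.
Proof. by rewrite -(cabsN w) cabsD. Qed.

Lemma cabs_subC z w : cabs (z - w) = cabs (w - z).
Proof. by rewrite -cabsN opprB. Qed.

Lemma cabs_triangle w z u : cabs (z - u) <= cabs (z - w) + cabs (w - u).
Proof. by apply: le_trans (cabsD _ _); rewrite addrA subrK. Qed.

Lemma cabs_le_add z w : cabs z <= cabs w + cabs (z - w).
Proof. by apply: le_trans (cabsD _ _); rewrite addrC subrK. Qed.

Lemma cabs_eq0 z : (cabs z == 0) = (z == 0).
Proof.
by apply/eqP/eqP => [/eq0_normc //|->]; exact: cabs0.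
Qed.

Lemma cabs_gt0 z : (0 < cabs z) = (z != 0).
Proof. by rewrite lt_def cabs_ge0 andbT cabs_eq0. Qed.

Lemma cabs_small0 z : (forall e : R, 0 < e -> cabs z <= e) -> z = 0.
Proof.
move=> h; apply/eqP; rewrite -cabs_eq0 eq_le cabs_ge0 andbT.
apply/ler_addgt0Pr => e e0; rewrite add0r; exact: h.
Qed.

Lemma cabsR (x : R) : cabs (x%:C)%C = `|x|.
Proof. by rewrite cabs_normc /= expr0n addr0 sqrtr_sqr. Qed.

Lemma cabs_nat n : cabs n%:R = n%:R.
Proof.
have -> : (n%:R : C) = ((n%:R : R)%:C)%C by rewrite rmorph_nat.
by rewrite cabsR ger0_norm.
Qed.

Lemma cabs_Re z : `|complex.Re z| <= cabs z.
Proof. by case: z => x y; rewrite cabs_normc -sqrtr_sqr ler_wsqrtr // lerDl sqr_ge0. Qed.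

Lemma cabs_Im z : `|complex.Im z| <= cabs z.
Proof. by case: z => x y; rewrite cabs_normc -sqrtr_sqr ler_wsqrtr // lerDr sqr_ge0. Qed.

Lemma cabs_ReIm z : cabs z <= `|complex.Re z| + `|complex.Im z|.
Proof.
have Ez : z = ((complex.Re z)%:C)%C + 'i%C * ((complex.Im z)%:C)%C := complexE z.
rewrite {1}Ez; apply: le_trans (cabsD _ _) _.
rewrite cabsM !cabsR.
have -> : cabs ('i%C : C) = 1 by rewrite cabs_normc /= expr0n expr1n add0r sqrtr1.
by rewrite mul1r.
Qed.

Lemma cabs_sum (I : Type) (s : seq I) (P : pred I) (F : I -> C) :
  cabs (\sum_(i <- s | P i) F i) <= \sum_(i <- s | P i) cabs (F i).
Proof.
elim/big_rec2 : _ => [|i x y _ h]; first by rewrite cabs0.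
exact: le_trans (cabsD _ _) (lerD _ _).
Qed.

Lemma cabs_prod (I : Type) (s : seq I) (P : pred I) (F : I -> C) :
  cabs (\prod_(i <- s | P i) F i) = \prod_(i <- s | P i) cabs (F i).
Proof. by elim/big_rec2 : _ => [|i x y _ <-]; rewrite ?cabs1 ?cabsM. Qed.

Lemma nearC (P : set C) z : nbhs z P <->
  exists2 d : R, 0 < d & forall x, cabs (x - z) < d -> P x.
Proof.
split=> [/nbhs_ballP[e /= e0 h]|[d d0 h]].
  have er : e = ((complex.Re e)%:C)%C by rewrite RRe_real // gtr0_real.
  exists (complex.Re e); first by rewrite -ltcR -er.
  move=> x hx; apply: h; rewrite /ball /= er cabsE ltcR.
  by rewrite cabs_subC.
apply/nbhs_ballP; exists (d%:C)%C => /=; first by rewrite ltcR.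
by move=> x; rewrite /ball /= cabsE ltcR cabs_subC => /h.
Qed.

Definition ccont f z := forall e : R, 0 < e ->
  exists2 d : R, 0 < d & forall x, cabs (x - z) < d -> cabs (f x - f z) < e.

Lemma ccontP f z : ccont f z <-> {for z, continuous f}.
Proof.
split=> [h|h e e0].
  apply/(@cvgrPdist_lt _ _ _ (nbhs z)) => e e0; apply/nearC.
  have er : e = ((complex.Re e)%:C)%C by rewrite RRe_real // gtr0_real.
  rewrite er ltcR in e0.
  have [d d0 hd] := h _ e0.
  exists d => // x /hd hx.
  by rewrite er cabsE ltcR cabs_subC.
have /cvgrPdist_lt/(_ (e%:C)%C) := h.
rewrite ltcR => /(_ e0)/nearC[d d0 hd].
exists d => // x /hd; rewrite cabsE ltcR cabs_subC; exact.
Qed.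

(* A wrapper that keeps unification from unfolding [differentiable]. *)
Variant hol f z : Prop := Hol of differentiable (f : C -> C) (z : C).

Lemma holP f z : hol f z <-> exists l, forall e : R, 0 < e ->
  exists2 d : R, 0 < d & forall h, cabs h < d ->
    cabs (f (z + h) - f z - l * h) <= e * cabs h.
Proof.
split.
- move=> [/derivable1_diffP /cvg_ex[/= l hl]]; exists l => e e0.
  have /(_ (e%:C)%C) := (@cvgrPdist_le _ C _ _ (dnbhs_filter (0 : C))
    (fun h : C => h^-1 *: (f (h *: 1 + z) - f z)) l).1 hl.
  rewrite ltcR => /(_ e0) /nearC[d d0 hd].
  exists d => // h hd1.
  have [->|h0] := eqVneq h 0; first by rewrite addr0 mulr0 !subrr cabs0 mulr0.
  have := hd h; rewrite subr0 => /(_ hd1 h0).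
  rewrite /= cabsE lecR => hle.
  have -> : f (z + h) - f z - l * h =
      - (l - h^-1 *: (f (h *: 1 + z) - f z)) * h.
    rewrite [h *: 1]mulr1 (addrC h) [_ *: _]mulrC.
    by field.
  by rewrite cabsM cabsN ler_wpM2r // cabs_ge0.
- move=> [l hl]; split; apply/derivable1_diffP/cvg_ex; exists l.
  apply/(@cvgrPdist_le _ C _ _ (dnbhs_filter (0 : C))) => e e0; apply/nearC.
  have er : e = ((complex.Re e)%:C)%C by rewrite RRe_real // gtr0_real.
  rewrite er ltcR in e0 *.
  have [d d0 hd] := hl _ e0.
  exists d => // h; rewrite subr0 => /hd hle h0.
  rewrite /= er cabsE lecR.
  have -> : l - h^-1 *: (f (h *: 1 + z) - f z) =
      - (f (z + h) - f z - l * h) / h.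
    rewrite [h *: 1]mulr1 (addrC h) [_ *: _]mulrC.
    by field.
  by rewrite cabsM cabsN cabsV ler_pdivrMr // cabs_gt0.
Qed.

Lemma hol_ccont f z : hol f z -> ccont f z.
Proof. by move=> [/differentiable_continuous/ccontP]. Qed.

(** Caratheodory's criterion, with derivative [q z]: differentiability is reduced to continuity of
    an explicit quotient. It serves at exceptional points, for roots and for inverse functions. *)
Lemma hol_caratheodory f q z : (forall x, f x - f z = q x * (x - z)) ->
  ccont q z -> hol f z.
Proof.
move=> fq qc; apply/holP; exists (q z) => e e0.
have [d d0 hd] := qc _ e0; exists d => // h hh.
rewrite fq [z + h]addrC addrK -mulrBl cabsM ler_wpM2r ?cabs_ge0 //.
by apply/ltW/hd; rewrite addrK.
Qed.

Lemma hol_eq f g z : (exists2 d : R, 0 < d & forall x, cabs (x - z) < d -> f x = g x) ->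
  hol f z -> hol g z.
Proof.
move=> [d d0 fg] /holP[l hl]; apply/holP; exists l => e e0.
have [d' d'0 hd'] := hl _ e0.
exists (Num.min d d'); first by rewrite lt_min d0.
move=> h; rewrite lt_min => /andP[h1 h2].
rewrite -!fg ?subrr ?cabs0 //; first exact: hd'.
by rewrite addrC addKr.
Qed.

Lemma hol_ext f g z : (forall x, f x = g x) -> hol f z -> hol g z.
Proof. by move=> fg; rewrite (funext fg). Qed.

Lemma hol_cst (c : C) z : hol (fun=> c) z.
Proof. by split; exact: differentiable_cst. Qed.

Lemma hol_id z : hol id z. Proof. by split; exact: ex_diff. Qed.

Lemma holD f g z : hol f z -> hol g z -> hol (fun x => f x + g x) z.
Proof. by move=> [?] [?]; split; exact: differentiableD. Qed.

Lemma holB f g z : hol f z -> hol g z -> hol (fun x => f x - g x) z.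
Proof. by move=> [?] [?]; split; exact: differentiableB. Qed.

Lemma holM f g z : hol f z -> hol g z -> hol (fun x => f x * g x) z.
Proof. by move=> [?] [?]; split; exact: differentiableM. Qed.

Lemma holV f z : hol f z -> f z != 0 -> hol (fun x => (f x)^-1) z.
Proof. by move=> [?] ?; split; exact: differentiableV. Qed.

Lemma hol_div f g z : hol f z -> hol g z -> g z != 0 -> hol (fun x => f x / g x) z.
Proof. by move=> hf hg g0; exact: (holM hf (holV hg g0)). Qed.

Lemma holX f n z : hol f z -> hol (fun x => f x ^+ n) z.
Proof.
move=> hf; elim: n => [|n IH]; first exact: hol_cst.
by by apply: hol_ext (holM hf IH) => x; rewrite exprS.
Qed.

Lemma hol_sum (I : Type) (s : seq I) (P : pred I) (F : I -> C -> C) z :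
  (forall i, P i -> hol (F i) z) -> hol (fun x => \sum_(i <- s | P i) F i x) z.
Proof.
move=> hF; elim: s => [|i s IH]; first by apply: hol_ext (hol_cst 0 z) => x; rewrite big_nil.
case Pi : (P i).
  by apply: hol_ext (holD (hF _ Pi) IH) => x; rewrite big_cons Pi.
by apply: hol_ext IH => x; rewrite big_cons Pi.
Qed.

Lemma hol_prod (I : Type) (s : seq I) (P : pred I) (F : I -> C -> C) z :
  (forall i, P i -> hol (F i) z) -> hol (fun x => \prod_(i <- s | P i) F i x) z.
Proof.
move=> hF; elim: s => [|i s IH]; first by apply: hol_ext (hol_cst 1 z) => x; rewrite big_nil.
case Pi : (P i).
  by apply: hol_ext (holM (hF _ Pi) IH) => x; rewrite big_cons Pi.
by apply: hol_ext IH => x; rewrite big_cons Pi.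
Qed.

Lemma hol_comp f g z : hol f z -> hol g (f z) -> hol (fun x => g (f x)) z.
Proof. by move=> [hf] [hg]; exact: (Hol (differentiable_comp hf hg)). Qed.

End ComplexModulus.

(* [lra] compares its atoms up to conversion, which is slow on terms such as
   [cabs z]; generalizing them first and dropping the other hypotheses makes
   the comparison syntactic. *)
Ltac lra_prepare :=
  repeat match goal with
  | H : ?T |- _ =>
      lazymatch type of T with Prop => idtac end;
      lazymatch T with
      | is_true (leq _ _) => clear H
      | is_true (negb _) => clear H
      | is_true _ => fail
      | @eq (Real.sort _) _ _ => fail
      | _ => clear H
      end
  end.
Ltac cabs_atoms :=
  repeat match goal with
  | |- context [cabs ?z] => let a := fresh "a" in set (a := cabs z) in *; clearbody a
  | _ : context [cabs ?z] |- _ => let a := fresh "a" in set (a := cabs z) in *; clearbody a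
  end.
Ltac clra := first [solve [lra_prepare; cabs_atoms; lra] | lra].

(** * The maximum principle *)

Section Goursat.
Context {R : realType}.
Local Notation C := (Cplx R).
Local Notation "x %:CC" := ((x : R)%:C%C : C) (at level 2, format "x %:CC").

(* Trapezoidal sums on the 2 ^ n parts of [p, q], in place of a contour integral. *)
Fixpoint edge_sum n (g : C -> C) (p q : C) : C :=
  if n is m.+1 then edge_sum m g p ((p + q) / 2) + edge_sum m g ((p + q) / 2) q
  else (g p + g q) / 2 * (q - p).

Lemma edge_sumC n g p q : edge_sum n g q p = - edge_sum n g p q.
Proof.
elim: n p q => [|n IH] p q /=; first by ring.
rewrite (addrC q p) (IH ((p + q) / 2) q) (IH p ((p + q) / 2)); ring.
Qed.

Lemma edge_sum_shift n g p q u : (forall x, g (x + u) = g x) ->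
  edge_sum n g (p + u) (q + u) = edge_sum n g p q.
Proof.
move=> gu; elim: n p q => [|n IH] p q /=.
  by rewrite !gu; congr (_ * _); ring.
have -> : (p + u + (q + u)) / 2 = (p + q) / 2 + u by field.
by rewrite !IH.
Qed.

(** The trapezoidal rule is exact on affine functions, so only the deviation [e] of [g] from the
    affine map enters, multiplied by the total length of the parts. *)
Lemma edge_sum_affine n g p q (l m : C) (e : R) :
  (forall x : R, 0 <= x <= 1 ->
     let z := p + x%:CC * (q - p) in cabs (g z - (l * z + m)) <= e) ->
  cabs (edge_sum n g p q - (l * (q ^+ 2 - p ^+ 2) / 2 + m * (q - p)))
    <= e * cabs (q - p).
Proof.
have half01 (x : R) : 0 <= x <= 1 -> 0 <= x / 2 <= 1 /\ 0 <= x / 2 + 1 / 2 <= 1.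
  by move=> /andP[x0 x1]; split; apply/andP; split; lra.
elim: n p q => [|n IH] p q h /=.
  have h0 := h 0; have h1 := h 1.
  rewrite /= rmorph0 mul0r addr0 in h0; rewrite /= rmorph1 mul1r subrKC in h1.
  have -> : (g p + g q) / 2 * (q - p) - (l * (q ^+ 2 - p ^+ 2) / 2 + m * (q - p))
     = ((g p - (l * p + m)) + (g q - (l * q + m))) * ((q - p) / 2) by field.
  rewrite !cabsM cabsV cabs_nat.
  rewrite [_ * (_ * _)]mulrCA mulrC ler_wpM2r ?cabs_ge0 //.
  rewrite ler_pdivrMr //; apply: le_trans (cabsD _ _) _.
  have := h0; rewrite lexx ler01 => /(_ isT) {}h0.
  have := h1; rewrite lexx ler01 => /(_ isT) {}h1.
  by lra.
set r := (p + q) / 2.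
have rp : r - p = (q - p) / 2 by rewrite /r; field.
have qr : q - r = (q - p) / 2 by rewrite /r; field.
have c2 : cabs ((q - p) / 2) = cabs (q - p) / 2 by rewrite cabsM cabsV cabs_nat.
have := IH p r; rewrite rp c2 => h1.
have := IH r q; rewrite qr c2 => h2.
have {}h1 := h1 _; have {}h2 := h2 _.
have -> : edge_sum n g p r + edge_sum n g r q -
   (l * (q ^+ 2 - p ^+ 2) / 2 + m * (q - p)) =
   (edge_sum n g p r - (l * (r ^+ 2 - p ^+ 2) / 2 + m * ((q - p) / 2))) +
   (edge_sum n g r q - (l * (q ^+ 2 - r ^+ 2) / 2 + m * ((q - p) / 2))) by field.
apply: le_trans (cabsD _ _) _.
suff [k1 k2] : cabs (edge_sum n g p r - (l * (r ^+ 2 - p ^+ 2) / 2 + m * ((q - p) / 2)))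
  <= e * (cabs (q - p) / 2) /\
  cabs (edge_sum n g r q - (l * (q ^+ 2 - r ^+ 2) / 2 + m * ((q - p) / 2)))
  <= e * (cabs (q - p) / 2) by clra.
split.
  apply: h1 => x /half01[hx _].
  have := h _ hx; rewrite (_ : p + (x / 2)%:CC * (q - p) = p + x%:CC * ((q - p) / 2)) //.
  by rewrite rmorphM fmorphV rmorph_nat; field.
apply: h2 => x /half01[_ hx].
have := h _ hx.
rewrite (_ : p + (x / 2 + 1 / 2)%:CC * (q - p) = r + x%:CC * ((q - p) / 2)) //.
by rewrite rmorphD !rmorphM fmorphV rmorph_nat rmorph1 /r; field.
Qed.

Definition box_sum n g (w a b : C) : C :=
  edge_sum n g w (w + a) + edge_sum n g (w + a) (w + a + b)
  + edge_sum n g (w + a + b) (w + b) + edge_sum n g (w + b) w.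

(** Each inner edge is run through twice in opposite directions, so only the outer boundary survives
    in the sum over the four quarters. *)
Lemma box_sumS n g w a b :
  box_sum n.+1 g w a b =
    box_sum n g w (a / 2) (b / 2) + box_sum n g (w + a / 2) (a / 2) (b / 2)
  + box_sum n g (w + b / 2) (a / 2) (b / 2)
  + box_sum n g (w + a / 2 + b / 2) (a / 2) (b / 2).
Proof.
rewrite /box_sum /=.
rewrite -(_ : (w + (w + a)) / 2 = w + a / 2); last by field.
rewrite (_ : (w + a + (w + a + b)) / 2 = w + a + b / 2); last by field.
rewrite (_ : (w + a + b + (w + b)) / 2 = (w + (w + a)) / 2 + b); last by field.
rewrite (_ : (w + b + w) / 2 = w + b / 2); last by field.
set u := (w + (w + a)) / 2.
rewrite (_ : u + a / 2 = w + a); last by rewrite /u; field.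
rewrite (_ : w + b / 2 + a / 2 = u + b / 2); last by rewrite /u; field.
rewrite (_ : u + b / 2 + a / 2 = w + a + b / 2); last by rewrite /u; field.
rewrite (_ : u + b / 2 + b / 2 = u + b); last by field.
rewrite (_ : w + b / 2 + b / 2 = w + b); last by field.
rewrite (_ : w + a + b / 2 + b / 2 = w + a + b); last by field.
rewrite (edge_sumC n g (u + b / 2) u) (edge_sumC n g (u + b / 2) (w + b / 2)).
rewrite (edge_sumC n g (w + a + b / 2) (u + b / 2)) (edge_sumC n g (u + b) (u + b / 2)).
ring.
Qed.

(** The exact integrals of the affine map cancel around the boundary; the factor
    [2 * (cabs a + cabs b)] is the perimeter. *)
Lemma box_sum_affine n g w a b (l m : C) (e : R) :
  (forall x y : R, 0 <= x <= 1 -> 0 <= y <= 1 ->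
     let z := w + x%:CC * a + y%:CC * b in cabs (g z - (l * z + m)) <= e) ->
  cabs (box_sum n g w a b) <= e * (2 * (cabs a + cabs b)).
Proof.
move=> h.
have z01 : 0 <= (0 : R) <= 1 by rewrite lexx ler01.
have o01 : 0 <= (1 : R) <= 1 by rewrite lexx ler01.
have e1 : cabs (edge_sum n g w (w + a) -
   (l * ((w + a) ^+ 2 - w ^+ 2) / 2 + m * (w + a - w))) <= e * cabs (w + a - w).
  apply: edge_sum_affine => x hx /=; have := h x 0 hx z01.
  by rewrite /= rmorph0 mul0r addr0 [w + a - w]addrC addKr.
have e2 : cabs (edge_sum n g (w + a) (w + a + b) -
   (l * ((w + a + b) ^+ 2 - (w + a) ^+ 2) / 2 + m * (w + a + b - (w + a))))
     <= e * cabs (w + a + b - (w + a)).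
  apply: edge_sum_affine => x hx /=; have := h 1 x o01 hx.
  by rewrite /= rmorph1 mul1r [w + a + b - _]addrC addKr.
have e3 : cabs (edge_sum n g (w + b) (w + a + b) -
   (l * ((w + a + b) ^+ 2 - (w + b) ^+ 2) / 2 + m * (w + a + b - (w + b))))
     <= e * cabs (w + a + b - (w + b)).
  apply: edge_sum_affine => x hx /=; have := h x 1 hx o01.
  rewrite /= rmorph1 mul1r (_ : w + a + b - (w + b) = a); last by ring.
  by rewrite addrAC.
have e4 : cabs (edge_sum n g w (w + b) -
   (l * ((w + b) ^+ 2 - w ^+ 2) / 2 + m * (w + b - w))) <= e * cabs (w + b - w).
  apply: edge_sum_affine => x hx /=; have := h 0 x z01 hx.
  by rewrite /= rmorph0 mul0r addr0 [w + b - w]addrC addKr.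
rewrite /box_sum (edge_sumC n g (w + b) (w + a + b)) (edge_sumC n g w (w + b)).
move: e1 e2 e3 e4.
rewrite (_ : w + a - w = a); last by ring.
rewrite (_ : w + b - w = b); last by ring.
rewrite (_ : w + a + b - (w + a) = b); last by ring.
rewrite (_ : w + a + b - (w + b) = a); last by ring.
set E1 := edge_sum _ _ _ _; set E2 := edge_sum _ _ _ _.
set E3 := edge_sum _ _ _ _; set E4 := edge_sum _ _ _ _.
set A1 := (X in E1 - X); set A2 := (X in E2 - X).
set A3 := (X in E3 - X); set A4 := (X in E4 - X) => e1 e2 e3 e4.
have -> : E1 + E2 - E3 - E4 = (E1 - A1) + (E2 - A2) - (E3 - A3) - (E4 - A4).
  by rewrite /A1 /A2 /A3 /A4; field.
apply: le_trans (cabsB _ _) _.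
apply: le_trans (lerD (cabsB _ _) (lexx _)) _.
apply: le_trans (lerD (lerD (cabsD _ _) (lexx _)) (lexx _)) _.
by lra.
Qed.

(** Goursat's bisection. A box sum depends on the level [n], so the property handed down to a
    quarter is a lower bound for arbitrarily large [n]; no limit of the sums is taken. *)
Lemma goursat g w a b :
  (forall x y : R, 0 <= x <= 1 -> 0 <= y <= 1 -> hol g (w + x%:CC * a + y%:CC * b)) ->
  forall c : R, 0 < c -> exists N, forall n, (N <= n)%N -> cabs (box_sum n g w a b) <= c.
Proof.
move=> hg c c0; apply: contrapT => /forallNP nh.
pose h k : R := 2^-1 ^+ k.
have h0 k : 0 < h k by rewrite exprn_gt0 // invr_gt0.
have hS k : h k.+1 = h k / 2 by rewrite /h exprSr.
pose P k (x : R * R) := forall N, exists2 n, (N <= n)%N &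
  c * h k ^+ 2 < cabs (box_sum n g (w + x.1%:CC * a + x.2%:CC * b)
                      ((h k)%:CC * a) ((h k)%:CC * b)).
have P0 : P 0%N (0, 0).
  move=> N; have /existsNP[n /not_implyP[Nn /negP]] := nh N.
  rewrite -ltNge => hn; exists n => //.
  by rewrite /h /= expr0 expr1n mulr1 rmorph1 rmorph0 !mul0r !addr0 !mul1r.
have PS k x : exists y, P k x -> [/\ P k.+1 y, x.1 <= y.1 <= x.1 + h k.+1
    & x.2 <= y.2 <= x.2 + h k.+1].
  have [Pk|] := pselect (P k x); last by exists (0, 0).
  pose u := h k.+1.
  have u0 : 0 < u := h0 _.
  apply: contrapT => /forallNP nex.
  (* If all four quarters failed, every sum beyond the four thresholds would be bounded, and the big
     box would fail as well. *)
  have nP y : x.1 <= y.1 <= x.1 + u -> x.2 <= y.2 <= x.2 + u ->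
     exists N, forall n, (N <= n)%N ->
     cabs (box_sum n g (w + y.1%:CC * a + y.2%:CC * b)
         (u%:CC * a) (u%:CC * b)) <= c * u ^+ 2.
    move=> y1 y2; have /not_implyP[_ hN] := nex y.
    have /existsNP[N hN'] : ~ P k.+1 y by move=> Py; apply: hN; split.
    exists N => n Nn; rewrite leNgt; apply/negP => hlt.
    by apply: hN'; exists n.
  have [N1 H1] := nP (x.1, x.2) ltac:(rewrite /=; lra) ltac:(rewrite /=; lra).
  have [N2 H2] := nP (x.1 + u, x.2) ltac:(rewrite /=; lra) ltac:(rewrite /=; lra).
  have [N3 H3] := nP (x.1, x.2 + u) ltac:(rewrite /=; lra) ltac:(rewrite /=; lra).
  have [N4 H4] := nP (x.1 + u, x.2 + u) ltac:(rewrite /=; clra) ltac:(rewrite /=; clra).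
  have [[|n]] := Pk (N1 + N2 + N3 + N4).+1; first by rewrite ltn0.
  rewrite ltnS => Nn.
  have {}H1 := H1 n ltac:(lia); have {}H2 := H2 n ltac:(lia).
  have {}H3 := H3 n ltac:(lia); have {}H4 := H4 n ltac:(lia).
  apply/negP; rewrite -leNgt box_sumS.
  have hk : h k = 2 * u by rewrite /u hS; field.
  have E (v : C) : (h k)%:CC * v / 2 = u%:CC * v.
    by rewrite hk rmorphM rmorph_nat; field.
  rewrite !E; move: H1 H2 H3 H4; rewrite /= !rmorphD /= => H1 H2 H3 H4.
  rewrite hk.
  have -> : w + x.1%:CC * a + x.2%:CC * b + u%:CC * a =
     w + (x.1%:CC + u%:CC) * a + x.2%:CC * b by ring.
  have -> : w + x.1%:CC * a + x.2%:CC * b + u%:CC * b =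
     w + x.1%:CC * a + (x.2%:CC + u%:CC) * b by ring.
  have -> : w + (x.1%:CC + u%:CC) * a + x.2%:CC * b + u%:CC * b =
     w + (x.1%:CC + u%:CC) * a + (x.2%:CC + u%:CC) * b by ring.
  apply: le_trans (cabsD _ _) _.
  apply: le_trans (lerD (cabsD _ _) (lexx _)) _.
  apply: le_trans (lerD (lerD (cabsD _ _) (lexx _)) (lexx _)) _.
  have -> : c * (2 * u) ^+ 2 = c * u ^+ 2 + c * u ^+ 2 + c * u ^+ 2 + c * u ^+ 2 by ring.
  by rewrite !lerD.
have [nxt hnxt] : {nxt : nat -> R * R -> R * R & forall k x, P k x ->
    [/\ P k.+1 (nxt k x), x.1 <= (nxt k x).1 <= x.1 + h k.+1
    & x.2 <= (nxt k x).2 <= x.2 + h k.+1]}.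
  have hc (kx : nat * (R * R)) : exists y, P kx.1 kx.2 ->
    [/\ P kx.1.+1 y, kx.2.1 <= y.1 <= kx.2.1 + h kx.1.+1
    & kx.2.2 <= y.2 <= kx.2.2 + h kx.1.+1] by exact: PS.
  have [f hf] := choice hc.
  by exists (fun k x => f (k, x)) => k x; exact: (hf (k, x)).
pose X := fix X k := if k is k'.+1 then nxt k' (X k') else (0, 0).
have PX k : P k (X k).
  by elim: k => [|k /hnxt[]].
(* Nested intervals: a left end increases by at most the next halved length, so the supremum of the
   left ends lies in all intervals. *)
have mono (u : nat -> R) : (forall k, u k <= u k.+1 <= u k + h k.+1) ->
    exists s, forall k, u k <= s <= u k + h k.
  move=> hu.
  have le_u k j : u k <= u (k + j)%N /\ u (k + j)%N + h (k + j)%N <= u k + h k.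
    elim: j => [|j [i1 i2]]; first by rewrite addn0.
    by rewrite addnS; have /andP[]:= hu (k + j)%N; rewrite hS; split; lra.
  have ub k m : u m <= u k + h k.
    have [km|mk] := leqP k m.
      have [_] := le_u k (m - k)%N; rewrite subnKC //; have := h0 m; lra.
    have [+ _] := le_u m (k - m)%N; rewrite subnKC 1?ltnW //; have := h0 k; lra.
  exists (sup (range u)) => k; apply/andP; split.
    apply: ub_le_sup; last by exists k.
    by exists (u 0%N + h 0%N) => _ [m _ <-].
  by apply: ge_sup => [|_ [m _ <-]]; [exists (u 0%N); exists 0%N|].
have [s hs] := mono (fun k => (X k).1) ltac:(by move=> k; have [] := hnxt _ _ (PX k)).
have [t ht] := mono (fun k => (X k).2) ltac:(by move=> k; have [] := hnxt _ _ (PX k)).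
pose z0 := w + s%:CC * a + t%:CC * b.
have X0 k : 0 <= (X k).1 /\ (X k).1 + h k <= 1 /\ 0 <= (X k).2 /\ (X k).2 + h k <= 1.
  elim: k => [|k]; first by rewrite /h /= expr0 add0r lexx.
  have [_ /andP[? ?] /andP[? ?]] := hnxt _ _ (PX k).
  have := hS k; rewrite /=; lra.
have /holP[l hl] : hol g z0.
  by apply: hg; [have := hs 0%N|have := ht 0%N]; rewrite /= /h expr0 add0r.
pose L : R := cabs a + cabs b.
have L0 : 0 <= L by rewrite addr_ge0 ?cabs_ge0.
(* With this [e], the affine error [e * (L * h k)] times the perimeter [2 * (h k * L)] is at most
   [c * h k ^+ 2], against [P k]. *)
pose e : R := c / (2 * (L ^+ 2 + 1)).
have L20 := sqr_ge0 L.
have e0 : 0 < e by rewrite divr_gt0 // mulr_gt0 //; lra.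
have [d d0 hd] := hl _ e0.
have [k hk] : exists k, L * h k < d.
  have hcv : (fun k => h k) @ \oo --> (0 : R).
    by apply: cvg_expr; rewrite ger0_norm //; lra.
  have /cvgrPdist_lt/(_ (d / (L + 1))) := hcv.
  have dL : 0 < d / (L + 1) by rewrite divr_gt0 //; lra.
  move=> /(_ dL)[k _ /(_ k (leqnn k))] /=; rewrite sub0r normrN ger0_norm; last exact/ltW.
  rewrite ltr_pdivlMr; last by lra.
  by move=> hk; exists k; apply: le_lt_trans hk; rewrite mulrC ler_wpM2l ?ltW //; lra.
have [n _] := PX k 0%N; apply/negP; rewrite -leNgt.
have -> : g = (fun z => g z) by [].
have hb := @box_sum_affine n g (w + (X k).1%:CC * a + (X k).2%:CC * b)
   ((h k)%:CC * a) ((h k)%:CC * b) l (g z0 - l * z0) (e * (L * h k)).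
apply: le_trans (hb _) _; last first.
  rewrite !cabsM cabsR (ger0_norm (ltW (h0 _))) -mulrDr -/L.
  have -> : e * (L * h k) * (2 * (h k * L)) = (e * 2 * L ^+ 2) * h k ^+ 2 by ring.
  rewrite ler_wpM2r ?sqr_ge0 // /e.
  have -> : c / (2 * (L ^+ 2 + 1)) * 2 * L ^+ 2 = c * (L ^+ 2 / (L ^+ 2 + 1)).
    by field; clra.
  by apply: ler_piMr; [exact: ltW|rewrite ler_pdivrMr; clra].
move=> x y hx hy /=; set z := (X in g X).
pose dd := ((X k).1 + x * h k - s)%:CC * a + ((X k).2 + y * h k - t)%:CC * b.
have zd : z = z0 + dd.
  by rewrite /z /z0 /dd !(rmorphB, rmorphD, rmorphM) /=; ring.
have hdd : cabs dd <= L * h k.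
  apply: le_trans (cabsD _ _) _; rewrite !cabsM !cabsR mulrDl.
  have hx1 : 0 <= x * h k <= h k.
    by move: hx (h0 k) => /andP[x0 x1] hk0; rewrite mulr_ge0 ?ler_piMl // ltW.
  have hy1 : 0 <= y * h k <= h k.
    by move: hy (h0 k) => /andP[x0 x1] hk0; rewrite mulr_ge0 ?ler_piMl // ltW.
  apply: lerD; rewrite mulrC ler_wpM2l ?cabs_ge0 // ler_norml.
    by have := hs k; rewrite /=; clra.
  by have := ht k; rewrite /=; clra.
have := hd dd (le_lt_trans hdd hk); rewrite -zd.
have -> : g z - (l * z + (g z0 - l * z0)) = g z - g z0 - l * dd by rewrite zd; ring.
move=> hle; apply: le_trans hle _.
by apply: ler_wpM2l => //; exact: ltW.
Qed.

End Goursat.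

Section MaximumPrinciple.
Context {R : realType}.
Local Notation C := (Cplx R).
Local Notation "x %:CC" := ((x : R)%:C%C : C) (at level 2, format "x %:CC").

Lemma is_derive_eps (f : R -> R) (x l : R) : is_derive x 1 f l ->
  forall e : R, 0 < e -> exists2 d : R, 0 < d & forall h, `|h| < d ->
    `|f (x + h) - f x - l * h| <= e * `|h|.
Proof.
move=> [/cvg_ex[/= l' hl'] dl] e e0.
have ll : l' = l by rewrite -dl; apply/esym/cvg_lim.
rewrite ll in hl'.
have := (@cvgrPdist_le _ _ _ _ (dnbhs_filter (0 : R)) _ _).1 hl' _ e0.
move=> /nbhs_ballP[d d0 hd]; exists d => // h hh.
have [->|h0] := eqVneq h 0; first by rewrite addr0 mulr0 !subrr normr0 mulr0.
have := hd h; rewrite /ball /= sub0r normrN => /(_ hh h0).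
rewrite (_ : l - _ = - (f (x + h) - f x - l * h) / h); last first.
  by rewrite [h *: 1]mulr1 (addrC h) [_ *: _]mulrC; field.
by rewrite normrM normrN normfV ler_pdivrMr // normr_gt0.
Qed.

Definition cexp (z : C) : C :=
  (expR (complex.Re z) * cos (complex.Im z) +i* (expR (complex.Re z) * sin (complex.Im z)))%C.

Lemma cexpD z w : cexp (z + w) = cexp z * cexp w.
Proof.
case: z w => [x y] [u v]; rewrite /cexp /= expRD cosD sinD.
by congr (_ +i* _)%C; ring.
Qed.

Lemma sqr_cabs (z : C) : cabs z ^+ 2 = complex.Re z ^+ 2 + complex.Im z ^+ 2.
Proof. by case: z => x y; rewrite cabs_normc /= sqr_sqrtr // addr_ge0 ?sqr_ge0. Qed.

Lemma cabs_cexp z : cabs (cexp z) = expR (complex.Re z).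
Proof.
apply/eqP; rewrite -(@eqrXn2 _ 2) ?cabs_ge0 ?expR_ge0 // sqr_cabs /=.
by rewrite !exprMn -mulrDr cos2Dsin2 mulr1.
Qed.

Lemma cexp_approx (e : R) : 0 < e -> exists2 d : R, 0 < d &
  forall h, cabs h < d -> cabs (cexp h - 1 - h) <= e * cabs h.
Proof.
move=> e0.
pose e1 := Num.min 1 (e / 10).
have e10 : 0 < e1 by rewrite lt_min ltr01 divr_gt0.
have e1e : e1 <= e / 10 by rewrite ge_min lexx orbT.
have e11 : e1 <= 1 by rewrite ge_min lexx.
have [d1 d10 h1] := is_derive_eps (is_derive_expR (0 : R)) e10.
have [d2 d20 h2] := is_derive_eps (is_derive_sin (0 : R)) e10.
have [d3 d30 h3] := is_derive_eps (is_derive_cos (0 : R)) e10.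
pose d := Num.min (Num.min d1 d2) (Num.min d3 (e1 / 2)).
exists d; first by rewrite !lt_min d10 d20 d30 divr_gt0.
move=> h; rewrite !lt_min => /andP[/andP[k1 k2] /andP[k3 k4]].
have := cabs_Re h; have := cabs_Im h.
set x := complex.Re h; set y := complex.Im h => hy hx.
have {}h1 := h1 x (le_lt_trans hx k1).
have {}h2 := h2 y (le_lt_trans hy k2).
have {}h3 := h3 y (le_lt_trans hy k3).
move: h1 h2 h3; rewrite !add0r expR0 cos0 sin0 mul1r subr0 oppr0 mul0r subr0 mul1r => h1 h2 h3.
have hE : cexp h - 1 - h =
   ((expR x * cos y - 1 - x) +i* (expR x * sin y - y))%C.
  have hh : h = (x +i* y)%C by rewrite /x /y; case: (h).
  rewrite {2}hh /cexp -/x -/y; apply/eqP; rewrite eq_complex /=.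
  by apply/andP; split; apply/eqP; ring.
rewrite hE; apply: le_trans (cabs_ReIm _) _ => /=.
have ch0 := cabs_ge0 h.
set H := cabs h in hx hy k1 k2 k3 k4 ch0 *.
have hx1 : `|x| * e1 <= H * e1 by rewrite ler_wpM2r // ltW.
have hy1 : `|y| * e1 <= H * e1 by rewrite ler_wpM2r // ltW.
have hH1 : H * e1 <= H by rewrite ler_piMr.
have hH2 : H * e1 <= H * (e / 10) by rewrite ler_wpM2l.
have ex1 : `|expR x - 1| <= 2 * H.
  have -> : expR x - 1 = (expR x - 1 - x) + x by ring.
  by apply: le_trans (ler_normD _ _) _; lra.
have ex2 : `|expR x| <= 2.
  have -> : expR x = (expR x - 1) + 1 by ring.
  by apply: le_trans (ler_normD _ _) _; rewrite normr1; clra.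
have t1 : `|expR x * cos y - 1 - x| <= 3 * (H * e1).
  have -> : expR x * cos y - 1 - x = expR x * (cos y - 1) + (expR x - 1 - x) by ring.
  apply: le_trans (ler_normD _ _) _; rewrite normrM.
  have : `|expR x| * `|cos y - 1| <= 2 * (e1 * `|y|) by apply: ler_pM.
  clra.
have t2 : `|expR x * sin y - y| <= 3 * (H * e1).
  have -> : expR x * sin y - y = expR x * (sin y - y) + (expR x - 1) * y by ring.
  apply: le_trans (ler_normD _ _) _; rewrite !normrM.
  have : `|expR x| * `|sin y - y| <= 2 * (e1 * `|y|) by apply: ler_pM.
  have : `|expR x - 1| * `|y| <= (2 * H) * H by apply: ler_pM.
  have : H * H <= H * (e1 / 2) by rewrite ler_wpM2l // ltW.
  clra.
have : 0 <= e * H by rewrite mulr_ge0 // ltW.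
clra.
Qed.

Lemma hol_cexp z : hol cexp z.
Proof.
apply/holP; exists (cexp z) => e e0.
have c0 : 0 < cabs (cexp z) by rewrite cabs_cexp expR_gt0.
have [d d0 hd] := cexp_approx (divr_gt0 e0 c0); exists d => // h /hd hh.
have -> : cexp (z + h) - cexp z - cexp z * h = cexp z * (cexp h - 1 - h).
  by rewrite cexpD; ring.
by rewrite cabsM -ler_pdivlMl // mulrA [_^-1 * e]mulrC.
Qed.

(** The mean value property without integrals: [goursat] for [f (r exp w)] on the rectangle with
    sides [L] and [2 pi i]. The horizontal sides cancel by periodicity, the right side is bounded by
    the values on the circle, and the left side is close to [2 pi i f(0)]. *)
Lemma cabs_center (f : C -> C) (r M : R) : 0 < r ->
  (forall z, cabs z <= r -> hol f z) ->
  (forall z, cabs z = r -> cabs (f z) <= M) -> cabs (f 0) <= M.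
Proof.
move=> r0 hf hM; apply/ler_addgt0Pr => e e0.
have e30 : 0 < e / 3 by rewrite divr_gt0.
have [|d d0 hd] := hol_ccont (hf 0 _) e30; first by rewrite cabs0 ltW.
(* [expR L >= 1 + L > r / d] brings the left side within [d] of 0. *)
pose L := r / d.
have L0 : 0 < L by rewrite divr_gt0.
have expL : r * expR (- L) < d.
  rewrite expRN -ltr_pdivlMr ?invr_gt0 ?expR_gt0 // invrK mulrC.
  rewrite -ltr_pdivrMr // -/L; apply: lt_le_trans (expR_ge1Dx _); lra.
pose b : C := (0 +i* (pi *+ 2))%C.
pose g w := f (r%:CC * cexp w).
have cexpb w : cexp (w + b) = cexp w.
  rewrite cexpD (_ : cexp b = 1) ?mulr1 //.
  by rewrite /cexp /= expR0 cos2pi sin2pi mulr1 mulr0.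
have cb : cabs b = 2 * pi.
  rewrite cabs_normc /= expr0n add0r sqrtr_sqr (_ : pi *+ 2 = 2 * pi) ?mulr_natl //.
  by rewrite ger0_norm // mulrn_wge0 // pi_ge0.
have pi0 := pi_gt0 R.
have crR w : cabs (r%:CC * cexp w) = r * expR (complex.Re w).
  by rewrite cabsM cabsR cabs_cexp ger0_norm // ltW.
have ReR (x : R) (w : C) : complex.Re (x%:CC * w) = x * complex.Re w.
  by case: w => u v /=; rewrite mul0r subr0.
have hg (x y : R) : 0 <= x <= 1 -> 0 <= y <= 1 ->
    hol g (- L%:CC + x%:CC * L%:CC + y%:CC * b).
  move=> /andP[x0 x1] _; apply: hol_comp.
    by apply: holM; [exact: hol_cst|exact: hol_cexp].
  apply: hf; rewrite crR.
  have -> : complex.Re (- L%:CC + x%:CC * L%:CC + y%:CC * b) = - L + x * L.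
    rewrite !raddfD /= !mul0r !mulr0 !subr0; ring.
  rewrite -[leRHS]mulr1 ler_pM2l // -expR0 ler_expR.
  have : x * L <= 1 * L by rewrite ler_wpM2r // ltW.
  lra.
have [|N /(_ N (leqnn N))] := goursat hg (c := (2 * pi) * (e / 3)).
  by rewrite mulr_gt0 // mulr_gt0.
rewrite /box_sum.
rewrite (_ : - L%:CC + L%:CC = 0); last by ring.
rewrite add0r.
have hs : edge_sum N g (- L%:CC + b) b = edge_sum N g (- L%:CC) 0.
  rewrite -[RHS](@edge_sum_shift _ N g (- L%:CC) 0 b) ?add0r // => x.
  by rewrite /g cexpb.
rewrite (edge_sumC N g (- L%:CC + b) b) hs (edge_sumC N g (- L%:CC)).
have e1 := @edge_sum_affine _ N g 0 b 0 0 M.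
have e2 := @edge_sum_affine _ N g (- L%:CC) (- L%:CC + b) 0 (f 0) (e / 3).
move: e1 e2.
rewrite subr0 (_ : - L%:CC + b - - L%:CC = b); last by ring.
rewrite !mul0r !add0r subr0 => e1 e2.
have {}e1 : cabs (edge_sum N g 0 b) <= M * cabs b.
  apply: e1 => x hx /=; rewrite mul0r !addr0 add0r subr0 /g; apply: hM.
  by rewrite crR ReR /= mulr0 expR0 mulr1.
have {}e2 : cabs (edge_sum N g (- L%:CC) (- L%:CC + b) - f 0 * b) <= e / 3 * cabs b.
  apply: e2 => x hx /=; rewrite mul0r add0r /g; apply/ltW/hd.
  by rewrite subr0 crR raddfD /= !mul0r mulr0 subr0 addr0.
set E1 := edge_sum _ _ _ 0; set E2 := edge_sum _ _ 0 _ in e1 *.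
set E3 := edge_sum _ _ _ _ in e2 *.
rewrite (_ : E1 + E2 - E1 - E3 = E2 - E3); last by ring.
move=> e3.
have : cabs (f 0 * b) <= M * cabs b + (e / 3 * cabs b) + (2 * pi) * (e / 3).
  have -> : f 0 * b = E2 - (E3 - f 0 * b) - (E2 - E3) by ring.
  apply: le_trans (cabsB _ _) _; apply: lerD => //.
  by apply: le_trans (cabsB _ _) _; apply: lerD.
rewrite cabsM cb => h.
rewrite -(@ler_pM2r _ (2 * pi)); last by rewrite mulr_gt0.
have : 0 < pi * e by rewrite mulr_gt0.
clra.
Qed.

(** A Moebius map of the disk sends 0 to [a] and preserves the circle, which reduces the bound at
    [a] to the one at the centre. *)
Lemma cabs_disk0 (f : C -> C) (r M : R) : 0 < r ->
  (forall z, cabs z <= r -> hol f z) ->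
  (forall z, cabs z = r -> cabs (f z) <= M) ->
  forall a, cabs a < r -> cabs (f a) <= M.
Proof.
move=> r0 hf hM a ar.
have rC0 : r%:CC != 0 by rewrite -cabs_eq0 cabsR normr_eq0 gt_eqF.
pose al := a / r%:CC.
pose be : C := (complex.Re al -i* complex.Im al)%C.
have al1 : cabs al < 1 by rewrite /al cabsM cabsV cabsR gtr0_norm // ltr_pdivrMr // mul1r.
have be1 : cabs be < 1.
  suff -> : cabs be = cabs al by [].
  apply/eqP; rewrite -(@eqrXn2 _ 2) ?cabs_ge0 // !sqr_cabs /=; apply/eqP; ring.
have den z : cabs z <= 1 -> 1 + be * z != 0.
  move=> z1; apply/eqP => h.
  have : cabs (be * z) = 1.
    have -> : be * z = - 1 + (1 + be * z) by ring.
    by rewrite h addr0 cabsN cabs1.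
  rewrite cabsM => h'; have := cabs_ge0 be; have := cabs_ge0 z; nra.
have key z : cabs (1 + be * z) ^+ 2 - cabs (z + al) ^+ 2 =
    (1 - cabs al ^+ 2) * (1 - cabs z ^+ 2).
  rewrite !sqr_cabs /be; case: z al {al1 be be1 den} => [x y] [u v] /=.
  ring.
have le2 z : cabs z <= 1 -> cabs (z + al) <= cabs (1 + be * z).
  move=> z1; rewrite -(@ler_pXn2r _ 2) ?nnegrE ?cabs_ge0 // -subr_ge0 key.
  by rewrite mulr_ge0 // subr_ge0 expr_le1 ?cabs_ge0 // ltW.
have eq2 z : cabs z = 1 -> cabs (z + al) = cabs (1 + be * z).
  move=> z1; apply/eqP; rewrite -(@eqrXn2 _ 2) ?cabs_ge0 //.
  by rewrite eq_sym -subr_eq0 key z1 expr1n subrr mulr0.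
pose phi z := r%:CC * ((z + al) / (1 + be * z)).
have cphi z : cabs (phi z) = r * (cabs (z + al) / cabs (1 + be * z)).
  by rewrite /phi !cabsM cabsV cabsR gtr0_norm.
have := @cabs_center (fun z => f (phi z)) 1 M ltr01.
rewrite /phi mulr0 addr0 add0r divr1 /al mulrCA divff // mulr1; apply.
- move=> z z1; apply: (@hol_comp _ phi f).
    apply: holM; first exact: hol_cst.
    apply: hol_div; last exact: den.
      by apply: holD; [exact: hol_id|exact: hol_cst].
    apply: holD; first exact: hol_cst.
    by apply: holM; [exact: hol_cst|exact: hol_id].
  apply: hf; rewrite cphi ger_pMr // ler_pdivrMr ?mul1r ?le2 //.
  by rewrite cabs_gt0 den.
- move=> z z1; apply: hM; rewrite cphi eq2 // divff ?mulr1 //.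
  by rewrite cabs_eq0 den // z1.
Qed.

Theorem maximum_principle (f : C -> C) (c : C) (r M : R) :
  (forall z, cabs (z - c) <= r -> hol f z) ->
  (forall z, cabs (z - c) = r -> cabs (f z) <= M) ->
  forall z, cabs (z - c) <= r -> cabs (f z) <= M.
Proof.
move=> hf hM z; rewrite le_eqVlt => /predU1P[/hM //|zr].
have r0 : 0 < r by apply: le_lt_trans zr; exact: cabs_ge0.
have := @cabs_disk0 (fun z => f (z + c)) r M r0 _ _ (z - c) zr.
rewrite subrK; apply.
- move=> w wr; apply: (@hol_comp _ (fun w => w + c) f).
    by apply: holD; [exact: hol_id|exact: hol_cst].
  by apply: hf; rewrite addrK.
- by move=> w wr; apply: hM; rewrite addrK.
Qed.

Lemma ccontM (g h : C -> C) z : ccont g z -> ccont h z -> ccont (fun x => g x * h x) z.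
Proof.
move=> gc hc e e0; pose K := 1 + cabs (g z) + cabs (h z).
have K1 : 1 <= K by rewrite /K -addrA lerDl addr_ge0 ?cabs_ge0.
pose u := Num.min 1 (e / K).
have u0 : 0 < u by rewrite lt_min ltr01 divr_gt0 //; lra.
have u1 : u <= 1 by rewrite ge_min lexx.
have uK : u * K <= e by rewrite -ler_pdivlMr ?ge_min ?lexx ?orbT //; lra.
have [d d0 hd] := gc _ u0; have [d' d'0 hd'] := hc _ u0.
exists (Num.min d d'); first by rewrite lt_min d0.
move=> x; rewrite lt_min => /andP[/hd x1 /hd' x2].
have -> : g x * h x - g z * h z =
  (g x - g z) * (h x - h z) + (g z * (h x - h z) + (g x - g z) * h z) by ring.
apply: le_lt_trans (cabsD _ _) _.
apply: le_lt_trans (lerD (lexx _) (cabsD _ _)) _; rewrite !cabsM.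
apply: lt_le_trans uK; rewrite /K.
have a0 := cabs_ge0 (g z); have b0 := cabs_ge0 (h z).
have c0 := cabs_ge0 (g x - g z); have e1 := cabs_ge0 (h x - h z).
have : cabs (g x - g z) * cabs (h x - h z) <= cabs (g x - g z) * 1.
  by apply: ler_wpM2l => //; lra.
have : cabs (g z) * cabs (h x - h z) <= cabs (g z) * u by apply: ler_wpM2l => //; exact: ltW.
have : cabs (g x - g z) * cabs (h z) <= u * cabs (h z) by apply: ler_wpM2r => //; exact: ltW.
lra.
Qed.

Lemma ccontX (f : C -> C) n z : ccont f z -> ccont (fun x => f x ^+ n) z.
Proof.
move=> hf; elim: n => [|n IH].
  by move=> e e0; exists 1 => // x _; rewrite !expr0 subrr cabs0.
have -> : (fun x => f x ^+ n.+1) = (fun x => f x * f x ^+ n).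
  by apply: funext => x; rewrite exprS.
exact: ccontM.
Qed.

(** If [y < x], the powers of [y / x] tend to 0 and beat any constant. This removes the constants
    from an estimate that holds for all powers. *)
Lemma le_of_exprn_le (c K x y : R) : 0 < c -> 0 <= x -> 0 <= y ->
  (forall n, c * x ^+ n <= K * y ^+ n) -> x <= y.
Proof.
move=> c0 x0 y0 h; rewrite leNgt; apply/negP => yx.
have xp : 0 < x by exact: le_lt_trans yx.
have q1 : `|y / x| < 1 by rewrite ger0_norm ?divr_ge0 // ltr_pdivrMr // mul1r.
have K0 : 0 < K by have := h 0%N; rewrite !expr0 !mulr1; lra.
have /cvgrPdist_lt/(_ (c / K)) := cvg_expr q1.
rewrite divr_gt0 // => /(_ isT)[n _ /(_ n (leqnn n))] /=.
rewrite sub0r normrN ger0_norm ?exprn_ge0 ?divr_ge0 //.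
rewrite ltr_pdivlMr // expr_div_n -mulrAC ltr_pdivrMr ?exprn_gt0 //.
by have := h n; rewrite mulrC (mulrC K); lra.
Qed.

Lemma punctured_notin (s : seq C) (z : C) :
  exists2 d : R, 0 < d & forall w, w != z -> cabs (w - z) < d -> w \notin s.
Proof.
elim: s => [|e s [d d0 IH]]; first by exists 1.
have [->|ez] := eqVneq e z.
  by exists d => // w wz wd; rewrite inE negb_or wz IH.
exists (Num.min d (cabs (e - z))); first by rewrite lt_min d0 cabs_gt0 subr_eq0.
move=> w wz; rewrite lt_min => /andP[wd we]; rewrite inE negb_or IH // andbT.
by apply: contraTneq we => ->; rewrite ltxx.
Qed.

Lemma near_disk (c z : C) (r d : R) : 0 < d -> cabs (z - c) < r ->
  exists w, [/\ w != z, cabs (w - z) < d & cabs (w - c) < r].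
Proof.
move=> d0 zr.
pose h := Num.min (d / 2) ((r - cabs (z - c)) / 2).
have h0 : 0 < h by rewrite lt_min !divr_gt0 // subr_gt0.
have hd : h <= d / 2 by rewrite ge_min lexx.
have hr : h <= (r - cabs (z - c)) / 2 by rewrite ge_min lexx orbT.
have ch : cabs h%:CC = h by rewrite cabsR gtr0_norm.
exists (z + h%:CC); split.
- by rewrite -subr_eq0 addrC addKr -cabs_eq0 ch gt_eqF.
- by rewrite addrC addKr ch; lra.
- rewrite addrAC; apply: le_lt_trans (cabsD _ _) _; rewrite ch; lra.
Qed.

(* Multiplying a power of f by \prod_(e <- E) (z - e) removes the exceptional
   points; the extra factor disappears when the power tends to infinity. *)
Lemma maximum_principle_except (E : seq C) (f : C -> C) (c : C) (r M : R) :
  (forall z, cabs (z - c) <= r -> ccont f z) ->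
  (forall z, cabs (z - c) <= r -> z \notin E -> hol f z) ->
  (forall z, cabs (z - c) = r -> cabs (f z) <= M) ->
  forall z, cabs (z - c) <= r -> cabs (f z) <= M.
Proof.
move=> fc fh fM.
have step z : cabs (z - c) <= r -> z \notin E -> cabs (f z) <= M.
  move=> zr zE.
  pose H n x := (\prod_(e <- E) (x - e)) * f x ^+ n.
  have Hh n x : cabs (x - c) <= r -> hol (H n) x.
    move=> xr.
    have hp (s : seq C) : hol (fun x => \prod_(e <- s) (x - e)) x.
      by apply: hol_prod => e _; apply: holB; [exact: hol_id|exact: hol_cst].
    (* At an exceptional point the factor [y - x] splits off and leaves a continuous cofactor, which
       is enough for differentiability there. *)
    have [xE|xE] := boolP (x \in E); last by apply: holM => //; apply: holX; exact: fh.
    have pE y : \prod_(e <- E) (y - e) = (y - x) * \prod_(e <- rem x E) (y - e).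
      by rewrite (perm_big _ (perm_to_rem xE)) big_cons.
    apply: (@hol_caratheodory _ _ (fun y => (\prod_(e <- rem x E) (y - e)) * f y ^+ n)).
      by move=> y; rewrite /H !pE subrr; ring.
    apply: (@ccontM (fun y => \prod_(e <- rem x E) (y - e)) (fun y => f y ^+ n)).
      exact: hol_ccont.
    exact/ccontX/fc.
  pose K := \prod_(e <- E) (r + cabs (c - e)).
  have r0 : 0 <= r by apply: le_trans zr; exact: cabs_ge0.
  have M0 : 0 <= M.
    have wr : cabs (c + r%:CC - c) = r by rewrite addrC addKr cabsR ger0_norm.
    exact: le_trans (cabs_ge0 _) (fM _ wr).
  apply: (@le_of_exprn_le (cabs (\prod_(e <- E) (z - e))) K) => //.
  - rewrite cabs_gt0; apply/negP; rewrite prodf_seq_eq0 => /hasP[e eE /=].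
    by rewrite subr_eq0 => /eqP ze; move: zE; rewrite ze eE.
  - exact: cabs_ge0.
  - move=> n; rewrite -cabsX -cabsM.
    apply: (maximum_principle (f := H n)) zr => [x|x xr]; first exact: Hh.
    rewrite /H cabsM cabs_prod; apply: ler_pM; rewrite ?cabs_ge0 //.
    + by apply: prodr_ge0 => e _; exact: cabs_ge0.
    + rewrite /K; apply: ler_prod => e _; rewrite cabs_ge0 /=.
      by apply: le_trans (cabs_triangle c _ _) _; rewrite xr.
    + by rewrite cabsX lerXn2r ?nnegrE ?cabs_ge0 ?fM.
move=> z; rewrite le_eqVlt => /predU1P[/fM //|zr].
apply/ler_addgt0Pr => e e0.
have [d d0 hd] := fc z (ltW zr) _ e0.
have [d' d'0 hd'] := punctured_notin E z.
have [|w [wz wd wr]] := near_disk (d := Num.min d d') _ zr; first by rewrite lt_min d0.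
move: wd; rewrite lt_min => /andP[wd wd'].
have hw := step w (ltW wr) (hd' _ wz wd').
apply: le_trans (cabs_le_add _ (f w)) _; rewrite cabs_subC.
by have := hd _ wd; lra.
Qed.

End MaximumPrinciple.

(** * Cauchy estimates and expansions *)

Section CauchyEstimates.
Context {R : realType}.
Local Notation C := (Cplx R).

Let eqW (x y : R) : x = y -> x <= y. Proof. by move->. Qed.

Lemma ccont_eq (f g : C -> C) z :
  (exists2 d : R, 0 < d & forall x, cabs (x - z) < d -> f x = g x) ->
  ccont f z -> ccont g z.
Proof.
move=> [d d0 fg] fc e e0; have [d' d'0 hd'] := fc _ e0.
exists (Num.min d d'); first by rewrite lt_min d0.
move=> x; rewrite lt_min => /andP[/fg <- /hd'].
by rewrite -fg // subrr cabs0.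
Qed.

(** [q] is the difference quotient at [a], completed by the derivative. At [a] itself only its
    continuity is available so far; hence the maximum principle with exceptional points. *)
Lemma hol_quotient (f : C -> C) a : hol f a -> exists q : C -> C,
  [/\ forall x, f x - f a = q x * (x - a), ccont q a,
      forall z, z != a -> hol f z -> hol q z
    & forall z, z != a -> ccont f z -> ccont q z].
Proof.
move=> /holP[l hl].
pose q x := if x == a then l else (f x - f a) / (x - a).
have qE z : z != a -> exists2 d : R, 0 < d & forall x, cabs (x - z) < d ->
    (f x - f a) * (x - a)^-1 = q x.
  move=> za; exists (cabs (z - a)) => [|x xz]; first by rewrite cabs_gt0 subr_eq0.
  by rewrite /q; case: eqVneq => // xa; move: xz; rewrite xa cabs_subC ltxx.
exists q; split.
- move=> x; rewrite /q; have [->|xa] := eqVneq; first by rewrite !subrr mulr0.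
  by rewrite divfK // subr_eq0.
- move=> e e0; have e20 : 0 < e / 2 by rewrite divr_gt0.
  have [d d0 hd] := hl _ e20; exists d => // x xa.
  rewrite {2}/q eqxx /q; have [_|xna] := eqVneq; first by rewrite subrr cabs0.
  have := hd _ xa; rewrite [a + _]addrC subrK => h.
  have xa0 : x - a != 0 by rewrite subr_eq0.
  have -> : (f x - f a) / (x - a) - l = (f x - f a - l * (x - a)) / (x - a) by field.
  rewrite cabsM cabsV ltr_pdivrMr ?cabs_gt0 //; apply: le_lt_trans h _.
  by rewrite ltr_pM2r ?cabs_gt0 //; lra.
- move=> z za fz; apply: hol_eq (qE z za) _; apply: hol_div; last by rewrite subr_eq0.
    by apply: holB => //; exact: hol_cst.
  by apply: holB; [exact: hol_id|exact: hol_cst].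
- move=> z za fz; apply: ccont_eq (qE z za) _.
  apply: (@ccontM _ (fun x => f x - f a) (fun x => (x - a)^-1)).
    move=> e /fz[d d0 hd]; exists d => // x /hd.
    by rewrite opprB addrA subrK.
  apply: hol_ccont; apply: holV; last by rewrite subr_eq0.
  by apply: holB; [exact: hol_id|exact: hol_cst].
Qed.

Section Disk.
Variables (E : seq C) (f : C -> C) (c : C) (r M : R).
Hypotheses (r0 : 0 < r)
  (fc : forall z, cabs (z - c) <= r -> ccont f z)
  (fh : forall z, cabs (z - c) <= r -> z \notin E -> hol f z)
  (fM : forall z, cabs (z - c) = r -> cabs (f z) <= M).

Let far z a : cabs (z - c) = r -> cabs (a - c) <= r / 2 -> r / 2 <= cabs (z - a).
Proof. by move=> zr ar; have := cabs_triangle a z c; rewrite zr; lra. Qed.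

Let half z : cabs (z - c) <= r / 2 -> cabs (z - c) <= r.
Proof. by move=> h; move: r0; lra. Qed.

(** The maximum principle for the difference quotient at [a]: on the circle its numerator is at most
    [2 * M] and its denominator at least [r / 2]. *)
Lemma cauchy_lipschitz a x : cabs (a - c) <= r / 2 -> hol f a -> cabs (x - c) <= r ->
  cabs (f x - f a) <= 4 * M / r * cabs (x - a).
Proof.
move=> ar fa xr; have [q [fq qa qh qc]] := hol_quotient fa.
have fM' := maximum_principle_except fc fh fM.
suff : cabs (q x) <= 4 * M / r by rewrite fq cabsM => h; rewrite ler_wpM2r ?cabs_ge0.
apply: (@maximum_principle_except _ (a :: E) q c r) xr => [z zr|z zr|z zr].
- by have [->//|za] := eqVneq z a; apply: qc => //; exact: fc.
- by rewrite inE negb_or => /andP[za zE]; apply: qh => //; exact: fh.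
- have za := far zr ar.
  have : cabs (q z) * cabs (z - a) <= 2 * M.
    by rewrite -cabsM -fq; apply: le_trans (cabsB _ _) _;
       have := fM zr; have := fM' _ (half ar); lra.
  have : cabs (q z) * (r / 2) <= cabs (q z) * cabs (z - a) by rewrite ler_wpM2l ?cabs_ge0.
  by rewrite ler_pdivlMr //; lra.
Qed.

(** The difference of the quotients based at [a] and [b] is bounded on the circle by a multiple of
    [cabs (a - b)], hence also inside. This plays the part of a bound on the second derivative: the
    quotients at [x] form a Cauchy family as the base point varies. *)
Lemma cauchy_lipschitz2 a b x : cabs (a - c) <= r / 2 -> cabs (b - c) <= r / 2 ->
  hol f a -> hol f b -> cabs (x - c) <= r -> x != a -> x != b ->
  cabs ((f x - f a) / (x - a) - (f x - f b) / (x - b)) <= 16 * M / r ^+ 2 * cabs (a - b).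
Proof.
move=> ar br fa fb xr xa xb.
have [p [fp pa ph pc]] := hol_quotient fa.
have [q [fq qb qh qc]] := hol_quotient fb.
rewrite fp fq !mulfK ?subr_eq0 //.
apply: (@maximum_principle_except _ [:: a, b & E] (fun x => p x - q x) c r) xr
  => [z zr|z zr|z zr].
- have pz : ccont p z by have [->//|za] := eqVneq z a; apply: pc => //; exact: fc.
  have qz : ccont q z by have [->//|zb] := eqVneq z b; apply: qc => //; exact: fc.
  move=> e e0; have e20 : 0 < e / 2 by rewrite divr_gt0.
  have [d d0 hd] := pz _ e20; have [d' d'0 hd'] := qz _ e20.
  exists (Num.min d d'); first by rewrite lt_min d0.
  move=> y; rewrite lt_min => /andP[/hd h1 /hd' h2].
  have -> : p y - q y - (p z - q z) = (p y - p z) - (q y - q z) by ring.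
  by apply: le_lt_trans (cabsB _ _) _; lra.
- rewrite !inE !negb_or => /and3P[za zb zE].
  by apply: holB; [apply: ph|apply: qh] => //; exact: fh.
- have zb := far zr br.
  have lz := cauchy_lipschitz ar fa (eqW zr).
  have lb := cauchy_lipschitz ar fa (half br).
  have za0 : 0 < cabs (z - a) by have := far zr ar; have := r0; lra.
  have pz : cabs (p z) <= 4 * M / r by move: lz; rewrite fp cabsM ler_pM2r.
  have E1 : (p z - q z) * (z - b) = p z * (a - b) + (f b - f a).
    have := fp z; have := fq z => h1 h2.
    have -> : (p z - q z) * (z - b) = p z * (z - a) + p z * (a - b) - q z * (z - b) by ring.
    by rewrite -h1 -h2; ring.
  have h : cabs (p z - q z) * cabs (z - b) <= 8 * M / r * cabs (a - b).
    rewrite -cabsM E1; apply: le_trans (cabsD _ _) _; rewrite cabsM.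
    have : cabs (p z) * cabs (a - b) <= 4 * M / r * cabs (a - b).
      by rewrite ler_wpM2r ?cabs_ge0.
    by move: lb; rewrite (cabs_subC b a); lra.
  have : cabs (p z - q z) * (r / 2) <= cabs (p z - q z) * cabs (z - b).
    by rewrite ler_wpM2l ?cabs_ge0.
  have -> : 16 * M / r ^+ 2 * cabs (a - b) = (8 * M / r * cabs (a - b)) / (r / 2).
    by field; rewrite gt_eqF.
  rewrite ler_pdivlMr ?divr_gt0 //; clra.
Qed.

End Disk.

(** McShane's extension: the supremum of [u a - K * cabs (a - e)] is a Lipschitz value at [e]. Real
    and imaginary parts are extended separately, whence the factor 2. *)
Lemma lipschitz_limit (Q : C -> C) (P : C -> Prop) (K : R) e : 0 <= K ->
  (exists a, P a) -> (forall a b, P a -> P b -> cabs (Q a - Q b) <= K * cabs (a - b)) ->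
  exists l, forall a, P a -> cabs (Q a - l) <= 2 * K * cabs (a - e).
Proof.
move=> K0 [a0 Pa0] hQ.
have real_limit (u : C -> R) : (forall a b, P a -> P b -> `|u a - u b| <= K * cabs (a - b)) ->
    exists l, forall a, P a -> `|u a - l| <= K * cabs (a - e).
  move=> hu; pose S := [set u a - K * cabs (a - e) | a in P].
  have ubS b : P b -> ubound S (u b + K * cabs (b - e)).
    move=> Pb _ [a Pa <-]; have /ler_normlP[_] := hu a b Pa Pb.
    have : K * cabs (a - b) <= K * (cabs (a - e) + cabs (b - e)).
      by rewrite ler_wpM2l // (cabs_subC b e) cabs_triangle.
    lra.
  exists (sup S) => b Pb; rewrite ler_norml; apply/andP; split.
    have : sup S <= u b + K * cabs (b - e) by apply: ge_sup (ubS b Pb); exists (u a0 - K * cabs (a0 - e)); exists a0.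
    lra.
  have : u b - K * cabs (b - e) <= sup S.
    by apply: ub_le_sup; [exists (u b + K * cabs (b - e)); exact: ubS|exists b].
  lra.
have [x hx] := real_limit (fun a => complex.Re (Q a)) ltac:(by move=> a b Pa Pb;
  apply: le_trans (hQ a b Pa Pb); rewrite -raddfB cabs_Re).
have [y hy] := real_limit (fun a => complex.Im (Q a)) ltac:(by move=> a b Pa Pb;
  apply: le_trans (hQ a b Pa Pb); rewrite -raddfB cabs_Im).
exists (x +i* y)%C => a Pa; apply: le_trans (cabs_ReIm _) _.
rewrite !raddfB /=; have := hx _ Pa; have := hy _ Pa; lra.
Qed.

Lemma hol_of_quotient_bound (f : C -> C) c l (K d : R) : 0 < d -> 0 <= K ->
  (forall a, a != c -> cabs (a - c) < d -> cabs ((f c - f a) / (c - a) - l) <= K * cabs (a - c)) ->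
  hol f c.
Proof.
move=> d0 K0 h; apply/holP; exists l => e e0.
exists (Num.min d (e / (K + 1))).
  by rewrite lt_min d0 divr_gt0 //; lra.
move=> x; rewrite lt_min => /andP[xd]; rewrite ltr_pdivlMr; last lra.
move=> xe; have [->|x0] := eqVneq x 0; first by rewrite addr0 mulr0 !subrr cabs0 mulr0.
have hx : c + x - c = x by ring.
have := h (c + x); rewrite -subr_eq0 hx => /(_ x0 xd).
have -> : (f c - f (c + x)) / (c - (c + x)) - l = (f (c + x) - f c - l * x) / x.
  have -> : c - (c + x) = - x by ring.
  by field.
rewrite cabsM cabsV ler_pdivrMr ?cabs_gt0 // => hle; apply: le_trans hle _.
have := cabs_ge0 x; nra.
Qed.

(** With [c] as exceptional point, [cauchy_lipschitz2] makes the quotients [(f c - f a) / (c - a)]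
    Lipschitz in [a], so they have a limit, which is the derivative. *)
Theorem hol_removable (f : C -> C) (c : C) :
  (exists2 r : R, 0 < r & forall z, z != c -> cabs (z - c) < r -> hol f z) ->
  ccont f c -> hol f c.
Proof.
move=> [r r0 fh] fc.
have [d d0 hd] := fc 1 ltr01.
pose s := Num.min r d / 2.
have s0 : 0 < s by rewrite divr_gt0 // lt_min r0.
have m1 : Num.min r d <= r by rewrite ge_min lexx.
have m2 : Num.min r d <= d by rewrite ge_min lexx orbT.
have sr : s < r by rewrite /s; lra.
have sd : s < d by rewrite /s; lra.
pose M := cabs (f c) + 1.
have M0 : 0 <= M by rewrite addr_ge0 ?cabs_ge0.
have fM z : cabs (z - c) = s -> cabs (f z) <= M.
  move=> zs; apply: le_trans (cabs_le_add _ (f c)) _.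
  by rewrite lerD2l ltW // hd // zs.
have fcs z : cabs (z - c) <= s -> ccont f z.
  move=> zs; have [->//|zc] := eqVneq z c.
  by apply/hol_ccont/fh => //; exact: le_lt_trans sr.
have fhs z : cabs (z - c) <= s -> z \notin [:: c] -> hol f z.
  by rewrite inE => zs zc; apply: fh => //; exact: le_lt_trans sr.
pose P a := a != c /\ cabs (a - c) <= s / 2.
have [l hl] := @lipschitz_limit (fun a => (f c - f a) / (c - a)) P (16 * M / s ^+ 2) c
  ltac:(by rewrite divr_ge0 ?sqr_ge0 // mulr_ge0)
  ltac:(by have [|a [ac _ asm]] := @near_disk _ c c (s / 2) 1 ltr01;
     [rewrite subrr cabs0 divr_gt0|exists a; split => //; exact: ltW])
  ltac:(move=> a b [ac as1] [bc bs]; apply: (cauchy_lipschitz2 s0 fcs fhs fM) => //;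
     [by apply: fhs; rewrite ?inE //; lra|by apply: fhs; rewrite ?inE //; lra
     |by rewrite subrr cabs0 ltW|by rewrite eq_sym|by rewrite eq_sym]).
apply: (@hol_of_quotient_bound f c l (2 * (16 * M / s ^+ 2)) (s / 2)).
- by rewrite divr_gt0.
- by rewrite mulr_ge0 // divr_ge0 ?sqr_ge0 // mulr_ge0.
- by move=> a ac asm; apply: hl; split => //; exact: ltW.
Qed.

(** The constant of [cauchy_lipschitz2] depends only on a bound of the approximating functions, so
    the Lipschitz estimate of the quotients passes to [f]. *)
Theorem hol_uniform_limit (f : C -> C) (c : C) (r M : R) : 0 < r ->
  (forall z, cabs (z - c) <= r -> cabs (f z) <= M) ->
  (forall e : R, 0 < e -> exists2 g : C -> C,
    forall z, cabs (z - c) <= r -> hol g z &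
    forall z, cabs (z - c) <= r -> cabs (f z - g z) <= e) -> hol f c.
Proof.
move=> r0 fM happ.
have M0 : 0 <= M by apply: le_trans (cabs_ge0 _) (fM c _); rewrite subrr cabs0 ltW.
pose K := 16 * (M + 1) / r ^+ 2.
have K0 : 0 <= K by rewrite divr_ge0 ?sqr_ge0 // mulr_ge0 //; lra.
pose P a := a != c /\ cabs (a - c) <= r / 2.
have PK a b : P a -> P b -> cabs ((f c - f a) / (c - a) - (f c - f b) / (c - b)) <= K * cabs (a - b).
  move=> [ac ar] [bc br]; apply/ler_addgt0Pr => e e0.
  have ca : 0 < cabs (c - a) by rewrite cabs_gt0 subr_eq0 eq_sym.
  have cb : 0 < cabs (c - b) by rewrite cabs_gt0 subr_eq0 eq_sym.
  pose T := 2 / cabs (c - a) + 2 / cabs (c - b).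
  have T0 : 0 < T by rewrite addr_gt0 // divr_gt0.
  have [|g gh fg] := happ (Num.min 1 (e / T)); first by rewrite lt_min ltr01 divr_gt0.
  have cr : cabs (c - c) <= r by rewrite subrr cabs0 ltW.
  have ar' : cabs (a - c) <= r by lra.
  have br' : cabs (b - c) <= r by lra.
  have := @cauchy_lipschitz2 [::] g c r (M + 1) r0 (fun z h => hol_ccont (gh z h))
     (fun z h _ => gh z h) _ a b c ar br (gh _ ar') (gh _ br') cr.
  rewrite eq_sym in ac; rewrite eq_sym in bc => /(_ _ ac bc) hg.
  have {}hg := hg _; rewrite -/K in hg.
  have E1 : (f c - f a) / (c - a) - (f c - f b) / (c - b) =
     ((g c - g a) / (c - a) - (g c - g b) / (c - b)) +
     (((f c - g c) - (f a - g a)) / (c - a) - ((f c - g c) - (f b - g b)) / (c - b)).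
    by field; rewrite !subr_eq0 ac bc.
  rewrite E1; apply: le_trans (cabsD _ _) _; apply: lerD.
    apply: hg => z zr; apply: le_trans (cabs_le_add _ (f z)) _; apply: lerD; first by apply: fM; rewrite zr.
    by rewrite cabs_subC; apply: le_trans (fg z _) _; rewrite ?zr // ge_min lexx.
  set u := Num.min 1 (e / T) in fg.
  have uT : u * T <= e by rewrite -ler_pdivlMr // ge_min lexx orbT.
  apply: le_trans (cabsB _ _) (le_trans _ uT).
  rewrite !cabsM !cabsV /T mulrDr !mulrA.
  have fc' := fg c cr; have fa' := fg a ar'; have fb' := fg b br'.
  apply: lerD; rewrite ler_wpM2r ?invr_ge0 ?cabs_ge0 //;
    by apply: le_trans (cabsB _ _) _; clra.
have [l hl] := @lipschitz_limit (fun a => (f c - f a) / (c - a)) P K c K0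
  ltac:(by have [|a [ac _ asm]] := @near_disk _ c c (r / 2) 1 ltr01;
     [rewrite subrr cabs0 divr_gt0|exists a; split => //; exact: ltW]) PK.
apply: (@hol_of_quotient_bound f c l (2 * K) (r / 2)).
- by rewrite divr_gt0.
- by rewrite mulr_ge0.
- by move=> a ac asm; apply: hl; split => //; exact: ltW.
Qed.

(** [(z - c) * f z] tends to 0 at [c], so it is holomorphic there, and its difference quotient at
    [c] is the extension. *)
Lemma hol_removable_bounded (f : C -> C) (c : C) (r M : R) : 0 < r ->
  (forall z, z != c -> cabs (z - c) < r -> hol f z) ->
  (forall z, z != c -> cabs (z - c) < r -> cabs (f z) <= M) ->
  exists2 g : C -> C, forall z, cabs (z - c) < r -> hol g z &
    forall z, z != c -> g z = f z.
Proof.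
move=> r0 fh fM.
pose F z := (z - c) * (if z == c then 0 else f z).
have Fh z : z != c -> cabs (z - c) < r -> hol F z.
  move=> zc zr; apply: (@hol_eq _ (fun x => (x - c) * f x)).
    exists (cabs (z - c)) => [|x xz]; first by rewrite cabs_gt0 subr_eq0.
    by rewrite /F; case: eqVneq => // xc; move: xz; rewrite xc cabs_subC ltxx.
  by apply: holM; [apply: holB; [exact: hol_id|exact: hol_cst]|exact: fh].
have Fc : ccont F c.
  move=> e e0; pose K := Num.max M 0 + 1.
  have K0 : 0 < K by rewrite ltr_wpDl // le_max lexx orbT.
  exists (Num.min r (e / K)); first by rewrite lt_min r0 divr_gt0.
  move=> x; rewrite lt_min ltr_pdivlMr // => /andP[xr xe].
  rewrite {2}/F subrr mul0r subr0 /F cabsM; have [->|xc] := eqVneq.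
    by rewrite cabs0 mulr0.
  apply: le_lt_trans xe; rewrite ler_wpM2l ?cabs_ge0 //.
  apply: le_trans (fM _ xc xr) _; rewrite /K.
  have : M <= Num.max M 0 by rewrite le_max lexx.
  lra.
have Fhc : hol F c by apply: hol_removable => //; exists r.
have [q [Fq qc qh _]] := hol_quotient Fhc.
exists q => z.
  move=> zr; have [->|zc] := eqVneq z c; last exact: (qh z zc (Fh z zc zr)).
  apply: hol_removable qc; exists r; first exact: r0.
  by move=> w wc wr; exact: (qh w wc (Fh w wc wr)).
move=> zc; have := Fq z; rewrite {2}/F subrr mul0r subr0 /F (negPf zc) mulrC.
by move/(mulIf _) => -> //; rewrite subr_eq0.
Qed.

Lemma hol_divide (f : C -> C) (r : R) : 0 < r ->
  (forall z, cabs z <= r -> hol f z) ->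
  exists2 g : C -> C, forall z, cabs z <= r -> hol g z & forall z, f z = f 0 + z * g z.
Proof.
move=> r0 fh; have [|q [fq qc qh _]] := hol_quotient (fh 0 _); first by rewrite cabs0 ltW.
exists q => z; last by rewrite mulrC; have := fq z; rewrite subr0 => <-; rewrite subrKC.
move=> zr; have [->|z0] := eqVneq z 0; last by apply: qh => //; exact: fh.
apply: hol_removable => //; exists r => // w w0; rewrite subr0 => wr.
by apply: qh => //; apply: fh; exact: ltW.
Qed.

(** If division by [z] never stops, the maximum principle bounds the k-th quotient by [M / r ^+ k].
    Then [cabs (f z) * r ^+ k <= M * cabs z ^+ k] for all [k], which forces [f z = 0] when
    [cabs z < r]. *)
Lemma hol_order (f : C -> C) (r : R) : 0 < r ->
  (forall z, cabs z <= r -> hol f z) -> (exists M, forall z, cabs z <= r -> cabs (f z) <= M) ->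
  (forall z, cabs z < r -> f z = 0) \/
  exists k (g : C -> C), [/\ g 0 != 0, forall z, cabs z <= r -> hol g z
     & forall z, f z = z ^+ k * g z].
Proof.
move=> r0 fh [M fM].
have [h|nh] := pselect (exists k (g : C -> C), [/\ g 0 != 0,
  forall z, cabs z <= r -> hol g z & forall z, f z = z ^+ k * g z]); [by right|left].
have D k : exists2 g : C -> C, forall z, cabs z <= r -> hol g z & forall z, f z = z ^+ k * g z.
  elim: k => [|k [g gh fg]]; first by exists f => // z; rewrite mul1r.
  have [g00|g0] := eqVneq (g 0) 0; last by case: nh; exists k, g.
  have [q qh gq] := hol_divide r0 gh; exists q => // z.
  by rewrite fg gq g00 add0r exprSr mulrA.
move=> z zr; apply: contrapT => /eqP fz.
suff : r <= cabs z by lra.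
apply: (@le_of_exprn_le _ (cabs (f z)) M); rewrite ?cabs_gt0 ?cabs_ge0 ?ltW // => k.
have [g gh fg] := D k.
have rk : 0 < r ^+ k by rewrite exprn_gt0.
have gM : cabs (g z) <= M / r ^+ k.
  apply: (@maximum_principle _ g 0 r); last by rewrite subr0 ltW.
    by move=> w; rewrite subr0; exact: gh.
  move=> w; rewrite subr0 => wr; rewrite ler_pdivlMr // mulrC -wr -cabsX -cabsM -fg.
  by apply: fM; rewrite wr.
rewrite ler_pdivlMr // in gM; rewrite fg cabsM cabsX.
have := ler_wpM2l (exprn_ge0 k (cabs_ge0 z)) gM; lra.
Qed.

Lemma taylor1 K (f : C -> C) (r M : R) : 0 < r ->
  (forall z, cabs z <= r -> hol f z) -> (forall z, cabs z <= r -> cabs (f z) <= M) ->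
  exists (c : nat -> C) (M' : R), forall z, cabs z <= r ->
    cabs (f z - \sum_(l < K) c l * z ^+ l) <= M' * cabs z ^+ K.
Proof.
move=> r0; elim: K f M => [|K IH] f M fh fM.
  by exists (fun=> 0), M => z zr; rewrite big_ord0 subr0 mulr1; exact: fM.
have [g gh fg] := hol_divide r0 fh.
have gM z : cabs z <= r -> cabs (g z) <= 2 * M / r.
  move=> zr; apply: (@maximum_principle _ g 0 r); last by rewrite subr0.
    by move=> w; rewrite subr0; exact: gh.
  move=> w; rewrite subr0 => wr; rewrite ler_pdivlMr // mulrC -wr -cabsM.
  have -> : w * g w = f w - f 0 by rewrite fg; ring.
  apply: le_trans (cabsB _ _) _.
  have := fM w (eqW wr); have := fM 0; rewrite cabs0 => /(_ (ltW r0)); lra.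
have [c [M' h]] := IH g _ gh gM.
exists (fun l => if l is m.+1 then c m else f 0), M' => z zr.
rewrite big_ord_recl /= mulr1 fg.
under eq_bigr do rewrite /bump /= exprS mulrCA.
rewrite -mulr_sumr opprD addrA (addrC (f 0)) addrK -mulrBr cabsM exprS mulrCA.
by rewrite ler_wpM2l ?cabs_ge0 ?h.
Qed.

End CauchyEstimates.

(** * Taylor estimates in two variables *)

Section TwoVariables.
Context {R : realType}.
Local Notation C := (Cplx R).
Local Notation "x %:CC" := ((x : R)%:C%C : C) (at level 2, format "x %:CC").

Let eqW (x y : R) : x = y -> x <= y. Proof. by move->. Qed.

(** Separate holomorphy with a common bound: estimates in one variable are applied in each variable
    in turn. *)
Definition bihol (r M : R) (a : C -> C -> C) := forall t p, cabs t <= r -> cabs p <= r ->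
  [/\ hol (fun x => a x p) t, hol (fun y => a t y) p & cabs (a t p) <= M].

(** For [t != 0] the quotient by [t] is visibly holomorphic in [p]; at [t = 0] it is the uniform
    limit of the quotients at small [t], by the Cauchy estimate in [t]. *)
Lemma bihol_divide (r M : R) (a : C -> C -> C) : 0 < r -> bihol r M a ->
  exists2 g, bihol (r / 2) (2 * M / r) g &
    forall t p, cabs p <= r -> a t p = a 0 p + t * g t p.
Proof.
move=> r0 ha.
have c0r : cabs (0 : C) <= r by rewrite cabs0 ltW.
have hq p : exists q : C -> C, cabs p <= r ->
    (forall z, cabs z <= r -> hol q z) /\ (forall t, a t p = a 0 p + t * q t).
  have [pr|] := pselect (cabs p <= r); last by exists (fun=> 0).
  have [|q qh qE] := @hol_divide _ (fun t => a t p) r r0.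
    by move=> z zr; have [] := ha z p zr pr.
  by exists q.
have [q hq'] := choice hq.
pose g t p := q p t.
have gE t p : cabs p <= r -> a t p = a 0 p + t * g t p by move=> /hq'[_]; exact.
have gt p : cabs p <= r -> forall t, cabs t <= r -> hol (fun t => g t p) t.
  by move=> /hq'[].
have gM t p : cabs t <= r -> cabs p <= r -> cabs (g t p) <= 2 * M / r.
  move=> tr pr; apply: (@maximum_principle _ (fun t => g t p) 0 r); last by rewrite subr0.
    by move=> w; rewrite subr0; exact: gt.
  move=> w; rewrite subr0 => wr; rewrite ler_pdivlMr // mulrC -wr -cabsM.
  have -> : w * g w p = a w p - a 0 p by rewrite gE //; ring.
  apply: le_trans (cabsB _ _) _.
  have [_ _] := ha w p (eqW wr) pr; have [_ _] := ha 0 p c0r pr; lra.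
have ghol_p t p : cabs t <= r -> t != 0 -> cabs p < r -> hol (g t) p.
  move=> tr t0 pr; apply: (@hol_eq _ (fun p => (a t p - a 0 p) / t)).
    exists (r - cabs p); first by rewrite subr_gt0.
    move=> x xp; rewrite (gE t x); first by field.
    by have := cabs_le_add x p; lra.
  apply: (@hol_div _ (fun p => a t p - a 0 p) (fun=> t)); [|exact: hol_cst|exact: t0].
  by apply: (@holB _ (a t) (a 0)); [have [] := ha t p tr (ltW pr)|have [] := ha 0 p c0r (ltW pr)].
exists g => // t p tr2 pr2.
have tr : cabs t <= r by lra.
have pr : cabs p <= r by lra.
split; [exact: gt|idtac|exact: gM].
have [->|t0] := eqVneq t 0; last by apply: ghol_p => //; lra.
have near_p y : cabs (y - p) <= r / 4 -> cabs y < r.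
  by move=> yp; have := cabs_le_add y p; lra.
have M0 : 0 <= M by have [_ _] := ha 0 0 c0r c0r; exact/le_trans/cabs_ge0.
apply: (@hol_uniform_limit _ _ p (r / 4) (2 * M / r)) => [|z zp|e e0].
- by rewrite divr_gt0.
- by apply: gM => //; exact/ltW/near_p.
pose K := 4 * (2 * M / r) / r.
have K0 : 0 <= K.
  apply: divr_ge0; last exact: ltW.
  by apply: mulr_ge0 => //; apply: divr_ge0; [exact: mulr_ge0|exact: ltW].
pose h := Num.min (r / 2) (e / (K + 1)).
have h0 : 0 < h by rewrite lt_min !divr_gt0 //; lra.
have hr : h <= r / 2 by rewrite ge_min lexx.
have he : h * (K + 1) <= e by rewrite -ler_pdivlMr ?ge_min ?lexx ?orbT //; clra.
have ch : cabs h%:CC = h by rewrite cabsR gtr0_norm.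
exists (g h%:CC) => z /near_p zr.
  by apply: ghol_p => //; [rewrite ch; clra|rewrite -cabs_eq0 ch gt_eqF].
have := @cauchy_lipschitz _ [::] (fun t => g t z) 0 r (2 * M / r) r0 _ _ _ 0 h%:CC.
rewrite cabs_subC => hL; apply: le_trans (hL _ _ _ _ _ _) _.
- by move=> w; rewrite subr0 => wr; apply/hol_ccont/gt => //; exact: ltW.
- by move=> w; rewrite subr0 => wr _; apply: gt => //; exact: ltW.
- by move=> w; rewrite subr0 => wr; apply: gM; [exact: eqW|exact: ltW].
- by rewrite subrr cabs0 divr_ge0 // ltW.
- by apply: gt => //; exact: ltW.
- by rewrite subr0 ch; clra.
rewrite subr0 ch -/K; nra.
Qed.

(** The homogeneous part of degree [k] of the double series whose coefficient at [t ^+ j * p ^+ l]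
    is [c j l]. *)
Definition hsum (c : nat -> nat -> C) k (t p : C) : C :=
  \sum_(l < k.+1) c (k - l)%N l * t ^+ (k - l) * p ^+ l.

Lemma hsumS c k t p :
  hsum c k.+1 t p = t * hsum (fun j => c j.+1) k t p + c 0%N k.+1 * p ^+ k.+1.
Proof.
rewrite /hsum big_ord_recr /= subnn mulr1; congr (_ + _).
rewrite mulr_sumr; apply: eq_bigr => i _.
have ik : (i <= k)%N by rewrite -ltnS.
by rewrite subSn // exprS; ring.
Qed.

Definition cmax (t p : C) : R := Num.max (cabs t) (cabs p).

(** Splitting off [a 0 p] leaves [t * g t p], where [g] is expanded one order lower; [hsumS] matches
    this with the homogeneous parts. *)
Lemma taylor2 K (a : C -> C -> C) (r M : R) : 0 < r -> bihol r M a ->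
  exists (c : nat -> nat -> C) (r' M' : R), 0 < r' /\
    forall t p, cabs t <= r' -> cabs p <= r' ->
    cabs (a t p - \sum_(k < K) hsum c k t p) <= M' * cmax t p ^+ K.
Proof.
move=> r0; elim: K a r M r0 => [|K IH] a r M r0 ha.
  exists (fun _ _ => 0), r, M; split => // t p tr pr.
  by rewrite big_ord0 subr0 mulr1; have [] := ha _ _ tr pr.
have [g hg aE] := bihol_divide r0 ha.
have r20 : 0 < r / 2 by rewrite divr_gt0.
have [c [r' [M' [r'0 hc]]]] := IH g _ _ r20 hg.
have c0r : cabs (0 : C) <= r by rewrite cabs0 ltW.
have [|z zr|b [M'' hb]] := @taylor1 _ K.+1 (a 0) r M r0.
- by move=> z zr; have [] := ha 0 z c0r zr.
- by have [] := ha 0 z c0r zr.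
exists (fun j l => if j is j'.+1 then c j' l else b l), (Num.min r' r), (M' + `|M''|).
split; first by rewrite lt_min r'0.
move=> t p; rewrite !le_min => /andP[tr' tr] /andP[pr' pr].
have E1 : \sum_(k < K.+1) hsum (fun j l => if j is j'.+1 then c j' l else b l) k t p =
   \sum_(l < K.+1) b l * p ^+ l + t * \sum_(k < K) hsum c k t p.
  rewrite !big_ord_recl /= {1}/hsum big_ord1 /= !mulr1 -addrA; congr (_ + _).
  rewrite mulr_sumr -big_split /=; apply: eq_bigr => i _.
  by rewrite /bump /= hsumS addrC.
rewrite E1 aE //.
have -> : a 0 p + t * g t p - (\sum_(l < K.+1) b l * p ^+ l + t * \sum_(k < K) hsum c k t p)
  = t * (g t p - \sum_(k < K) hsum c k t p) + (a 0 p - \sum_(l < K.+1) b l * p ^+ l) by ring.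
apply: le_trans (cabsD _ _) _; rewrite mulrDl; apply: lerD.
  rewrite cabsM exprS mulrCA; apply: ler_pM; rewrite ?cabs_ge0 ?hc //.
  by rewrite /cmax le_max lexx.
apply: le_trans (hb _ pr) _; apply: le_trans (ler_wpM2r _ (ler_norm _)) _.
  by rewrite exprn_ge0 ?cabs_ge0.
apply: ler_wpM2l => //; rewrite lerXn2r ?nnegrE ?cabs_ge0 //.
  by rewrite /cmax le_max cabs_ge0.
by rewrite /cmax le_max lexx orbT.
Qed.

End TwoVariables.

(** * Roots of polynomials with holomorphic coefficients *)

Section PolynomialRoots.
Context {R : realType}.
Local Notation C := (Cplx R).
Local Notation "x %:CC" := ((x : R)%:C%C : C) (at level 2, format "x %:CC").
Implicit Types (p q : {poly C}) (P : C -> {poly C}).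

Lemma cabs_in_disk (c s s' : C) (rho : R) :
  cabs (s' - s) < rho - cabs (s - c) -> cabs (s' - c) < rho.
Proof. by have := cabs_triangle s s' c; lra. Qed.

(** Compactness is used for a square around the disk. Its corners lie at distance less than
    [2 * rho] from [c], which is why the local hypothesis reaches that far. *)
Lemma disk_uniform (c : C) (rho : R) (Q : R -> C -> Prop) : 0 < rho ->
  (forall s0, cabs (s0 - c) <= 2 * rho -> exists (d e0 : R), [/\ 0 < d, 0 < e0 &
     forall s, cabs (s - s0) < d -> forall e, 0 < e < e0 -> Q e s]) ->
  exists2 e0 : R, 0 < e0 & forall e, 0 < e < e0 -> forall s, cabs (s - c) <= rho -> Q e s.
Proof.
move=> rho0 hQ.
pose K : set (R * R) := `[- rho, rho] `*` `[- rho, rho].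
have cK : compact K by apply: compact_setX; exact: segment_compact.
pose pt (xy : R * R) : C := c + (xy.1 +i* xy.2)%C.
have := (compact_near_coveringP K).1 cK R (0^'+) (fun e xy => Q e (pt xy)) _.
case=> [[x y] [/= hx hy]|e0 /= e00 h].
  move: hx hy; rewrite !in_itv /= => hx hy.
  have [|d [e0 [d0 e00 h]]] := hQ (pt (x, y)).
    rewrite /pt addrC addKr; apply: le_trans (cabs_ReIm _) _ => /=.
    by rewrite mulr_natl mulr2n lerD // ler_norml.
  have d20 : 0 < d / 2 by rewrite divr_gt0.
  exists ([set xy : R * R | ball x (d / 2) xy.1 /\ ball y (d / 2) xy.2], [set e | 0 < e < e0]).
    split => /=.
      by exists (ball x (d / 2), ball y (d / 2)) => /=; [split; exact: nbhsx_ballx|move=> [u v] []].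
    exists e0 => // e /=; rewrite sub0r normrN => he e0'.
    by rewrite e0' /=; apply: le_lt_trans he; rewrite ler_norm.
  move=> [[u v] e] /= [[bu bv] he]; apply: h he.
  rewrite /pt /= [c + _ - _]addrAC opprD !addrA subrr sub0r addrC.
  apply: le_lt_trans (cabs_ReIm _) _; rewrite /= addrC.
  move: bu bv; rewrite /ball /= => bu bv.
  by rewrite (distrC u) (distrC v); lra.
exists e0 => // e /andP[e1 e2] s sc.
have := h e; rewrite /= sub0r normrN gtr0_norm // => /(_ e2 e1 (complex.Re (s - c), complex.Im (s - c))).
have -> : pt (complex.Re (s - c), complex.Im (s - c)) = s.
  by rewrite /pt /=; have := complexE (s - c); case: (s - c) (subrK c s) => a b /= <- _; rewrite addrC.
apply; split => /=; rewrite in_itv /= -ler_norml; apply: le_trans sc; [exact: cabs_Re|exact: cabs_Im].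
Qed.

Lemma ball_all n (Q : nat -> C -> Prop) z :
  (forall i, (i < n)%N -> exists2 d : R, 0 < d & forall x, cabs (x - z) < d -> Q i x) ->
  exists2 d : R, 0 < d & forall x, cabs (x - z) < d -> forall i, (i < n)%N -> Q i x.
Proof.
elim: n => [|n IH] h; first by exists 1.
have [i /ltnW /h //|d d0 hd] := IH; have [d' d'0 hd'] := h n (ltnSn n).
exists (Num.min d d'); first by rewrite lt_min d0.
move=> x; rewrite lt_min => /andP[xd xd'] i; rewrite ltnS leq_eqVlt => /predU1P[->|].
  exact: hd'.
exact: hd.
Qed.

Definition monicd d p := p \is monic /\ size p = d.+1.

Lemma monicd_prod d p : monicd d p ->
  exists2 rs : seq C, size rs = d & p = \prod_(z <- rs) ('X - z%:P).
Proof.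
move=> [mp sp]; have [rs prs] := closed_field_poly_normal p.
rewrite (monicP mp) scale1r in prs; exists rs => //.
by apply/eqP; rewrite -eqSS -sp prs size_prod_XsubC.
Qed.

Lemma horner_monicd d p x : monicd d p -> p.[x] = x ^+ d + \sum_(i < d) p`_i * x ^+ i.
Proof.
move=> [/monicP mp sp]; rewrite horner_coef sp big_ord_recr /= addrC.
by move: mp; rewrite lead_coefE sp /= => ->; rewrite mul1r.
Qed.

(** The modulus of [p.[x]] is the product of the distances from [x] to the roots. *)
Lemma monicd_near_root d p x (eta : R) : monicd d p -> 0 < eta ->
  cabs p.[x] < eta ^+ d -> exists2 y, root p y & cabs (x - y) < eta.
Proof.
move=> mp eta0; have [rs srs prs] := monicd_prod mp.
move=> h; apply: contrapT => nex.
suff : eta ^+ d <= cabs p.[x] by lra.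
have far y : y \in rs -> eta <= cabs (x - y).
  move=> yrs; rewrite leNgt; apply/negP => xy; apply: nex; exists y => //.
  by rewrite prs root_prod_XsubC.
rewrite prs horner_prod cabs_prod -srs.
elim: rs far {srs prs nex} => [|y rs IH] far; first by rewrite big_nil.
rewrite big_cons /= exprS hornerXsubC; apply: ler_pM => //.
- exact: ltW.
- by rewrite exprn_ge0 // ltW.
- by apply: far; rewrite mem_head.
- by apply: IH => z zr; apply: far; rewrite inE zr orbT.
Qed.

Lemma monicd_root_bound d p y (M : R) : 0 <= M -> monicd d p ->
  (forall i, (i < d)%N -> cabs p`_i <= M) -> root p y -> cabs y <= 1 + d%:R * M.
Proof.
move=> M0 mp pM /rootP py; have dM : 0 <= d%:R * M by rewrite mulr_ge0.
have [y1|y1] := leP (cabs y) 1; first by lra.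
have := horner_monicd y mp; rewrite py.
case: d mp pM dM => [|d] mp pM dM.
  by rewrite big_ord0 addr0 => /eqP; rewrite eq_sym oner_eq0.
move=> /eqP; rewrite eq_sym addr_eq0 => /eqP h.
have y0 : 0 < cabs y by lra.
suff : cabs y ^+ d.+1 <= d.+1%:R * M * cabs y ^+ d.
  by rewrite exprS ler_pM2r ?exprn_gt0 //; lra.
rewrite -cabsX h cabsN; apply: le_trans (cabs_sum _ _ _) _.
rewrite -mulrA mulr_natl -[X in _ *+ X]card_ord -sumr_const.
apply: ler_sum => i _; rewrite cabsM cabsX; apply: ler_pM; rewrite ?exprn_ge0 ?cabs_ge0 ?pM //.
by rewrite ler_weXn2l // ?ltW // -ltnS.
Qed.

(** At a root [x] of [p] the value [q.[x]] is a combination of the differences of the coefficients,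
    hence small, and [monicd_near_root] applies. That [e] depends on [d], [M] and [eta] only allows
    whole families to be compared. *)
Lemma close_roots d (M eta : R) : 0 <= M -> 0 < eta -> exists2 e : R, 0 < e &
  forall p q, monicd d p -> monicd d q -> (forall i, (i < d)%N -> cabs p`_i <= M) ->
  (forall i, (i < d)%N -> cabs (q`_i - p`_i) <= e) ->
  forall x, root p x -> exists2 y, root q y & cabs (x - y) < eta.
Proof.
move=> M0 eta0; pose B := 1 + d%:R * M.
have B1 : 1 <= B by rewrite lerDl mulr_ge0.
have B0 : 0 < B by lra.
pose T := (d%:R + 1) * B ^+ d.
have T0 : 0 < T by rewrite mulr_gt0 ?exprn_gt0 // ltr_wpDl.
exists (eta ^+ d / T / 2); first by rewrite !divr_gt0 ?exprn_gt0.
move=> p q mp mq pM pq x px.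
have xB := monicd_root_bound M0 mp pM px.
apply: (monicd_near_root mq eta0).
have -> : q.[x] = \sum_(i < d) (q`_i - p`_i) * x ^+ i.
  have /rootP := px; rewrite (horner_monicd x mp) (horner_monicd x mq) => h.
  have -> : \sum_(i < d) (q`_i - p`_i) * x ^+ i =
      \sum_(i < d) q`_i * x ^+ i - \sum_(i < d) p`_i * x ^+ i.
    by rewrite -sumrB; apply: eq_bigr => i _; exact: mulrBl.
  by move/eqP: h; rewrite addr_eq0 => /eqP ->; ring.
apply: le_lt_trans (cabs_sum _ _ _) _.
set e := eta ^+ d / T / 2 in pq *.
have e0 : 0 < e by rewrite !divr_gt0 ?exprn_gt0.
apply: (@le_lt_trans _ _ (\sum_(i < d) e * B ^+ d)).
  apply: ler_sum => i _; rewrite cabsM cabsX; apply: ler_pM; rewrite ?exprn_ge0 ?cabs_ge0 ?pq //.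
  apply: (@le_trans _ _ (B ^+ i)); first by rewrite lerXn2r ?nnegrE ?cabs_ge0 // ltW.
  by apply: ler_weXn2l => //; exact: ltnW.
rewrite sumr_const card_ord -mulr_natl.
have eT : e * T * 2 = eta ^+ d by rewrite /e; field; rewrite gt_eqF.
have : 0 < eta ^+ d by rewrite exprn_gt0.
have : 0 <= e * B ^+ d by rewrite mulr_ge0 ?exprn_ge0 // ltW.
rewrite -eT /T; lra.
Qed.

Lemma uniq_roots_prod d p (x : 'I_d -> C) : monicd d p -> injective x ->
  (forall i, root p (x i)) -> p = \prod_(i < d) ('X - (x i)%:P).
Proof.
move=> [mp sp] xi px.
have := @all_roots_prod_XsubC _ p [seq x i | i <- enum 'I_d].
rewrite size_map size_enum_ord (monicP mp) scale1r big_map big_enum; apply => //.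
  by apply/allP => _ /mapP[i _ ->].
by rewrite uniq_rootsE map_inj_uniq // enum_uniq.
Qed.

Lemma separable_uniq_prod d p : monicd d p -> separable_poly p ->
  exists2 x : 'I_d -> C, injective x & p = \prod_(i < d) ('X - (x i)%:P).
Proof.
move=> mp sp; have [rs srs prs] := monicd_prod mp.
have urs : uniq rs by rewrite -separable_prod_XsubC -prs.
exists (fun i => nth 0 rs i).
  by move=> i j /eqP; rewrite nth_uniq ?srs // => /eqP/val_inj.
by rewrite prs (big_nth 0) srs big_mkord.
Qed.

(* A continuous choice of a simple root is holomorphic: writing
   P s0 = (X - x s0) Q, the difference quotient of x at s0 is
   - (sum of the difference quotients of the coefficients) / Q. *)
Lemma hol_root d P (x : C -> C) s0 (r : R) : 0 < r ->
  (forall s, cabs (s - s0) < r -> monicd d (P s) /\ root (P s) (x s)) ->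
  (forall i, (i < d)%N -> hol (fun s => (P s)`_i) s0) ->
  separable_poly (P s0) -> ccont x s0 -> hol x s0.
Proof.
move=> r0 Px Ph sep xc.
have ss0 : cabs (s0 - s0) < r by rewrite subrr cabs0.
have [mP rP] := Px s0 ss0.
have /factor_theorem[Q PQ] := rP.
have Qx0 : Q.[x s0] != 0.
  by move: sep; rewrite PQ separable_root => /andP[_]; rewrite rootE.
have hq i : exists q : C -> C, (i < d)%N -> (forall s, (P s)`_i - (P s0)`_i = q s * (s - s0)) /\ ccont q s0.
  have [id|] := ltnP i d; last by exists (fun=> 0).
  by have [q [qE qc _ _]] := hol_quotient (Ph i id); exists q.
have [q {}hq] := choice hq.
have Qh : hol (fun z => Q.[z]) (x s0).
  apply: (@hol_ext _ (fun z => \sum_(i < size Q) Q`_i * z ^+ i)) => [z|]; first by rewrite horner_coef.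
  by apply: hol_sum => i _; apply: holM; [exact: hol_cst|apply: holX; exact: hol_id].
have Qc : ccont (fun s => Q.[x s]) s0.
  move=> e e0; have [d1 d10 h1] := hol_ccont Qh e0; have [d2 d20 h2] := xc _ d10.
  by exists d2 => // s /h2; exact: h1.
have [d1 d10 Qn0] : exists2 d1 : R, 0 < d1 & forall s, cabs (s - s0) < d1 -> Q.[x s] != 0.
  have [|d1 d10 h1] := Qc (cabs Q.[x s0]); first by rewrite cabs_gt0.
  exists d1 => // s /h1; apply: contraTneq => ->.
  by rewrite sub0r cabsN ltxx.
pose N s := - (\sum_(i < d) q i s * x s ^+ i) / Q.[x s].
have Nc : ccont N s0.
  apply: (@ccontM _ (fun s => - (\sum_(i < d) q i s * x s ^+ i)) (fun s => (Q.[x s])^-1)).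
    have sc n : (n <= d)%N -> ccont (fun s => \sum_(i < n) q i s * x s ^+ i) s0.
      elim: n => [|n IH] nd.
        by move=> e e0; exists 1 => // s _; rewrite !big_ord0 subrr cabs0.
      move=> e e0; have e20 : 0 < e / 2 by rewrite divr_gt0.
      have [d2 d20 h2] := IH (ltnW nd) _ e20.
      have [_ qc] := hq n nd.
      have [d3 d30 h3] := ccontM qc (ccontX n xc) e20.
      exists (Num.min d2 d3); first by rewrite lt_min d20.
      move=> s; rewrite lt_min => /andP[/h2 s2 /h3 s3]; rewrite !big_ord_recr /= opprD addrACA.
      by apply: le_lt_trans (cabsD _ _) _; lra.
    move=> e /(sc d (leqnn d))[d2 d20 h2]; exists d2 => // s /h2.
    by rewrite -opprD cabsN.
  have : hol (fun z => (Q.[z])^-1) (x s0) by exact: holV.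
  move=> /hol_ccont ic e /ic[d2 d20 h2].
  by have [d3 d30 h3] := xc _ d20; exists d3 => // s /h3/h2.
apply: (@hol_eq _ (fun s => if cabs (s - s0) < Num.min r d1 then x s else x s0 + N s * (s - s0))).
  exists (Num.min r d1); first by rewrite lt_min r0.
  by move=> s ->.
apply: (@hol_caratheodory _ _ N) => // s.
have -> : cabs (s0 - s0) < Num.min r d1 by rewrite subrr cabs0 lt_min r0.
case: ifPn => [|_]; last by rewrite addrC addKr.
rewrite lt_min => /andP[sr sd].
have [mPs /rootP rPs] := Px s sr.
have E1 : (P s0).[x s] = Q.[x s] * (x s - x s0) by rewrite PQ hornerM hornerXsubC.
have E2 : (P s).[x s] - (P s0).[x s] = (\sum_(i < d) q i s * x s ^+ i) * (s - s0).
  rewrite (horner_monicd _ mPs) (horner_monicd _ mP) opprD addrACA subrr add0r -sumrB mulr_suml.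
  apply: eq_bigr => i _; rewrite -mulrBl; have [-> _] := hq i (ltn_ord i).
  by ring.
apply: (mulfI (Qn0 s sd)).
rewrite -E1 /N; move: E2; rewrite rPs sub0r => /(congr1 -%R); rewrite opprK => ->.
by field; exact: Qn0.
Qed.

Lemma seq_separation (rs : seq C) : exists2 e : R, 0 < e &
  forall x y, x \in rs -> y \in rs -> x != y -> e <= cabs (x - y).
Proof.
elim: rs => [|z rs [e e0 IH]]; first by exists 1.
have [d d0 hd] := punctured_notin rs z.
exists (Num.min e d); first by rewrite lt_min e0.
have sep w : w \in rs -> w != z -> d <= cabs (w - z).
  by move=> wrs wz; rewrite leNgt; apply: contraTN wrs; exact: hd.
move=> x y; rewrite !inE => /predU1P[->|xr] /predU1P[->|yr] xy.
- by rewrite eqxx in xy.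
- by rewrite ge_min cabs_subC sep ?orbT // eq_sym.
- by rewrite ge_min sep ?orbT.
- by rewrite ge_min IH.
Qed.

Section LocalRoots.
Variables (d : nat) (P : C -> {poly C}) (c : C) (r : R).
Hypotheses (r0 : 0 < r) (Pm : forall s, cabs (s - c) < r -> monicd d (P s))
  (Psep : forall s, cabs (s - c) < r -> separable_poly (P s))
  (Ph : forall s, cabs (s - c) < r -> forall i, (i < d)%N -> hol (fun s => (P s)`_i) s).

Lemma local_close_roots s0 (eta : R) : cabs (s0 - c) < r -> 0 < eta ->
  exists2 e : R, 0 < e & forall s, cabs (s - s0) < e -> cabs (s - c) < r /\
    (forall x, root (P s0) x -> exists2 y, root (P s) y & cabs (x - y) < eta) /\
    (forall y, root (P s) y -> exists2 x, root (P s0) x & cabs (x - y) < eta).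
Proof.
move=> s0r eta0; pose M := 1 + \sum_(i < d) cabs (P s0)`_i.
have M1 (i : nat) : (i < d)%N -> cabs (P s0)`_i <= M - 1.
  move=> id; rewrite /M addrC addKr (bigD1 (Ordinal id)) //= lerDl.
  by apply: sumr_ge0 => j _; exact: cabs_ge0.
have M0 : 0 <= M by rewrite addr_ge0 // sumr_ge0 // => i _; exact: cabs_ge0.
have [e e0 he] := close_roots d M0 eta0.
have e10 : 0 < Num.min e 1 by rewrite lt_min e0 ltr01.
have [k k0 hk] := ball_all (fun i id => hol_ccont (Ph s0r id) e10).
exists (Num.min k (r - cabs (s0 - c))); first by rewrite lt_min k0 subr_gt0.
move=> s; rewrite lt_min => /andP[sk sr].
have scr : cabs (s - c) < r by have := cabs_triangle s0 s c; lra.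
have pe i : (i < d)%N -> cabs ((P s)`_i - (P s0)`_i) < e /\ cabs ((P s)`_i - (P s0)`_i) < 1.
  by move=> id; have := hk s sk i id; rewrite lt_min => /andP.
split => //; split.
  apply: he; [exact: Pm|exact: Pm| |].
    by move=> i id; have := M1 i id; lra.
  by move=> i /pe[/ltW].
move=> y yr; have [i id|i /pe[/ltW]|x xr xy] := he (P s) (P s0) (Pm scr) (Pm s0r) _ _ y yr.
- by have [_] := pe i id; have := M1 i id; have := cabs_le_add (P s)`_i (P s0)`_i; lra.
- by rewrite cabs_subC.
- by exists x => //; rewrite cabs_subC.
Qed.

(** Each root is followed from [c] to [s] along the segment in [N.+1] short steps, each time to the
    root within [eta] of the last one. Distinct roots are at least [4 * eta] apart, so the end point
    depends continuously on [s], and [hol_root] gives holomorphy. The radius [r / 4] is the same for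
    every family, as the Harnack inequality requires. *)
Theorem hol_roots : exists x : 'I_d -> C -> C, forall s, cabs (s - c) < r / 4 ->
  [/\ P s = \prod_(i < d) ('X - (x i s)%:P), injective (x ^~ s) & forall i, hol (x i) s].
Proof.
pose rho := r / 3.
have rho0 : 0 < rho by rewrite divr_gt0.
have rho2 s : cabs (s - c) <= 2 * rho -> cabs (s - c) < r.
  by move: rho0; rewrite /rho; lra.
have rho1 s : cabs (s - c) <= rho -> cabs (s - c) < r.
  by move=> h; apply: rho2; lra.
(* Uniform separation: near [s0] the roots stay within an eighth of their minimal distance [sg], so
   distinct ones stay at least [sg / 2] apart. *)
have [|eta0 eta00 heta0] := @disk_uniform c rho (fun e s => cabs (s - c) < r ->
  forall x y, root (P s) x -> root (P s) y -> x != y -> 4 * e <= cabs (x - y)) rho0.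
  move=> s0 /rho2 s0r.
  have [xi xii Pxi] := separable_uniq_prod (Pm s0r) (Psep s0r).
  have [sg sg0 hsg] := seq_separation [seq xi i | i <- enum 'I_d].
  have sg80 : 0 < sg / 8 by rewrite divr_gt0.
  have [e e0 he] := local_close_roots s0r sg80.
  exists e, (sg / 8); split => // s se e' /andP[_ e'1] sr x y xs ys xy.
  have [_ [fwd _]] := he s se.
  have xir i : root (P s0) (xi i).
    by rewrite Pxi /root horner_prod (bigD1 i) //= hornerXsubC subrr mul0r.
  have hz' i : exists u, root (P s) u /\ cabs (xi i - u) < sg / 8.
    by have [u u1 u2] := fwd _ (xir i); exists u.
  have [z hz] := choice hz'.
  have far i j : i != j -> sg / 2 <= cabs (z i - z j).
    move=> ij; have : sg <= cabs (xi i - xi j).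
      by apply: hsg; rewrite ?map_f ?mem_enum // (inj_eq xii).
    have [_ h1] := hz i; have [_ h2] := hz j.
    have := cabs_triangle (z i) (xi i) (xi j); have := cabs_triangle (z j) (z i) (xi j).
    by rewrite (cabs_subC (z j)); lra.
  have zi : injective z.
    move=> i j zij; apply/eqP; apply: contraT => /far.
    by rewrite zij subrr cabs0; clra.
  have Pz := uniq_roots_prod (Pm sr) zi (fun i => (hz i).1).
  have rz w : root (P s) w -> exists i, w = z i.
    move=> /rootP; rewrite Pz horner_prod => /eqP; rewrite prodf_seq_eq0 => /hasP[i _ /=].
    by rewrite hornerXsubC subr_eq0 => /eqP ->; exists i.
  have [i xE] := rz x xs; have [j yE] := rz y ys.
  have ij : i != j by apply: contraNneq xy => ij; rewrite xE yE ij.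
  by have := far i j ij; rewrite -xE -yE; clra.
pose eta := eta0 / 2.
have eta_gt0 : 0 < eta by rewrite divr_gt0.
have eta_in : 0 < eta < eta0 by rewrite eta_gt0 /eta; lra.
have sep s : cabs (s - c) <= rho -> forall x y, root (P s) x -> root (P s) y ->
    cabs (x - y) < 4 * eta -> x = y.
  move=> sr x y xs ys xy; apply/eqP; apply: contraTT xy; rewrite -leNgt.
  exact: (heta0 _ eta_in s sr (rho1 _ sr)).
(* Uniform continuity of the set of roots: short moves of [s] displace each root by less than
   [eta]. *)
have [|del0 del00 hdel0] := @disk_uniform c rho (fun e s => cabs (s - c) < r ->
  forall s', cabs (s' - c) < r -> cabs (s' - s) < e ->
  forall x, root (P s) x -> exists2 y, root (P s') y & cabs (x - y) < eta) rho0.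
  move=> s0 /rho2 s0r.
  have eta20 : 0 < eta / 2 by rewrite divr_gt0.
  have [e e0 he] := local_close_roots s0r eta20.
  have e20 : 0 < e / 2 by rewrite divr_gt0.
  exists (e / 2), (e / 2); split => // s se e' /andP[_ e'e] sr s' s'r ss' x xr.
  have [|_ [_ bwd]] := he s; first by clra.
  have [|_ [fwd _]] := he s'; first by have := cabs_triangle s s' s0; lra.
  have [u ur ux] := bwd x xr; have [y yr uy] := fwd u ur.
  exists y => //; have := cabs_triangle u x y; rewrite (cabs_subC x u); clra.
pose del := del0 / 2.
have del_gt0 : 0 < del by rewrite divr_gt0.
have del_in : 0 < del < del0 by rewrite del_gt0 /del; lra.
have move_root s s' x : cabs (s - c) <= rho -> cabs (s' - c) <= rho -> cabs (s' - s) < del ->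
    root (P s) x -> exists2 y, root (P s') y & cabs (x - y) < eta.
  by move=> sr s'r ss' xr; exact: (hdel0 _ del_in s sr (rho1 _ sr) s' (rho1 _ s'r) ss' x xr).
have [N hN] : exists N : nat, rho < del * N.+1%:R.
  exists (Num.bound (rho / del)).
  have := archi_boundP (divr_ge0 (ltW rho0) (ltW del_gt0)).
  rewrite ltr_pdivrMr // => h; apply: lt_le_trans h _.
  by rewrite mulrC ler_wpM2l ?ler_nat // ltW.
pose la (k : nat) : R := k%:R / N.+1%:R.
have la01 k : (k <= N.+1)%N -> 0 <= la k <= 1.
  move=> kN; rewrite divr_ge0 //= ler_pdivrMr ?ltr0n // mul1r ler_nat //.
pose pt k s := c + (la k)%:CC * (s - c).
have ptc k s s' : (k <= N.+1)%N -> cabs (pt k s - pt k s') <= cabs (s - s').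
  move=> /la01/andP[l0 l1].
  have -> : pt k s - pt k s' = (la k)%:CC * (s - s') by rewrite /pt; ring.
  by rewrite cabsM cabsR ger0_norm // ler_piMl ?cabs_ge0.
have ptr k s : (k <= N.+1)%N -> cabs (s - c) <= rho -> cabs (pt k s - c) <= rho.
  move=> kN sr; apply: le_trans sr; have := ptc k s c kN.
  by rewrite (_ : pt k c = c) // /pt subrr mulr0 addr0.
have ptS k s : cabs (s - c) <= rho -> cabs (pt k.+1 s - pt k s) < del.
  move=> sr.
  have -> : pt k.+1 s - pt k s = (N.+1%:R^-1)%:CC * (s - c).
    rewrite /pt /la -(natr1 k) mulrDl mul1r rmorphD /=; ring.
  rewrite cabsM cabsR ger0_norm ?invr_ge0 // mulrC ltr_pdivrMr ?ltr0n //.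
  exact: le_lt_trans hN.
have hnxt' (sx : C * C) : exists y, (exists2 y, root (P sx.1) y & cabs (sx.2 - y) < eta) ->
    root (P sx.1) y /\ cabs (sx.2 - y) < eta.
  have [[y y1 y2]|nh] := pselect (exists2 y, root (P sx.1) y & cabs (sx.2 - y) < eta).
    by exists y.
  by exists 0 => /nh.
have [nxt hnxt] := choice hnxt'.
pose X z s := fix X k := if k is k'.+1 then nxt (pt k s, X k') else z.
have X0 z s : X z s 0%N = z by [].
have XS z s k : X z s k.+1 = nxt (pt k.+1 s, X z s k) by [].
have Xinv z s : root (P c) z -> cabs (s - c) <= rho -> forall k, (k <= N.+1)%N ->
    root (P (pt k s)) (X z s k).
  move=> zr sr; elim=> [|k IH] kN.
    by rewrite X0 /pt /la mul0r rmorph0 mul0r addr0.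
  rewrite XS; have [] // := hnxt (pt k.+1 s, X z s k).
  by apply: move_root (IH (ltnW kN)); [exact/ptr/sr/ltnW|exact: ptr|exact: ptS].
have Xstep z s : root (P c) z -> cabs (s - c) <= rho -> forall k, (k < N.+1)%N ->
    cabs (X z s k - X z s k.+1) < eta.
  move=> zr sr k kN; rewrite XS; have [] // := hnxt (pt k.+1 s, X z s k).
  by apply: move_root (Xinv _ _ zr sr _ (ltnW kN)); [exact/ptr/sr/ltnW|exact: ptr|exact: ptS].
(* Two neighbouring segments are compared step by step: the two candidate roots are joined by four
   gaps of less than [eta], so by separation they coincide. *)
have Xcont z s s' : root (P c) z -> cabs (s - c) <= rho -> cabs (s' - c) <= rho ->
    cabs (s' - s) < del -> forall k, (k <= N.+1)%N -> cabs (X z s k - X z s' k) < eta.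
  move=> zr sr s'r ss'; elim=> [|k IH] kN; first by rewrite !X0 subrr cabs0.
  have [||w wr hw] := @move_root (pt k.+1 s) (pt k.+1 s') (X z s k.+1) (ptr _ _ kN sr) (ptr _ _ kN s'r).
  - by apply: le_lt_trans ss'; exact: ptc.
  - exact: Xinv.
  suff <- : w = X z s' k.+1 by [].
  apply: (@sep (pt k.+1 s')) => //; [exact: ptr|exact: Xinv|].
  have h1 := Xstep z s zr sr k kN; have h2 := Xstep z s' zr s'r k kN.
  have h3 := IH (ltnW kN).
  have t1 := cabs_triangle (X z s k.+1) w (X z s' k.+1).
  have t2 := cabs_triangle (X z s k) (X z s k.+1) (X z s' k.+1).
  have t3 := cabs_triangle (X z s' k) (X z s k) (X z s' k.+1).
  by move: t1 t2; rewrite (cabs_subC w (X z s k.+1)) (cabs_subC (X z s k.+1) (X z s k)); lra.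
(* Backwards along the segment: equal end points come from roots less than [2 * eta] apart, which
   are therefore equal. *)
have Xinj z z' s : root (P c) z -> root (P c) z' -> cabs (s - c) <= rho ->
    forall k, (k <= N.+1)%N -> X z s k = X z' s k -> z = z'.
  move=> zr z'r sr; elim=> [|k IH] kN //= XX.
  apply: IH; first exact: ltnW.
  apply: (@sep (pt k s)); [exact/ptr/sr/ltnW|exact/Xinv/ltnW|exact/Xinv/ltnW|].
  have h1 := Xstep z s zr sr k kN; have h2 := Xstep z' s z'r sr k kN.
  have := cabs_triangle (X z s k.+1) (X z s k) (X z' s k).
  have -> : X z s k.+1 = X z' s k.+1 by [].
  have e1 : X z s k.+1 = X z' s k.+1 by [].
  by move: h1; rewrite e1 (cabs_subC (X z' s k.+1) (X z' s k)); lra.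
have ptN s : pt N.+1 s = s.
  by rewrite /pt /la divff ?rmorph1 ?mul1r ?subrKC // pnatr_eq0.
have cc : cabs (c - c) < r by rewrite subrr cabs0.
have [xi xii Pxi] := separable_uniq_prod (Pm cc) (Psep cc).
have xir i : root (P c) (xi i).
  by rewrite Pxi /root horner_prod (bigD1 i) //= hornerXsubC subrr mul0r.
pose x i s := X (xi i) s N.+1.
have xroot i s : cabs (s - c) <= rho -> root (P s) (x i s).
  by move=> sr; rewrite -[in P s](ptN s); exact: Xinv.
have xinj s : cabs (s - c) <= rho -> injective (x ^~ s).
  by move=> sr i j xij; apply: xii; apply: (Xinj (xi i) (xi j) s) xij.
have xcont i s : cabs (s - c) < rho -> ccont (x i) s.
  move=> sr e e0.
  have me : 0 < Num.min e eta by rewrite lt_min e0.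
  have [k k0 hk] := local_close_roots (rho1 _ (ltW sr)) me.
  exists (Num.min k (Num.min del (rho - cabs (s - c)))).
    by rewrite !lt_min k0 del_gt0 subr_gt0.
  move=> s'; rewrite !lt_min => /and3P[sk sd s's].
  have s'r := ltW (cabs_in_disk s's).
  have [_ [_ bwd]] := hk s' sk.
  have [w wr] := bwd _ (xroot i s' s'r); rewrite lt_min => /andP[we weta].
  suff <- : w = x i s by rewrite cabs_subC.
  apply: (@sep s) => //; [exact: ltW|exact/xroot/ltW|].
  have := Xcont (xi i) s s' (xir i) (ltW sr) s'r sd N.+1 (leqnn _).
  have := cabs_triangle (x i s') w (x i s).
  by rewrite (cabs_subC (x i s')) /x; lra.
exists x => s sr.
have srho : cabs (s - c) < rho by apply: lt_trans sr _; rewrite /rho; have := r0; clra.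
split.
- apply: uniq_roots_prod; [exact/Pm/rho1/ltW|exact/xinj/ltW|].
  by move=> i; exact/xroot/ltW.
- exact/xinj/ltW.
- move=> i; apply: (@hol_root d P _ s (rho - cabs (s - c))).
  + by rewrite subr_gt0.
  + move=> s' s's; have s'r := ltW (cabs_in_disk s's).
    by split; [exact/Pm/rho1|exact: xroot].
  + by apply: Ph; exact/rho1/ltW.
  + exact/Psep/rho1/ltW.
  + exact: xcont.
Qed.

End LocalRoots.

End PolynomialRoots.

(** * Transfer of coalescing roots from a point to a disk *)

Section Transfer.
Context {R : realType}.
Local Notation C := (Cplx R).
Local Notation "x %:CC" := ((x : R)%:C%C : C) (at level 2, format "x %:CC").

Lemma coef_prod_bound (rs : seq C) (B : R) k : 0 <= B ->
  (forall x, x \in rs -> cabs x <= B) ->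
  cabs (\prod_(x <- rs) ('X - x%:P))`_k <= 2 ^+ size rs * B ^+ (size rs - k).
Proof.
move=> B0; elim: rs k => [|x rs IH] k hx.
  rewrite big_nil coefC sub0n !mul1r; case: eqP => _; first by rewrite cabs1.
  by rewrite cabs0.
rewrite big_cons mulrBl coefB coefXM coefCM /= exprS.
have hrs y : y \in rs -> cabs y <= B by move=> yr; apply: hx; rewrite inE yr orbT.
have xB : cabs x <= B by apply: hx; exact: mem_head.
have T0 : 0 <= 2 ^+ size rs * B ^+ ((size rs).+1 - k) by rewrite mulr_ge0 ?exprn_ge0.
apply: le_trans (cabsB _ _) _; rewrite -mulrA mulr_natl mulr2n; apply: lerD.
  by case: k T0 => [|k] T0 /=; [rewrite cabs0|rewrite subSS IH].
rewrite cabsM; have [ks|sk] := leqP k (size rs).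
  rewrite subSn // exprS mulrCA; apply: ler_pM; rewrite ?cabs_ge0 ?IH //.
by rewrite nth_default ?cabs0 ?mulr0 // size_prod_XsubC.
Qed.

Lemma separable_XnsubC n (a : C) : (0 < n)%N -> a != 0 -> separable_poly ('X^n - a%:P).
Proof.
move=> n0 a0; rewrite separable_poly.unlock; apply/Pdiv.ClosedField.coprimepP => x; rewrite !rootE !hornerE.
rewrite subr_eq0 => /eqP xa.
rewrite derivB derivXn derivC subr0 hornerMn hornerXn -mulr_natr mulf_eq0 negb_or.
rewrite pnatr_eq0 -lt0n n0 andbT; apply: contraNneq a0 => h.
by rewrite -xa -(prednK n0) exprS h mulr0.
Qed.

Lemma monicd_XnsubC n (a : C) : (0 < n)%N -> monicd n ('X^n - a%:P).
Proof. by move=> n0; split; [exact: monicXnsubC|exact: size_XnsubC]. Qed.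

(** The roots of ['X^n - (h s)%:P] are simple because [h] does not vanish; [hol_roots] makes the
    radius [r / 4] independent of [n]. *)
Lemma hol_nth_root n (h : C -> C) c r : (0 < n)%N -> 0 < r ->
  (forall s, cabs (s - c) < r -> hol h s) -> (forall s, cabs (s - c) < r -> h s != 0) ->
  exists g : C -> C, forall s, cabs (s - c) < r / 4 -> hol g s /\ g s ^+ n = h s.
Proof.
move=> n0 r0 hh hn0.
have [x hx] := @hol_roots _ n (fun s => 'X^n - (h s)%:P) c r r0
  (fun s _ => monicd_XnsubC (h s) n0)
  (fun s sr => separable_XnsubC n0 (hn0 s sr))
  ltac:(move=> s sr i _; apply: (@hol_ext _ (fun s => (i == n)%:R - (if i == 0%N then h s else 0)));
    [by move=> z; rewrite coefB coefXn coefC|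
     apply: holB; [exact: hol_cst|case: eqP => _; [exact: hh|exact: hol_cst]]]).
exists (x (Ordinal n0)) => s sr; have [Ps _ xh] := hx s sr; split => //.
have : root ('X^n - (h s)%:P) (x (Ordinal n0) s).
  by rewrite Ps /root horner_prod (bigD1 (Ordinal n0)) //= hornerXsubC subrr mul0r.
by rewrite rootE !hornerE subr_eq0 => /eqP.
Qed.

(* A form of Harnack's inequality: an N-th root of h has modulus at most 1/2
   at the centre, hence at most 3/4 on a disk whose radius does not depend on N. *)
Lemma harnack_small N (h : C -> C) c r : (0 < N)%N -> 0 < r ->
  (forall s, cabs (s - c) < r -> hol h s) -> (forall s, cabs (s - c) < r -> h s != 0) ->
  (forall s, cabs (s - c) < r -> cabs (h s) <= 1) -> cabs (h c) <= (1 / 2) ^+ N ->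
  forall s, cabs (s - c) <= r / 80 -> cabs (h s) <= (3 / 4) ^+ N.
Proof.
move=> N0 r0 hh hn0 h1 hc s sr.
have [g hg] := hol_nth_root N0 r0 hh hn0.
have r50 : 0 < r / 5 by rewrite divr_gt0.
have r5 z : cabs (z - c) <= r / 5 -> cabs (z - c) < r / 4 by move=> ?; lra.
have gh z : cabs (z - c) <= r / 5 -> hol g z by move=> /r5/hg[].
have gN z : cabs (z - c) <= r / 5 -> g z ^+ N = h z by move=> /r5/hg[].
have cc : cabs (c - c) <= r / 5 by rewrite subrr cabs0 ltW.
have g1 z : cabs (z - c) <= r / 5 -> cabs (g z) <= 1.
  move=> zr; rewrite -(@ler_pXn2r _ N) ?nnegrE ?cabs_ge0 // expr1n -cabsX gN //.
  by apply: h1; lra.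
have gc : cabs (g c) <= 1 / 2.
  by rewrite -(@ler_pXn2r _ N) ?nnegrE ?cabs_ge0 // -cabsX gN.
have sr5 : cabs (s - c) <= r / 5 by lra.
(* On the disk of radius [r / 5] the Lipschitz constant of [g] is [20 / r]; a distance of [r / 80]
   costs 1/4, so 1/2 becomes 3/4. *)
have L : cabs (g s - g c) <= 4 * 1 / (r / 5) * cabs (s - c).
  apply: (@cauchy_lipschitz _ [::] g c (r / 5) 1 r50).
  - by move=> z zr; apply/hol_ccont/gh.
  - by move=> z zr _; exact: gh.
  - by move=> z zr; apply: g1; rewrite zr.
  - by rewrite subrr cabs0; lra.
  - exact: gh.
  - exact: sr5.
have : 4 * 1 / (r / 5) * cabs (s - c) <= 4 * 1 / (r / 5) * (r / 80).
  by apply: ler_wpM2l sr; rewrite divr_ge0 // ?ltW // mulr_ge0.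
have -> : 4 * 1 / (r / 5) * (r / 80) = 1 / 4 by field; rewrite gt_eqF.
move=> L2; have g34 : cabs (g s) <= 3 / 4 by have := cabs_le_add (g s) (g c); clra.
rewrite -gN // cabsX lerXn2r ?nnegrE ?cabs_ge0 //; lra.
Qed.

Lemma exists_expr_le (q e : R) : 0 <= q < 1 -> 0 < e -> exists2 N, (0 < N)%N & q ^+ N <= e.
Proof.
move=> /andP[q0 q1] e0.
have /cvgrPdist_lt/(_ _ e0)[n _ /(_ n.+1 (leqnSn n))] : q ^+ n @[n --> \oo] --> (0 : R).
  by apply: cvg_expr; rewrite ger0_norm.
by rewrite /= sub0r normrN ger0_norm ?exprn_ge0 // => h; exists n.+1 => //; exact: ltW.
Qed.

(** Separability keeps the difference of two roots nonzero, so [harnack_small] applies to it after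
    division by its bound [2 * B]. As the coefficient of degree [d.-1] is 0, each root is the mean
    of its differences with all roots, and small differences mean small roots. The fraction 1/320 is
    1/4 from [hol_roots] times 1/80 from [harnack_small]. *)
Theorem coalescence_transfer d (M eta : R) : 0 <= M -> 0 < eta -> exists2 del : R, 0 < del &
  forall (P : C -> {poly C}) c r, 0 < r ->
  (forall s, cabs (s - c) < r -> monicd d (P s)) ->
  (forall s, cabs (s - c) < r -> separable_poly (P s)) ->
  (forall s, cabs (s - c) < r -> forall i, (i < d)%N -> hol (fun s => (P s)`_i) s) ->
  (forall s, cabs (s - c) < r -> forall i, (i < d)%N -> cabs (P s)`_i <= M) ->
  (forall s, cabs (s - c) < r -> (P s)`_d.-1 = 0) ->
  (forall i, (i < d)%N -> cabs (P c)`_i <= del) ->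
  forall s, cabs (s - c) <= r / 320 -> forall i, (i < d)%N -> cabs (P s)`_i <= eta.
Proof.
move=> M0 eta0.
have [->|d0] := posnP d; first by exists 1.
pose B := 1 + d%:R * M.
have B1 : 1 <= B by rewrite lerDl mulr_ge0.
have B0 : 0 < B by lra.
pose e1 := Num.min 1 (eta / 2 ^+ d).
have e10 : 0 < e1 by rewrite lt_min ltr01 divr_gt0 ?exprn_gt0.
have q1 : 0 <= (3 / 4 : R) < 1 by apply/andP; split; lra.
have eB : 0 < e1 / (2 * B) by rewrite divr_gt0 ?mulr_gt0.
(* [N] is large enough for [2 * B * (3 / 4) ^+ N] to be at most [e1]; roots of modulus at most [sg]
   at [c] have differences at most [2 * B * (1 / 2) ^+ N]. *)
have [N N0 hN] := exists_expr_le q1 eB.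
pose sg := B * (1 / 2) ^+ N.
have sg0 : 0 < sg by rewrite mulr_gt0 ?exprn_gt0.
have [del del0 hdel] := close_roots d M0 sg0.
exists del => // P c r r0 Pm Psep Ph PM P0 Pc s sr i id.
have [x hx] := @hol_roots _ d P c r r0 Pm Psep Ph.
have r40 : 0 < r / 4 by rewrite divr_gt0.
have in_r z : cabs (z - c) < r / 4 -> cabs (z - c) < r by move=> ?; clra.
have xroot z j : cabs (z - c) < r / 4 -> root (P z) (x j z).
  move=> /hx[-> _ _].
  by rewrite /root horner_prod (bigD1 j) //= hornerXsubC subrr mul0r.
have xB z j : cabs (z - c) < r / 4 -> cabs (x j z) <= B.
  move=> zr; apply: monicd_root_bound (xroot z j zr) => //; [exact/Pm/in_r|].
  by move=> k kd; apply: PM => //; exact: in_r.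
have cc : cabs (c - c) < r / 4 by rewrite subrr cabs0.
have xsg j : cabs (x j c) <= sg.
  have [||||y] := hdel (P c) 'X^d _ _ _ _ _ (xroot c j cc).
  - exact/Pm/in_r.
  - by split; [exact: monicXn|exact: size_polyXn].
  - by move=> k kd; apply: PM => //; exact: in_r.
  - by move=> k kd; rewrite coefXn ltn_eqF // sub0r cabsN; exact: Pc.
  rewrite rootE hornerXn expf_eq0 d0 /= => /eqP -> ; rewrite subr0; exact: ltW.
have diff j k : cabs (x j s - x k s) <= e1.
  have [->|jk] := eqVneq j k; first by rewrite subrr cabs0 ltW.
  pose h z := (x j z - x k z) / (2 * B)%:CC.
  have cB : cabs (2 * B)%:CC = 2 * B by rewrite cabsR gtr0_norm // mulr_gt0.
  have B20 : 0 < 2 * B by rewrite mulr_gt0.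
  have Bn0 : (2 * B)%:CC != 0 by rewrite -cabs_eq0 cB gt_eqF.
  suff : cabs (h s) <= (3 / 4) ^+ N.
    rewrite /h cabsM cabsV cB ler_pdivrMr // => hh; apply: le_trans hh _.
    by rewrite -ler_pdivlMr.
  apply: (@harnack_small N h c (r / 4) N0 r40); last clra.
  - move=> z zr; have [_ _ xh] := hx z zr.
    by apply: (@hol_div _ (fun z => x j z - x k z) (fun=> (2 * B)%:CC));
      [exact: holB|exact: hol_cst|exact: Bn0].
  - move=> z zr; have [_ xi _] := hx z zr.
    by rewrite /h mulf_neq0 ?invr_eq0 // subr_eq0 (inj_eq xi).
  - move=> z zr; rewrite /h cabsM cabsV cB ler_pdivrMr // mul1r.
    by apply: le_trans (cabsB _ _) _; have := xB z j zr; have := xB z k zr; clra.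
  - rewrite /h cabsM cabsV cB ler_pdivrMr //; apply: le_trans (cabsB _ _) _.
    have := xsg j; have := xsg k; rewrite /sg; clra.
have sr4 : cabs (s - c) < r / 4 by clra.
have [Ps _ _] := hx s sr4.
have Pl : P s = \prod_(z <- [seq x k s | k <- enum 'I_d]) ('X - z%:P).
  by rewrite big_map big_enum.
have sl : size [seq x k s | k <- enum 'I_d] = d by rewrite size_map size_enum_ord.
have sum0 : \sum_(k < d) x k s = 0.
  have := P0 s (in_r _ sr4); rewrite Pl.
  have := @coefPn_prod_XsubC _ [seq x k s | k <- enum 'I_d]; rewrite sl => ->; last by rewrite -lt0n.
  by rewrite big_map big_enum => /eqP; rewrite oppr_eq0 => /eqP.
have xs j : cabs (x j s) <= e1.
  have E1 : d%:R * x j s = \sum_(k < d) (x j s - x k s).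
    by rewrite sumrB sum0 subr0 sumr_const card_ord mulr_natl.
  have dR : 0 < d%:R :> R by rewrite ltr0n.
  rewrite -(ler_pM2l dR) -{1}cabs_nat -cabsM E1.
  apply: le_trans (cabs_sum _ _ _) _.
  rewrite mulr_natl -[X in _ *+ X]card_ord -sumr_const.
  by apply: ler_sum => k _; exact: diff.
have e1_1 : e1 <= 1 by rewrite ge_min lexx.
have e1_2 : e1 * 2 ^+ d <= eta by rewrite -ler_pdivlMr ?exprn_gt0 // ge_min lexx orbT.
rewrite Pl; apply: le_trans (coef_prod_bound i (ltW e10) _) _.
  by move=> z /mapP[k _ ->].
rewrite sl; apply: le_trans e1_2; rewrite mulrC ler_wpM2r ?exprn_ge0 //.
by rewrite -[leRHS]expr1; apply: ler_wiXn2l => //; [exact: ltW|rewrite subn_gt0].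
Qed.

End Transfer.

(** * Orders of the coefficients along an arc *)

Section OrderOfVanishing.
Context {R : realType}.
Local Notation C := (Cplx R).

Lemma cmax_ge0 (t p : C) : 0 <= cmax t p.
Proof. by rewrite le_max cabs_ge0. Qed.

Lemma le_cmaxl (t p : C) : cabs t <= cmax t p. Proof. by rewrite le_max lexx. Qed.
Lemma le_cmaxr (t p : C) : cabs p <= cmax t p. Proof. by rewrite le_max lexx orbT. Qed.

Lemma cmax_le (t p : C) (r : R) : cabs t <= r -> cabs p <= r -> cmax t p <= r.
Proof. by move=> tr pr; rewrite ge_max tr. Qed.

Lemma hsum_bound (c : nat -> nat -> C) k : exists2 M : R, 0 <= M &
  forall t p, cabs (hsum c k t p) <= M * cmax t p ^+ k.
Proof.
exists (\sum_(l < k.+1) cabs (c (k - l)%N l)); first by apply: sumr_ge0 => l _; exact: cabs_ge0.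
move=> t p; apply: le_trans (cabs_sum _ _ _) _; rewrite mulr_suml; apply: ler_sum => l _.
rewrite !cabsM -mulrA ler_wpM2l ?cabs_ge0 // !cabsX.
have lk : (l <= k)%N by rewrite -ltnS.
have -> : cmax t p ^+ k = cmax t p ^+ (k - l) * cmax t p ^+ l by rewrite -exprD subnK.
apply: ler_pM; rewrite ?exprn_ge0 ?cabs_ge0 //;
  by rewrite lerXn2r ?nnegrE ?cabs_ge0 ?cmax_ge0 ?le_cmaxl ?le_cmaxr.
Qed.

(** [e] is the degree of the first nonzero homogeneous part, capped at [K]. The cap makes it defined
    for the zero germ too; at [e = K] only the upper bound remains. *)
Lemma taylor_order K (a : C -> C -> C) (r M : R) : 0 < r -> bihol r M a ->
  exists (c : nat -> nat -> C) (e : nat) (r' M' : R),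
  [/\ 0 < r', 0 <= M', (e < K)%N -> exists2 l, (l <= e)%N & c (e - l)%N l != 0,
      forall t p, cabs t <= r' -> cabs p <= r' -> cabs (a t p) <= M' * cmax t p ^+ e
    & (e < K)%N -> forall t p, cabs t <= r' -> cabs p <= r' ->
        cabs (a t p - hsum c e t p) <= M' * cmax t p ^+ e.+1].
Proof.
move=> r0 ha; have [c [r1 [M1 [r10 hc]]]] := taylor2 K r0 ha.
pose Q k := (K <= k)%N || `[< exists2 l, (l <= k)%N & c (k - l)%N l != 0 >].
have exQ : exists k, Q k by exists K; rewrite /Q leqnn.
pose e := ex_minn exQ.
have Qe : Q e by rewrite /e; case: ex_minnP.
have lt_e k : (k < e)%N -> forall t p, hsum c k t p = 0.
  rewrite /e; case: ex_minnP => m _ hm km t p.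
  have nQ : ~~ Q k by apply: contraL km => /hm; rewrite -leqNgt.
  move: nQ; rewrite /Q negb_or => /andP[_ /asboolPn nex].
  rewrite /hsum big1 // => l _.
  have [->|cl] := eqVneq (c (k - l)%N l) 0; first by rewrite !mul0r.
  by case: nex; exists l => //; rewrite -ltnS.
have eK : (e <= K)%N by rewrite /e; case: ex_minnP => m _ -> //; rewrite /Q leqnn.
have [B hB] : exists B : nat -> R, forall k, 0 <= B k /\ forall t p, cabs (hsum c k t p) <= B k * cmax t p ^+ k.
  have h k : exists B : R, 0 <= B /\ forall t p, cabs (hsum c k t p) <= B * cmax t p ^+ k.
    by have [B B0 hB] := hsum_bound c k; exists B.
  by have [B hB] := choice h; exists B.
pose N := `|M1| + \sum_(k < K) B k.
have SB : 0 <= \sum_(k < K) B k by apply: sumr_ge0 => k _; have [] := hB k.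
have N0 : 0 <= N by rewrite addr_ge0.
have M1N : M1 <= N by apply: le_trans (ler_norm _) _; rewrite lerDl.
pose r' := Num.min r1 1.
have r'0 : 0 < r' by rewrite lt_min r10 ltr01.
have r'1 : r' <= r1 by rewrite ge_min lexx.
have r'2 : r' <= 1 by rewrite ge_min lexx orbT.
have powle (x : R) i j : 0 <= x -> x <= 1 -> (j <= i)%N -> x ^+ i <= x ^+ j.
  by move=> x0 x1 ij; apply: ler_wiXn2l => //; rewrite x0.
have tail t p m : cabs t <= r' -> cabs p <= r' -> (e <= m <= K)%N ->
    cabs (a t p - \sum_(k < m) hsum c k t p) <= N * cmax t p ^+ m.
  move=> tr pr /andP[em mK].
  have cm0 := cmax_ge0 t p; have cm1 := le_trans (cmax_le tr pr) r'2.
  have := hc t p (le_trans tr r'1) (le_trans pr r'1).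
  have -> : \sum_(k < K) hsum c k t p = \sum_(k < m) hsum c k t p + \sum_(m <= k < K) hsum c k t p.
    by rewrite -!(big_mkord xpredT (fun k => hsum c k t p)) -big_cat_nat.
  rewrite opprD addrA => h1.
  apply: le_trans (cabs_le_add _ (a t p - \sum_(k < m) hsum c k t p - \sum_(m <= k < K) hsum c k t p)) _.
  rewrite subKr /N mulrDl; apply: lerD.
    apply: le_trans h1 _; apply: le_trans (ler_wpM2r (exprn_ge0 _ cm0) (ler_norm _)) _.
    by apply: ler_wpM2l => //; exact: powle.
  apply: le_trans (cabs_sum _ _ _) _.
  apply: (@le_trans _ _ (\sum_(m <= k < K) B k * cmax t p ^+ m)).
    rewrite big_nat_cond [leRHS]big_nat_cond; apply: ler_sum => k /andP[/andP[mk _] _].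
    have [Bk /(_ t p) hBk] := hB k; apply: le_trans hBk _.
    by apply: ler_wpM2l => //; exact: powle.
  rewrite -mulr_suml; apply: ler_wpM2r; first exact: exprn_ge0.
  rewrite -(big_mkord xpredT B).
  have -> : \sum_(0 <= k < K) B k = \sum_(0 <= k < m) B k + \sum_(m <= k < K) B k.
    by rewrite -big_cat_nat.
  rewrite lerDr.
  by apply: sumr_ge0 => k _; have [] := hB k.
have sum_e t p : \sum_(k < e) hsum c k t p = 0.
  by apply: big1 => k _; exact: lt_e.
exists c, e, r', N; split => //.
- by move=> eltK; move: Qe; rewrite /Q leqNgt eltK => /asboolP.
- move=> t p tr pr; have := tail t p e tr pr; rewrite sum_e subr0; apply.
  by rewrite leqnn.
- move=> eltK t p tr pr; have := tail t p e.+1 tr pr.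
  rewrite big_ord_recr /= sum_e add0r; apply.
  by rewrite leqnSn.
Qed.

Lemma uniform_radius n (Q : nat -> R -> R -> Prop) :
  (forall i r r' M M', Q i r M -> 0 < r' -> r' <= r -> M <= M' -> Q i r' M') ->
  (forall i, (i < n)%N -> exists r M : R, 0 < r /\ Q i r M) ->
  exists r M : R, [/\ 0 < r, 0 <= M & forall i, (i < n)%N -> Q i r M].
Proof.
move=> mono; elim: n => [|n IH] h; first by exists 1, 0.
have [i /ltnW/h //|r [M [r0 M0 hr]]] := IH.
have [r' [M' [r'0 hr']]] := h n (ltnSn n).
exists (Num.min r r'), (Num.max M M'); split.
- by rewrite lt_min r0.
- by rewrite le_max M0.
move=> i; rewrite ltnS leq_eqVlt => /predU1P[->|ilt].
  by apply: mono hr' _ _ _; rewrite ?lt_min ?r0 ?ge_min ?le_max ?lexx ?orbT.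
by apply: mono (hr i ilt) _ _ _; rewrite ?lt_min ?r0 ?ge_min ?le_max ?lexx ?orbT.
Qed.

Lemma nonroot_near0 (p : {poly C}) (e : R) : p != 0 -> 0 < e ->
  exists2 s, cabs s <= e & p.[s] != 0.
Proof.
move=> p0 e0; have [rs prs] := closed_field_poly_normal p.
have [d d0 hd] := punctured_notin rs 0.
have [||w [w0 wd we]] := @near_disk _ 0 0 e d; [by []|by rewrite subrr cabs0|].
exists w; first by rewrite subr0 in we; exact: ltW.
have : w \notin rs by exact: hd.
apply: contra => /eqP h; rewrite -root_prod_XsubC rootE.
by move: h; rewrite prs hornerZ => /eqP; rewrite mulf_eq0 lead_coef_eq0 (negPf p0).
Qed.

(** Monic of degree [d] for every [a], so a family has constant degree even where its coefficients
    are not controlled. *)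
Definition gpoly d (a : nat -> C) : {poly C} := \poly_(i < d.+1) (if i == d then 1 else a i).

Lemma coef_gpoly d a i : (i < d)%N -> (gpoly d a)`_i = a i.
Proof. by move=> id; rewrite coef_poly ltnW // ltn_eqF. Qed.

Lemma monicd_gpoly d a : monicd d (gpoly d a).
Proof.
have s : size (gpoly d a) = d.+1.
  by rewrite size_poly_eq //= eqxx oner_eq0.
by split => //; rewrite monicE lead_coefE s /= coef_poly ltnSn eqxx.
Qed.

Lemma horner_gpoly d a x : (gpoly d a).[x] = x ^+ d + \sum_(i < d) a i * x ^+ i.
Proof.
rewrite (horner_monicd x (monicd_gpoly d a)); congr (_ + _).
by apply: eq_bigr => i _; rewrite coef_gpoly.
Qed.

Lemma separableP (p : {poly C}) : reflect (forall x, root p x -> p^`().[x] != 0) (separable_poly p).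
Proof.
rewrite separable_poly.unlock; apply: (iffP (Pdiv.ClosedField.coprimepP _ _)) => h x /h //.
Qed.

Lemma gpoly_scale d (a : nat -> C) (la x : C) : la != 0 ->
  (gpoly d a).[la * x] = la ^+ d * (gpoly d (fun i => a i / la ^+ (d - i))).[x].
Proof.
move=> la0; rewrite !horner_gpoly exprMn mulrDr mulr_sumr; congr (_ + _).
apply: eq_bigr => i _; rewrite exprMn.
have id : (i <= d)%N by exact: ltnW.
have -> : la ^+ d = la ^+ (d - i) * la ^+ i by rewrite -exprD subnK.
by field; rewrite expf_neq0.
Qed.

Lemma gpoly_scale_root d (a : nat -> C) (la x : C) : la != 0 ->
  root (gpoly d (fun i => a i / la ^+ (d - i))) x = root (gpoly d a) (la * x).
Proof. by move=> la0; rewrite !rootE gpoly_scale // mulf_eq0 expf_eq0 (negPf la0) andbF. Qed.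

Lemma gpoly_scale_separable d (a : nat -> C) (la : C) : la != 0 ->
  separable_poly (gpoly d a) -> separable_poly (gpoly d (fun i => a i / la ^+ (d - i))).
Proof.
move=> la0 /(separable_uniq_prod (monicd_gpoly d a))[x xi Gx].
set q := gpoly d (fun i => _).
have -> : q = \prod_(i < d) ('X - (la^-1 * x i)%:P).
  apply: uniq_roots_prod; first exact: monicd_gpoly.
    by move=> i j /(mulfI (invr_neq0 la0)) /xi.
  move=> i; rewrite gpoly_scale_root // mulVKf // Gx /root horner_prod (bigD1 i) //=.
  by rewrite hornerXsubC subrr mul0r.
rewrite -(big_map (fun i => la^-1 * x i) xpredT (fun z => 'X - z%:P)) /index_enum -enumT.
rewrite separable_prod_XsubC map_inj_uniq ?enum_uniq //.
by move=> i j /(mulfI (invr_neq0 la0)) /xi.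
Qed.

End OrderOfVanishing.

(** * Newton slopes of the coefficients along the arc *)

Section Core.
Context {R : realType}.
Local Notation C := (Cplx R).
Local Notation "x %:CC" := ((x : R)%:C%C : C) (at level 2, format "x %:CC").

Lemma exists_root n (t : C) : (0 < n)%N -> exists x : C, x ^+ n = t.
Proof. by move=> n0; exists (n.-root t); rewrite rootCK. Qed.

Lemma exists_small (x : R) : 0 < x -> exists2 w : C, 0 < cabs w & cabs w < x.
Proof.
by move=> x0; exists (x / 2)%:CC; rewrite cabsR gtr0_norm ?divr_gt0 //; lra.
Qed.

Lemma gap_lt (x y x' y' : R) : `|x' - x| < `|x - y| / 2 -> `|y' - y| < `|x - y| / 2 ->
  x != y -> (x' < y') = (x < y).
Proof.
have [xy|yx|//] := ltgtP x y.
  have -> : `|x - y| = y - x by rewrite distrC gtr0_norm // subr_gt0.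
  by rewrite !ltr_norml => /andP[? ?] /andP[? ?] _; lra.
have -> : `|x - y| = x - y by rewrite gtr0_norm // subr_gt0.
rewrite !ltr_norml => /andP[? ?] /andP[? ?] _.
by apply/negbTE; rewrite -leNgt; lra.
Qed.

(** Families of roots are split off by inequalities [cabs (z ^+ m - h w) < cabs (v w)], which can
    change only through equality. The exponent [m] allows a power of [z] to be compared with a power
    of [w], so no root of [w ^+ k] has to be chosen. *)
Lemma locally_constant_lt m (h v : C -> C) w0 z0 : ccont h w0 -> ccont v w0 ->
  cabs (z0 ^+ m - h w0) != cabs (v w0) ->
  exists2 del : R, 0 < del & forall w z, cabs (w - w0) < del -> cabs (z - z0) < del ->
    (cabs (z ^+ m - h w) < cabs (v w)) = (cabs (z0 ^+ m - h w0) < cabs (v w0)).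
Proof.
move=> hc vc ne.
pose gap := `|cabs (z0 ^+ m - h w0) - cabs (v w0)|.
have gap0 : 0 < gap by rewrite normr_gt0 subr_eq0.
have gap40 : 0 < gap / 4 by rewrite divr_gt0.
have [d1 d10 h1] := hc _ gap40; have [d2 d20 h2] := vc _ gap40.
have [d3 d30 h3] := hol_ccont (holX m (hol_id z0)) gap40.
exists (Num.min d1 (Num.min d2 d3)); first by rewrite !lt_min d10 d20.
move=> w z; rewrite !lt_min => /and3P[/h1 w1 /h2 w2 _] /and3P[_ _ /h3 z3].
have A : `|cabs (z ^+ m - h w) - cabs (z0 ^+ m - h w0)| < gap / 2.
  have : cabs (z ^+ m - h w - (z0 ^+ m - h w0)) < gap / 2.
    have -> : z ^+ m - h w - (z0 ^+ m - h w0) = (z ^+ m - z0 ^+ m) - (h w - h w0) by ring.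
    by apply: le_lt_trans (cabsB _ _) _; lra.
  have := cabs_le_add (z ^+ m - h w) (z0 ^+ m - h w0).
  have := cabs_le_add (z0 ^+ m - h w0) (z ^+ m - h w).
  rewrite (cabs_subC (z0 ^+ m - h w0)) ltr_norml; lra.
have B : `|cabs (v w) - cabs (v w0)| < gap / 2.
  have := cabs_le_add (v w) (v w0); have := cabs_le_add (v w0) (v w).
  rewrite (cabs_subC (v w0)) ltr_norml; clra.
exact: gap_lt A B ne.
Qed.

Lemma cmax_cone (t p : C) : cabs p <= cabs t -> cmax t p = cabs t.
Proof. by move=> pt; apply/eqP; rewrite eq_le cmax_le //= le_cmaxl. Qed.

(* What the irreducibility of the arc-section says about the roots over the
   punctured arc t = w ^ k, p = pw w. *)
Definition nosplit d k (a : nat -> C -> C -> C) (pw : C -> C) :=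
  forall (S : C -> C -> Prop) (rho : R), 0 < rho ->
  let G w := gpoly d (fun i => a i (w ^+ k) (pw w)) in
  (forall w0 z0, 0 < cabs w0 < rho -> root (G w0) z0 ->
     exists2 e : R, 0 < e & forall w z, cabs (w - w0) < e -> cabs (z - z0) < e ->
       root (G w) z -> (S w z <-> S w0 z0)) ->
  (exists2 e : R, 0 < e & forall w z, 0 < cabs w < e -> root (G w) z -> S w z) \/
  (exists2 e : R, 0 < e & forall w z, 0 < cabs w < e -> root (G w) z -> ~ S w z).

(** [a i] are the coefficients after the Tschirnhaus translation, which gives [a_sub]; [e i] are
    their orders in both variables and [c i] their Taylor coefficients. An order not below [d.+1]
    carries only an upper bound. [eps] is the opening of the cone around the tangent on which the
    roots are simple, and [pwK] places the arc in it. *)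
Variables (d k : nat) (a : nat -> C -> C -> C) (pw : C -> C)
  (c : nat -> nat -> nat -> C) (e : nat -> nat) (r M eps K : R).
Hypotheses (k0 : (0 < k)%N) (r0 : 0 < r) (r1 : r <= 1) (M1 : 1 <= M)
  (eps0 : 0 < eps) (eps1 : eps <= 1) (K0 : 0 < K)
  (ah : forall i, (i < d)%N -> forall t p, cabs t <= r -> cabs p <= r -> hol (a i t) p)
  (ab : forall i, (i < d)%N -> forall t p, cabs t <= r -> cabs p <= r ->
     cabs (a i t p) <= M * cmax t p ^+ e i)
  (ac : forall i, (i < d)%N -> (e i < d.+1)%N -> forall t p, cabs t <= r -> cabs p <= r ->
     cabs (a i t p - hsum (c i) (e i) t p) <= M * cmax t p ^+ (e i).+1)
  (cn0 : forall i, (i < d)%N -> (e i < d.+1)%N -> exists2 l, (l <= e i)%N & c i (e i - l)%N l != 0)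
  (e_gt0 : forall i, (i < d)%N -> (0 < e i)%N)
  (a_sub : forall t p, a d.-1 t p = 0)
  (sep : forall t p, 0 < cabs t < r -> cabs p < eps * cabs t ->
     separable_poly (gpoly d (fun i => a i t p)))
  (pwK : forall w, cabs w < r -> cabs (pw w) <= K * cabs w ^+ k.+1)
  (arc_hol : forall i, (i < d)%N -> forall w, cabs w < r -> hol (fun w => a i (w ^+ k) (pw w)) w)
  (ns : nosplit d k a pw).

Lemma arc_small w : 0 < cabs w < r -> K * cabs w < eps ->
  [/\ 0 < cabs (w ^+ k) < r, cabs (pw w) < eps * cabs (w ^+ k) & w != 0].
Proof.
move=> /andP[w0 wr] Kw.
have wk0 : 0 < cabs (w ^+ k) by rewrite cabsX exprn_gt0.
split; last by rewrite -cabs_gt0.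
- rewrite wk0 /= cabsX; apply: (le_lt_trans _ wr); rewrite -[leRHS]expr1.
  apply: ler_wiXn2l => //; first exact: ltW.
  by have := r1; lra.
- apply: le_lt_trans (pwK wr) _; rewrite exprS mulrA cabsX ltr_pM2r ?exprn_gt0 //.
Qed.

Section Slope.
Variables (ee ff : nat).
Hypotheses (ff0 : (0 < ff)%N) (ee_ff : (ee <= ff)%N)
  (slope : forall i, (i < d)%N -> (ee * (d - i) <= e i * ff)%N).

(** In terms of [ta] the order of [a i] is [e i * ff >= ee * (d - i)], and [cabs ta <= 1]. *)
Lemma scaled_bound i t p (ta : C) : (i < d)%N -> 0 < cabs t <= r -> cabs p <= cabs t -> ta ^+ ff = t ->
  cabs (a i t p / (ta ^+ ee) ^+ (d - i)) <= M.
Proof.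
move=> id /andP[t0 tr] pt tat.
have := ab id tr (le_trans pt tr); rewrite cmax_cone // -{2}tat cabsX.
have ta0 : 0 < cabs ta.
  rewrite lt_def cabs_ge0 andbT; apply: contraTneq t0 => ta0.
  by rewrite -tat cabsX ta0 expr0n (gtn_eqF ff0) ltxx.
have ta1 : cabs ta <= 1.
  rewrite -(@ler_pXn2r _ ff) ?nnegrE ?cabs_ge0 // expr1n -cabsX tat.
  exact: le_trans tr r1.
move=> h; rewrite cabsM cabsV !cabsX ler_pdivrMr ?exprn_gt0 //; apply: le_trans h _.
rewrite -!exprM; apply: ler_wpM2l; first by have := M1; lra.
apply: ler_wiXn2l; [exact: ltW|exact: ta1|by rewrite [(ff * _)%N]mulnC slope].
Qed.

(** For fixed [t] and [p = s * t], the rescaled coefficient [i0] is [Q.[s]] up to [M * cabs t]. [Q]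
    may vanish at 0, the direction of the arc, but not at some small [s1]. If all rescaled
    coefficients were below [del] at the slope [sw] of the arc point, [coalescence_transfer] in the
    variable [s] would make the coefficient [i0] at [s1] at most half of [cabs Q.[s1]]. *)
Lemma arc_lower i0 : (i0 < d)%N -> ee = e i0 -> ff = (d - i0)%N -> exists c0 rho : R,
  [/\ 0 < c0, 0 < rho & forall w ta, 0 < cabs w < rho -> ta ^+ ff = w ^+ k ->
  exists2 i, (i < d)%N & c0 <= cabs (a i (w ^+ k) (pw w) / (ta ^+ ee) ^+ (d - i))].
Proof.
move=> i0d eeE ffE.
have eed : (e i0 < d.+1)%N by rewrite -eeE ltnS (leq_trans ee_ff) // ffE leq_subr.
pose Q : {poly C} := \poly_(l < ee.+1) c i0 (ee - l)%N l.
have Q0 : Q != 0.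
  have [l lee cl] := cn0 i0d eed; apply: contra_neq cl => Q0.
  have /(congr1 (fun q : {poly C} => q`_l)) := Q0.
  by rewrite coef0 coef_poly ltnS eeE lee.
(* [s1] and [sw] will both have modulus at most [E], so their distance is at most 1/320 of the
   radius [eps / 2] of the disk around [sw]. *)
have [E [E0 E8 E2]] : exists E : R, [/\ 0 < E, E <= eps / 8 & E + E <= eps / 2 / 320].
  by exists (eps / 1280); have := eps0; split; lra.
have [E_half E_eps] : E <= eps / 2 /\ E < eps by have := eps0; split; lra.
have [s1 s1e Qs1] := nonroot_near0 Q0 E0.
pose ka := cabs Q.[s1].
have ka0 : 0 < ka by rewrite cabs_gt0.
have ka20 : 0 < ka / 2 by rewrite divr_gt0.
have M0 : 0 <= M by have := M1; lra.
have Mgt0 : 0 < M by have := M1; lra.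
have [del del0 hdel] := coalescence_transfer d M0 ka20.
exists del, (Num.min r (Num.min (E / K) (ka / (2 * M)))).
split => //; first by rewrite !lt_min r0 !divr_gt0 // mulr_gt0.
move=> w ta; rewrite !lt_min => /andP[w0 /and3P[wr wK wM]] tak.
rewrite ltr_pdivlMr ?mulr_gt0 // in wK; rewrite ltr_pdivlMr ?mulr_gt0 // in wM.
have w0r : 0 < cabs w < r by rewrite w0.
have Kw : K * cabs w < eps by have := E0; clra.
have [/andP[t0 tr] pt wn0] := arc_small w0r Kw.
set t := w ^+ k in t0 tr pt tak *.
have tn0 : t != 0 by rewrite -cabs_gt0.
have ta0 : ta != 0.
  by apply: contra_neq tn0 => ta0; rewrite -tak ta0 expr0n (gtn_eqF ff0).
have la0 : ta ^+ ee != 0 by rewrite expf_neq0.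
pose P s := gpoly d (fun i => a i t (s * t) / (ta ^+ ee) ^+ (d - i)).
pose sw := pw w / t.
have swt : sw * t = pw w by rewrite divfK.
have swe : cabs sw <= E.
  rewrite /sw cabsM cabsV ler_pdivrMr //; apply: le_trans (pwK wr) _.
  rewrite exprS mulrA /t cabsX; apply: ler_wpM2r; first by rewrite exprn_ge0 ?cabs_ge0.
  by clra.
have s_eps s : cabs (s - sw) < eps / 2 -> cabs s < eps.
  move=> h; rewrite [eps]splitr; apply: le_lt_trans (cabs_le_add s sw) _.
  by apply: ler_ltD h; exact: le_trans E_half.
have st s : cabs s < eps -> cabs (s * t) < eps * cabs t.
  by move=> h; rewrite cabsM ltr_pM2r.
have st1 s : cabs s < eps -> cabs (s * t) <= cabs t.
  move=> /st h; apply: le_trans (ltW h) _; apply: ler_piMl => //; exact: ltW.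
have st2 s : cabs s < eps -> cabs (s * t) <= r.
  by move=> /st1 h; apply: le_trans h _; exact: ltW.
have tr' : 0 < cabs t <= r by rewrite t0 ltW.
have hol_st i s : (i < d)%N -> cabs s < eps -> hol (fun s => a i t (s * t)) s.
  move=> id se; apply: (@hol_comp _ (fun s => s * t) (a i t)).
    by apply: holM; [exact: hol_id|exact: hol_cst].
  by apply: ah => //; [exact: ltW|exact: st2].
apply: contrapT => nex.
have := hdel P sw (eps / 2) _ _ _ _ _ _ _ s1 _ i0 i0d.
have -> : (P s1)`_i0 = a i0 t (s1 * t) / t ^+ ee.
  by rewrite coef_gpoly // -exprM mulnC exprM -ffE tak.
have s1eps : cabs s1 < eps by exact: le_lt_trans E_eps.
suff big : ka / 2 < cabs (a i0 t (s1 * t) / t ^+ ee).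
  move=> hsmall; have {}hsmall := hsmall _ _ _ _ _ _ _ _.
  suff : cabs (a i0 t (s1 * t) / t ^+ ee) <= ka / 2 by rewrite leNgt big.
  apply: hsmall.
  - by rewrite divr_gt0.
  - by move=> s _; exact: monicd_gpoly.
  - move=> s /s_eps se; apply: gpoly_scale_separable => //.
    by apply: sep; [rewrite t0|exact: st].
  - move=> s /s_eps se i id.
    apply: (@hol_ext _ (fun s => a i t (s * t) / (ta ^+ ee) ^+ (d - i))).
      by move=> z; rewrite coef_gpoly.
    by apply: holM; [exact: hol_st|exact: hol_cst].
  - move=> s /s_eps se i id; rewrite coef_gpoly //.
    by apply: scaled_bound => //; exact: st1.
  - move=> s _; case: (posnP d) => [dE|dpos]; first by rewrite dE ltn0 in i0d.
    by rewrite coef_gpoly ?prednK // a_sub mul0r.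
  - move=> i id; rewrite coef_gpoly // swt leNgt; apply/negP => h.
    by apply: nex; exists i => //; exact: ltW.
  - exact: le_trans (cabsB s1 sw) (le_trans (lerD s1e swe) E2).
have hQ : hsum (c i0) ee t (s1 * t) = t ^+ ee * Q.[s1].
  rewrite horner_poly mulr_sumr; apply: eq_bigr => l _.
  have le : (l <= ee)%N by rewrite -ltnS.
  have -> : t ^+ ee = t ^+ (ee - l) * t ^+ l by rewrite -exprD subnK.
  by rewrite exprMn; ring.
have := ac i0d eed (ltW tr) (st2 _ s1eps).
rewrite -eeE hQ cmax_cone ?st1 // => h.
have te0 : 0 < cabs (t ^+ ee) by rewrite cabs_gt0 expf_neq0.
rewrite cabsM cabsV ltr_pdivlMr //.
have h2 : ka * cabs (t ^+ ee) <= cabs (a i0 t (s1 * t)) + M * cabs t ^+ ee.+1.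
  rewrite /ka mulrC -cabsM; apply: le_trans (cabs_le_add _ (a i0 t (s1 * t))) _.
  by rewrite lerD2l cabs_subC.
rewrite exprS -cabsX mulrA in h2.
have tw : cabs t <= cabs w.
  rewrite /t cabsX -[leRHS]expr1; apply: ler_wiXn2l => //; first exact: ltW.
  by have := r1; clra.
have : M * cabs t * cabs (t ^+ ee) < ka / 2 * cabs (t ^+ ee).
  rewrite ltr_pM2r //; have : M * cabs t <= M * cabs w by rewrite ler_wpM2l.
  clra.
clra.
Qed.

(** The power [ff] removes the choice of [ta]: it leaves the modulus of a quotient of functions of
    [w] that is bounded off 0, and the singularity of that quotient is removable. *)
Lemma arc_power_limit i : (i < d)%N -> exists g : C -> C, exists2 rho : R, 0 < rho &
  hol g 0 /\ forall w ta, 0 < cabs w < rho -> ta ^+ ff = w ^+ k ->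
    cabs (a i (w ^+ k) (pw w) / (ta ^+ ee) ^+ (d - i)) ^+ ff = cabs (g w).
Proof.
move=> id.
pose be w := (a i (w ^+ k) (pw w)) ^+ ff / w ^+ (k * (ee * (d - i))).
have beE w ta : ta ^+ ff = w ^+ k ->
    cabs (a i (w ^+ k) (pw w) / (ta ^+ ee) ^+ (d - i)) ^+ ff = cabs (be w).
  move=> tak; rewrite -cabsX exprMn exprVn; congr (cabs (_ / _)).
  by rewrite -!exprM [(ee * _ * _)%N]mulnC exprM tak -exprM.
pose rho := Num.min r (eps / K).
have rho0 : 0 < rho by rewrite lt_min r0 divr_gt0.
have small w : w != 0 -> cabs (w - 0) < rho -> 0 < cabs w < r /\ K * cabs w < eps.
  rewrite -cabs_gt0 subr0 lt_min ltr_pdivlMr // => -> /andP[-> h].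
  by rewrite mulrC.
have [w w0 /(small w w0)[/andP[_ wr] _]|w w0 /(small w w0)[wr wK]|g gh gE] :=
  @hol_removable_bounded _ be 0 rho (M ^+ ff) rho0.
- apply: hol_div; [exact/holX/arc_hol|exact/holX/hol_id|by rewrite expf_neq0].
- have [ta tak] := exists_root (w ^+ k) ff0.
  have [/andP[t0 tr] pt _] := arc_small wr wK.
  rewrite -(beE _ _ tak) lerXn2r ?nnegrE ?cabs_ge0 //; first by have := M1; lra.
  apply: scaled_bound => //; first by rewrite t0 ltW.
  by apply: le_trans (ltW pt) _; rewrite ler_piMl ?cabs_ge0.
exists g, rho => //; split; first by apply: gh; rewrite subrr cabs0.
move=> w ta /andP[w0 wr] tak; rewrite (beE _ _ tak) gE //.
by rewrite -cabs_gt0.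
Qed.

(** No rescaled coefficient oscillates: it tends to 0 or stays away from 0, according to the limit
    [B i] of its power. The minimum with 1 lets the lower bound be checked on powers of exponent
    [ff]. *)
Lemma arc_scaled_small : exists B : nat -> C,
  (forall i, (i < d)%N -> forall x : R, 0 < x -> exists2 rho : R, 0 < rho &
    forall w ta, 0 < cabs w < rho -> ta ^+ ff = w ^+ k ->
    let b := cabs (a i (w ^+ k) (pw w) / (ta ^+ ee) ^+ (d - i)) in
    if B i == 0 then b < x else Num.min 1 (cabs (B i) / 2) <= b).
Proof.
have hg i : exists g : C -> C, (i < d)%N -> exists2 rho : R, 0 < rho &
  hol g 0 /\ forall w ta, 0 < cabs w < rho -> ta ^+ ff = w ^+ k ->
    cabs (a i (w ^+ k) (pw w) / (ta ^+ ee) ^+ (d - i)) ^+ ff = cabs (g w).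
  have [id|] := boolP (i < d)%N; last by exists (fun=> 0).
  by have [g gP] := arc_power_limit id; exists g.
have [g {}hg] := choice hg.
exists (fun i => g i 0) => i id x x0.
have [rho rho0 [gh gE]] := hg i id.
have [Bi0|Bi0] := eqVneq (g i 0) 0.
  have xf0 : 0 < x ^+ ff by rewrite exprn_gt0.
  have [del del0 hdel] := hol_ccont gh xf0.
  exists (Num.min rho del); first by rewrite lt_min rho0.
  move=> w ta; rewrite lt_min => /andP[w0 /andP[wr wd]] tak /=.
  rewrite -(@ltr_pXn2r _ ff) ?nnegrE ?cabs_ge0 ?(ltW x0) // gE ?w0 //.
  by have := hdel w; rewrite Bi0 !subr0; exact.
have B20 : 0 < cabs (g i 0) / 2 by rewrite divr_gt0 // cabs_gt0.
have [del del0 hdel] := hol_ccont gh B20.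
exists (Num.min rho del); first by rewrite lt_min rho0.
move=> w ta; rewrite lt_min => /andP[w0 /andP[wr wd]] tak /=.
set m := Num.min 1 _.
have m0 : 0 < m by rewrite lt_min ltr01.
have m1 : m <= 1 by rewrite ge_min lexx.
have mB : m <= cabs (g i 0) / 2 by rewrite ge_min lexx orbT.
rewrite -(@ler_pXn2r _ ff) ?nnegrE ?cabs_ge0 ?(ltW m0) // gE ?w0 //.
apply: (@le_trans _ _ m).
  by rewrite -[leRHS]expr1; apply: ler_wiXn2l => //; exact: ltW.
have := hdel w; rewrite subr0 => /(_ wd).
by have := cabs_le_add (g i 0) (g i w); rewrite cabs_subC; lra.
Qed.

(** Let [e0] be the least index whose rescaled coefficient does not tend to 0; it exists by
    [arc_lower]. If [e0] is positive, the term of index [e0] dominates on the circle of radius [rh],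
    so no root crosses it and [ns] puts all roots on one side. All inside would make the coefficient
    [e0] small; all outside would keep the constant coefficient, the product of the roots up to
    sign, away from 0. *)
Lemma a0_lower i0 : (i0 < d)%N -> ee = e i0 -> ff = (d - i0)%N -> exists c1 rho : R,
  [/\ 0 < c1, 0 < rho & forall w ta, 0 < cabs w < rho -> ta ^+ ff = w ^+ k ->
   c1 <= cabs (a 0 (w ^+ k) (pw w) / (ta ^+ ee) ^+ d)].
Proof.
move=> i0d eeE ffE; have d0 : (0 < d)%N by exact: leq_ltn_trans i0d.
have [c0 [rho0 [c00 rho00 hc0]]] := arc_lower i0d eeE ffE.
have [B hB] := arc_scaled_small.
have exB : exists i, (i < d)%N && (B i != 0).
  apply: contrapT => nex.
  have B0 i : (i < d)%N -> B i = 0.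
    by move=> id; apply/eqP; apply: contrapT => Bi; apply: nex; exists i; rewrite id; exact/negP.
  have [i id|del del0 hdel] := @ball_all R d (fun i w => w != 0 -> forall ta, ta ^+ ff = w ^+ k ->
    cabs (a i (w ^+ k) (pw w) / (ta ^+ ee) ^+ (d - i)) < c0) 0.
    have [rho rho_gt0 h] := hB i id c0 c00; exists rho => // w; rewrite subr0 => wr w0 ta tak.
    by have := h w ta; rewrite B0 // eqxx cabs_gt0 w0 wr; apply.
  have [|w w0] := @exists_small (Num.min del rho0); first by rewrite lt_min del0.
  rewrite lt_min => /andP[wd wr]; have [ta tak] := exists_root (w ^+ k) ff0.
  have [||i id] := hc0 w ta; [by rewrite w0|by []|].
  have := hdel w; rewrite subr0 => /(_ wd i id); rewrite -cabs_gt0 => /(_ w0 ta tak); lra.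
have [e0 /andP[e0d Be0] e0min] := ex_minnP exB.
have B_lt i : (i < e0)%N -> B i = 0.
  move=> ie; have id := ltn_trans ie e0d.
  by apply/eqP; apply: contraTT ie => Bi; rewrite -leqNgt e0min // id.
pose c2 := Num.min 1 (cabs (B e0) / 2).
have c20 : 0 < c2 by rewrite lt_min ltr01 divr_gt0 // cabs_gt0.
have c21 : c2 <= 1 by rewrite ge_min lexx.
have [rho1 rho10 hc2] := hB e0 e0d 1 ltr01.
have {}hc2 w ta : 0 < cabs w < rho1 -> ta ^+ ff = w ^+ k ->
    c2 <= cabs (a e0 (w ^+ k) (pw w) / (ta ^+ ee) ^+ (d - e0)).
  by move=> w1 tak; have := hc2 w ta w1 tak; rewrite (negPf Be0).
case: (posnP e0) => [e00|e0_gt0].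
  by exists c2, rho1; split => // w ta w1 tak; have := hc2 w ta w1 tak; rewrite e00 subn0.
exfalso.
have M1' := M1; have M0 : 0 < M by lra.
(* [rh = c2 / D] serves twice: on the circle, the terms above [e0], the leading one included, take
   at most a quarter of [c2 * rh ^+ e0]; and roots of modulus at most [rh] force the coefficient
   [e0] below [c2]. *)
pose D : R := 4 * 2 ^+ d * (d%:R + 1) * M.
have d1 : 1 <= d%:R + 1 :> R by rewrite lerDr.
have p1 : 1 <= 2 ^+ d :> R by rewrite exprn_ege1 // ler1n.
have D0 : 0 < D by rewrite !mulr_gt0 ?exprn_gt0 //; lra.
pose rh := c2 / D.
have rh0 : 0 < rh by rewrite divr_gt0.
have rhD : rh * D = c2 by rewrite /rh divfK // gt_eqF.
have rhA : (d%:R + 1) * M * rh <= c2 / 4.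
  have : (d%:R + 1) * M * rh * 1 <= (d%:R + 1) * M * rh * 2 ^+ d.
    apply: ler_wpM2l p1; apply: mulr_ge0; last exact: ltW.
    by apply: mulr_ge0; [lra|exact: ltW].
  by move: rhD; rewrite /D; clra.
have rhB : 2 ^+ d * rh < c2.
  have : 2 ^+ d * rh * 1 <= 2 ^+ d * rh * ((d%:R + 1) * M).
    apply: ler_wpM2l; first by rewrite mulr_ge0 ?exprn_ge0 ?ltW.
    by rewrite -[leLHS]mulr1; apply: ler_pM; clra.
  by move: rhD; rewrite /D; clra.
have rh1 : rh <= 1.
  have : 1 * rh <= 2 ^+ d * rh by rewrite ler_wpM2r // ltW.
  clra.
(* The terms below [e0] get another quarter; the second bound contradicts a constant coefficient of
   modulus at least [rh ^+ d]. *)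
pose ze := Num.min (rh ^+ e0 * c2 / (4 * (d%:R + 1))) (rh ^+ d / 2).
have ze0 : 0 < ze.
  by rewrite lt_min !divr_gt0 ?mulr_gt0 ?exprn_gt0 //; lra.
have zeA : (d%:R + 1) * ze <= rh ^+ e0 * c2 / 4.
  have : ze <= rh ^+ e0 * c2 / (4 * (d%:R + 1)) by rewrite ge_min lexx.
  rewrite ler_pdivlMr; last by rewrite mulr_gt0 //; lra.
  by clra.
have zeB : ze < rh ^+ d.
  have h1 : ze <= rh ^+ d / 2 by rewrite ge_min lexx orbT.
  have : 0 < rh ^+ d by rewrite exprn_gt0.
  by clra.
have [i id|rho2 rho20 hz] := @ball_all R e0 (fun i w => w != 0 -> forall ta, ta ^+ ff = w ^+ k ->
    cabs (a i (w ^+ k) (pw w) / (ta ^+ ee) ^+ (d - i)) < ze) 0.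
  have [rho rho_gt0 h] := hB i (ltn_trans id e0d) ze ze0; exists rho => // w; rewrite subr0 => wr w0 ta tak.
  by have := h w ta; rewrite B_lt // eqxx cabs_gt0 w0 wr; apply.
pose rho := Num.min (Num.min rho1 rho2) (Num.min r (eps / K)).
have rho_gt0 : 0 < rho by rewrite !lt_min rho10 rho20 r0 divr_gt0.
pose bb w ta i := a i (w ^+ k) (pw w) / (ta ^+ ee) ^+ (d - i).
have ta_n0 w (ta : C) : 0 < cabs w -> ta ^+ ff = w ^+ k -> ta ^+ ee != 0.
  move=> w0 tak; rewrite expf_neq0 //; apply: contraTneq w0 => ta0.
  move/esym/eqP: tak; rewrite ta0 expr0n (gtn_eqF ff0) expf_eq0 => /andP[_ /eqP ->].
  by rewrite cabs0 ltxx.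
have bM w ta i : 0 < cabs w < rho -> ta ^+ ff = w ^+ k -> (i < d)%N -> cabs (bb w ta i) <= M.
  rewrite !lt_min => /andP[w0 /andP[_ /andP[wr wK]]] tak id.
  have [||/andP[t0 tr] pt _] := @arc_small w; [by rewrite w0|by rewrite mulrC -ltr_pdivlMr|].
  apply: scaled_bound => //; first by rewrite t0 ltW.
  by apply: le_trans (ltW pt) _; rewrite ler_piMl ?cabs_ge0.
have no_circle w ta x : 0 < cabs w < rho -> ta ^+ ff = w ^+ k ->
    root (gpoly d (bb w ta)) x -> cabs x != rh.
  move=> wrho tak; have := wrho; rewrite !lt_min => /andP[w0 /andP[/andP[wr1 wr2] _]].
  rewrite rootE horner_gpoly => /eqP hx; apply/eqP => xrh.
  pose j0 := Ordinal e0d.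
  move: hx; rewrite (bigD1 j0) //= addrCA => /eqP; rewrite addr_eq0 => /eqP hx.
  have := hc2 w ta; rewrite w0 wr1 => /(_ isT tak) hb.
  have : c2 * rh ^+ e0 <= cabs (bb w ta e0 * x ^+ e0).
    by rewrite cabsM cabsX xrh ler_wpM2r // exprn_ge0 // ltW.
  rewrite hx cabsN => h1.
  have X0 : 0 <= M * rh ^+ e0.+1 by rewrite mulr_ge0 ?exprn_ge0 ?ltW.
  have h2 : cabs (\sum_(i < d | i != j0) bb w ta i * x ^+ i) <= d%:R * (ze + M * rh ^+ e0.+1).
    apply: le_trans (cabs_sum _ _ _) _.
    rewrite mulr_natl -[X in _ *+ X]card_ord -sumr_const big_mkcond /=.
    apply: ler_sum => i _; case: ifPn => [ine|_]; last by apply: addr_ge0 => //; exact: ltW.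
    rewrite cabsM cabsX xrh; have [ie|ei|ie] := ltngtP i e0.
    - have := hz w; rewrite subr0 => /(_ wr2 i ie); rewrite -cabs_gt0 => /(_ w0 ta tak) hbi.
      apply: le_trans (_ : ze <= _); last by rewrite lerDl.
      rewrite -[leRHS]mulr1; apply: ler_pM; [exact: cabs_ge0| |exact: ltW|].
        by apply: exprn_ge0; exact: ltW.
      by apply: exprn_ile1 => //; exact: ltW.
    - apply: (@le_trans _ _ (M * rh ^+ e0.+1)); last by rewrite lerDr ltW.
      apply: ler_pM; rewrite ?cabs_ge0 ?exprn_ge0 ?(ltW rh0) ?bM //.
      by apply: ler_wiXn2l => //; exact: ltW.
    - by rewrite -val_eqE /= ie eqxx in ine.
  have h3 : cabs (x ^+ d) <= M * rh ^+ e0.+1.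
    rewrite cabsX xrh -[leLHS]mul1r; apply: ler_pM; rewrite ?exprn_ge0 ?(ltW rh0) //.
    by apply: ler_wiXn2l => //; exact: ltW.
  have := cabsD (x ^+ d) (\sum_(i < d | i != j0) bb w ta i * x ^+ i).
  have E0 : 0 < rh ^+ e0 by rewrite exprn_gt0.
  have : (d%:R + 1) * M * rh * rh ^+ e0 <= c2 / 4 * rh ^+ e0 by rewrite ler_wpM2r // ltW.
  have : 0 < c2 * rh ^+ e0 by rewrite mulr_gt0.
  by move: h1 h2 h3 zeA ze0; rewrite exprS; lra.
(* For [z = ta ^+ ee * x] this says [cabs x < rh], raised to the power [ff] so that it involves [w]
   and not [ta]. *)
pose S w z := cabs (z ^+ ff - 0) < cabs ((rh ^+ ff)%:CC * w ^+ (k * ee)).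
have Sx w ta x : ta ^+ ff = w ^+ k -> 0 < cabs w -> let la := ta ^+ ee in
    (cabs ((la * x) ^+ ff - 0) < cabs ((rh ^+ ff)%:CC * w ^+ (k * ee))) = (cabs x < rh) /\
    ((cabs ((la * x) ^+ ff - 0) == cabs ((rh ^+ ff)%:CC * w ^+ (k * ee))) = (cabs x == rh)).
  move=> tak w0 la; rewrite subr0.
  have laE : la ^+ ff = w ^+ (k * ee).
    by rewrite /la -exprM mulnC exprM tak -exprM.
  have la0 : 0 < cabs (w ^+ (k * ee)) by rewrite cabsX exprn_gt0.
  rewrite exprMn laE !cabsM (mulrC (cabs _%:CC)) cabsR ger0_norm ?exprn_ge0 ?(ltW rh0) //.
  rewrite ltr_pM2l // (inj_eq (mulfI (lt0r_neq0 la0))) cabsX.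
  by rewrite ltr_pXn2r ?nnegrE ?cabs_ge0 ?(ltW rh0) // eqrXn2 ?cabs_ge0 ?(ltW rh0).
have := ns (S := S) rho_gt0; rewrite /S; case.
- move=> w0 z0 w0r z0r; have [ta tak] := exists_root (w0 ^+ k) ff0.
  have w00 : 0 < cabs w0 by case/andP: w0r.
  have la0 := ta_n0 w0 ta w00 tak.
  have [] := @locally_constant_lt ff (fun=> 0) (fun w => (rh ^+ ff)%:CC * w ^+ (k * ee)) w0 z0.
  + exact/hol_ccont/hol_cst.
  + by apply: hol_ccont; apply: holM; [exact: hol_cst|exact/holX/hol_id].
  + have [_] := Sx w0 ta (z0 / ta ^+ ee) tak w00; rewrite mulrC divfK // => ->.
    by apply: (no_circle w0 ta) => //; rewrite gpoly_scale_root // mulrC divfK.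
  + move=> del del0 h; exists del; [exact: del0|move=> w z w1 z1 _].
    by rewrite (h w z w1 z1); exact: iff_refl.
- move=> [x x0 hx].
  have [|w w0] := @exists_small (Num.min x rho); first by rewrite lt_min x0.
  rewrite lt_min => /andP[wx wr]; have [ta tak] := exists_root (w ^+ k) ff0.
  have la0 := ta_n0 w ta w0 tak.
  have [rs srs prs] := monicd_prod (monicd_gpoly d (bb w ta)).
  have rs_small y : y \in rs -> cabs y <= rh.
    move=> yrs; have yr : root (gpoly d (bb w ta)) y by rewrite prs root_prod_XsubC.
    have := hx w (ta ^+ ee * y); rewrite w0 wx => /(_ isT).
    rewrite -gpoly_scale_root // => /(_ yr); have [-> _] := Sx w ta y tak w0; exact: ltW.
  have := coef_prod_bound e0 (ltW rh0) rs_small; rewrite -prs coef_gpoly // srs.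
  have wr1 : cabs w < rho1 by apply: lt_le_trans wr _; rewrite !ge_min lexx.
  have h1 : c2 <= cabs (bb w ta e0) by apply: hc2 => //; rewrite w0.
  move=> h2.
  have : rh ^+ (d - e0) <= rh.
    by rewrite -[leRHS]expr1; apply: ler_wiXn2l => //; [exact: ltW|rewrite subn_gt0].
  move=> h3; have : 2 ^+ d * rh ^+ (d - e0) <= 2 ^+ d * rh by rewrite ler_wpM2l ?exprn_ge0.
  by clra.
- move=> [x x0 hx].
  have [|w w0] := @exists_small (Num.min x rho); first by rewrite lt_min x0.
  rewrite lt_min => /andP[wx wr]; have [ta tak] := exists_root (w ^+ k) ff0.
  have la0 := ta_n0 w ta w0 tak.
  have [rs srs prs] := monicd_prod (monicd_gpoly d (bb w ta)).
  have rs_big y : y \in rs -> rh <= cabs y.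
    move=> yrs; have yr : root (gpoly d (bb w ta)) y by rewrite prs root_prod_XsubC.
    have := hx w (ta ^+ ee * y); rewrite w0 wx => /(_ isT).
    rewrite -gpoly_scale_root // => /(_ yr); have [-> _] := Sx w ta y tak w0.
    by move=> /negP; rewrite -leNgt.
  have wr2 : cabs w < rho2 by apply: lt_le_trans wr _; rewrite !ge_min lexx !orbT.
  have := hz w; rewrite subr0 => /(_ wr2 0%N e0_gt0); rewrite -cabs_gt0 => /(_ w0 ta tak).
  rewrite -/(bb w ta 0%N) -(coef_gpoly (bb w ta) d0) prs coef0_prod_XsubC.
  rewrite cabsM cabsX cabsN cabs1 expr1n mul1r cabs_prod.
  suff : rh ^+ d <= \prod_(y <- rs) cabs y by clra.
  rewrite -srs; elim: rs rs_big {prs srs} => [|y rs IH] hrs; first by rewrite big_nil.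
  rewrite big_cons /= exprS; apply: ler_pM; rewrite ?exprn_ge0 ?(ltW rh0) //.
    by apply: hrs; exact: mem_head.
  by apply: IH => y' yr; apply: hrs; rewrite inE yr orbT.
Qed.

(** With [ee = ff] the rescaled coefficients are functions of [w], so the polynomial itself has a
    limit [P0] at 0, and not only the moduli of its coefficients. Roots near [c1] and roots near
    [c2] then contradict [ns]. *)
Lemma slope_one i0 : (i0 < d)%N -> ee = e i0 -> ff = (d - i0)%N -> ee = ff -> False.
Proof.
move=> i0d eeE ffE eeff; have d0 : (0 < d)%N by exact: leq_ltn_trans i0d.
have [c0 [rho0 [c00 rho00 hc0]]] := arc_lower i0d eeE ffE.
pose b w i := a i (w ^+ k) (pw w) / (w ^+ k) ^+ (d - i).
have bE w ta i : ta ^+ ff = w ^+ k -> a i (w ^+ k) (pw w) / (ta ^+ ee) ^+ (d - i) = b w i.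
  by move=> tak; rewrite eeff tak.
pose rho := Num.min r (eps / K).
have rho_gt0 : 0 < rho by rewrite lt_min r0 divr_gt0.
have small w : 0 < cabs w -> cabs w < rho -> 0 < cabs w < r /\ K * cabs w < eps.
  rewrite lt_min ltr_pdivlMr // => -> /andP[-> h]; split => //.
  by rewrite mulrC.
have bM w i : (i < d)%N -> 0 < cabs w -> cabs w < rho -> cabs (b w i) <= M.
  move=> id w0 wr; have [ta tak] := exists_root (w ^+ k) ff0.
  have [h1 h2] := small w w0 wr; have [/andP[t0 tr] pt _] := arc_small h1 h2.
  rewrite -(bE w ta) //; apply: scaled_bound => //; first by rewrite t0 ltW.
  by apply: le_trans (ltW pt) _; rewrite ler_piMl ?cabs_ge0.
have hg i : exists g : C -> C, (i < d)%N -> ccont g 0 /\ forall w, w != 0 -> g w = b w i.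
  have [id|] := boolP (i < d)%N; last by exists (fun=> 0).
  have [w w0|w w0|g gh gE] := @hol_removable_bounded _ (fun w => b w i) 0 rho M rho_gt0.
  - rewrite subr0 => wr; rewrite -cabs_gt0 in w0; have [/andP[_ h1] _] := small w w0 wr.
    apply: hol_div; [exact: arc_hol|exact/holX/holX/hol_id|].
    by rewrite !expf_neq0 // -cabs_gt0.
  - by rewrite subr0 => wr; apply: bM => //; rewrite cabs_gt0.
  by exists g; split => //; apply/hol_ccont/gh; rewrite subrr cabs0.
have [g {}hg] := choice hg.
pose B i := g i 0.
pose P0 := gpoly d B.
have near_B (x : R) : 0 < x -> exists2 del : R, 0 < del & forall w, 0 < cabs w < del ->
    forall i, (i < d)%N -> cabs (b w i - B i) < x.
  move=> x0; have [i id|del del0 hdel] := @ball_all R d (fun i w => w != 0 -> cabs (b w i - B i) < x) 0.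
    have [gc gE] := hg i id; have [del del0 hdel] := gc x x0.
    by exists del => // w wd w0; rewrite -gE //; exact: hdel.
  by exists del => // w /andP[w0 wd] i id; apply: hdel => //; rewrite ?subr0 // -cabs_gt0.
have BM i : (i < d)%N -> cabs (B i) <= M + 1.
  move=> id; have [del del0 hdel] := near_B 1 ltr01.
  have [|w w0] := @exists_small (Num.min del rho); first by rewrite lt_min del0.
  rewrite lt_min => /andP[wd wr].
  have := hdel w _ i id; rewrite w0 wd => /(_ isT) h.
  by have := cabs_le_add (B i) (b w i); rewrite cabs_subC; have := bM w i id w0 wr; lra.
have M1' := M1; have M0 : 0 <= M + 1 by lra.
have [rs srs prs] := monicd_prod (monicd_gpoly d B).
(* The roots of [P0] have sum 0, so a single root of multiplicity [d] would be 0 and [P0] would be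
   ['X^d], against [arc_lower]. *)
have [c1 [c2 [c1r c2r c12]]] : exists c1 c2 : C, [/\ c1 \in rs, c2 \in rs & c1 != c2].
  apply: contrapT => nex.
  have all_eq x y : x \in rs -> y \in rs -> x = y.
    move=> xr yr; apply/eqP; apply: contrapT => /negP xy.
    by apply: nex; exists x, y.
  have [x xr] : exists x, x \in rs.
    by case: rs srs {prs nex all_eq} => [|x rs] srs; [rewrite -srs in d0|exists x; exact: mem_head].
  have rsE : rs = nseq d x.
    by rewrite -srs; apply/all_pred1P/allP => y yr /=; apply/eqP; exact: all_eq.
  have B_sub : B d.-1 = 0.
    have dd : (d.-1 < d)%N by rewrite prednK.
    have [gc gE] := hg _ dd; apply: cabs_small0 => x' x'0.
    have [del del0 hdel] := near_B x' x'0.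
    have [w w0 wd] := exists_small del0.
    have := hdel w _ _ dd; rewrite w0 wd => /(_ isT).
    by rewrite /b a_sub mul0r sub0r cabsN => /ltW.
  have x0 : x = 0.
    have := @coefPn_prod_XsubC _ rs; rewrite -prs srs => /(_ (lt0n_neq0 d0)).
    rewrite coef_gpoly ?prednK // B_sub rsE big_nseq iter_addr_0 => /esym/eqP.
    rewrite oppr_eq0 -mulr_natl mulf_eq0 pnatr_eq0 (negPf (lt0n_neq0 d0)) => /eqP //.
  have P0X : P0 = 'X^d.
    by rewrite /P0 prs rsE big_nseq iter_mulr_1 x0 subr0.
  have B0 i : (i < d)%N -> B i = 0.
    by move=> id; rewrite -(coef_gpoly B id) -/P0 P0X coefXn ltn_eqF.
  have [del del0 hdel] := near_B c0 c00.
  have [|w w0] := @exists_small (Num.min del rho0); first by rewrite lt_min del0.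
  rewrite lt_min => /andP[wd wr]; have [ta tak] := exists_root (w ^+ k) ff0.
  have [||i id] := hc0 w ta; [by rewrite w0|by []|]; rewrite bE // => h.
  by have := hdel w _ i id; rewrite w0 wd B0 // subr0 => /(_ isT); clra.
have [sg sg0 hsg] := seq_separation rs.
have sg100 : 0 < sg / 10 by rewrite divr_gt0.
have sg12 := hsg c1 c2 c1r c2r c12.
have [x1 x10 hx1] := close_roots d M0 sg100.
have [del del0 hdel] := near_B x1 x10.
pose rh := Num.min rho del.
have rh0 : 0 < rh by rewrite lt_min rho_gt0.
have fwd w c' : 0 < cabs w < rh -> c' \in rs -> exists2 x, root (gpoly d (b w)) x & cabs (c' - x) < sg / 10.
  rewrite lt_min => /andP[w0 /andP[wr wd]] c'r.
  apply: (hx1 P0 (gpoly d (b w))); [exact: monicd_gpoly|exact: monicd_gpoly| | |].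
  - by move=> i id; rewrite coef_gpoly //; exact: BM.
  - by move=> i id; rewrite !coef_gpoly //; apply/ltW/hdel; rewrite ?w0.
  - by rewrite /P0 prs root_prod_XsubC.
have bwd w x : 0 < cabs w < rh -> root (gpoly d (b w)) x -> exists2 y, y \in rs & cabs (x - y) < sg / 10.
  rewrite lt_min => /andP[w0 /andP[wr wd]] xr.
  have [||||y yr yx] := hx1 (gpoly d (b w)) P0 _ _ _ _ x xr; [exact: monicd_gpoly|exact: monicd_gpoly| | |].
  - by move=> i id; rewrite coef_gpoly //; have := bM w i id w0 wr; clra.
  - by move=> i id; rewrite !coef_gpoly // cabs_subC; apply/ltW/hdel; rewrite ?w0.
  - by exists y => //; move: yr; rewrite /P0 prs root_prod_XsubC.
have wkn0 w : 0 < cabs w -> w ^+ k != 0 by rewrite cabs_gt0 => ?; rewrite expf_neq0.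
have scale w x : 0 < cabs w -> root (gpoly d (b w)) x = root (gpoly d (fun i => a i (w ^+ k) (pw w))) (w ^+ k * x).
  by move=> /wkn0 w0; rewrite -gpoly_scale_root.
(* A rescaled root is within [sg / 10] of [c1] or at least [9 * sg / 10] away from it, so none lies
   on the circle of radius [sg / 3]. *)
pose u := sg / 3.
have u0 : 0 < u by rewrite divr_gt0.
pose S w z := cabs (z ^+ 1 - c1 * w ^+ k) < cabs (u%:CC * w ^+ k).
have Sx w x : 0 < cabs w ->
    (cabs ((w ^+ k * x) ^+ 1 - c1 * w ^+ k) < cabs (u%:CC * w ^+ k)) = (cabs (x - c1) < u) /\
    (cabs ((w ^+ k * x) ^+ 1 - c1 * w ^+ k) == cabs (u%:CC * w ^+ k)) = (cabs (x - c1) == u).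
  move=> w0; have wk0 : 0 < cabs (w ^+ k) by rewrite cabsX exprn_gt0.
  have -> : (w ^+ k * x) ^+ 1 - c1 * w ^+ k = (x - c1) * w ^+ k by rewrite expr1; ring.
  rewrite !cabsM cabsR (gtr0_norm u0) ltr_pM2r //.
  by rewrite (inj_eq (mulIf (lt0r_neq0 wk0))).
have := ns (S := S) rh0; rewrite /S; case.
- move=> w0 z0 w0r z0r; have w00 : 0 < cabs w0 by case/andP: w0r.
  have [] := @locally_constant_lt 1 (fun w => c1 * w ^+ k) (fun w => u%:CC * w ^+ k) w0 z0.
  + by apply: hol_ccont; apply: holM; [exact: hol_cst|exact/holX/hol_id].
  + by apply: hol_ccont; apply: holM; [exact: hol_cst|exact/holX/hol_id].
  + have [_] := Sx w0 (z0 / w0 ^+ k) w00; rewrite mulrC divfK ?wkn0 // => ->.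
    have [|y yr yx] := bwd w0 (z0 / w0 ^+ k) w0r.
      by rewrite scale // mulrC divfK ?wkn0.
    have [y1|yc1] := eqVneq y c1; first by rewrite -y1 lt_eqF // /u; lra.
    rewrite gt_eqF //.
    have := hsg y c1 yr c1r yc1; have := cabs_triangle (z0 / w0 ^+ k) y c1.
    by rewrite (cabs_subC y (z0 / w0 ^+ k)) /u; lra.
  + move=> x x0 h; exists x; [exact: x0|move=> w z w1 z1 _].
    by rewrite (h w z w1 z1); exact: iff_refl.
- move=> [x x0 hx].
  have [|w w0] := @exists_small (Num.min x rh); first by rewrite lt_min x0.
  rewrite lt_min => /andP[wx wr].
  have [|y yr yc] := fwd w c2 _ c2r; first by rewrite w0.
  have := hx w (w ^+ k * y); rewrite w0 wx -scale // => /(_ isT yr).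
  have [-> _] := Sx w y w0.
  by have := cabs_triangle y c1 c2; rewrite (cabs_subC c1 y) (cabs_subC y c2) /u; lra.
- move=> [x x0 hx].
  have [|w w0] := @exists_small (Num.min x rh); first by rewrite lt_min x0.
  rewrite lt_min => /andP[wx wr].
  have [|y yr yc] := fwd w c1 _ c1r; first by rewrite w0.
  have := hx w (w ^+ k * y); rewrite w0 wx -scale // => /(_ isT yr).
  have [-> _] := Sx w y w0; rewrite cabs_subC => /negP; rewrite -leNgt /u; clra.
Qed.

End Slope.

(** Consider the Newton polygon of the points [(i, e i)]. Either all of them lie above the line of
    slope -1 through [(d, 0)], or the least slope is attained at [i = 0] by [a0_lower] and is below
    1 by [slope_one]; the points with [i > 0] then lie above the line of slope -1 through
    [(0, e 0)]. *)
Theorem slope_dichotomy : (forall i, (i < d)%N -> (d < e i + i)%N) \/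
  ((0 < e 0 < d)%N /\ forall i, (0 < i < d)%N -> (e 0 < e i + i)%N).
Proof.
have [|nA] := pselect (forall i, (i < d)%N -> (d < e i + i)%N); [by left|right].
have [i1 i1d ei1] : exists2 i, (i < d)%N & (e i + i <= d)%N.
  apply: contrapT => nex; apply: nA => i id; rewrite ltnNge; apply/negP => h.
  by apply: nex; exists i.
pose q (i : 'I_d) : rat := (e i)%:R / (d - i)%:R.
(* [i0] attains the least slope [e i / (d - i)], which is at most 1 because of [i1]. *)
have [i0 _ hi0] := @Order.TotalTheory.arg_minP _ _ _ (Ordinal i1d) xpredT q isT.
have dpos (i : 'I_d) : 0 < (d - i)%:R :> rat by rewrite ltr0n subn_gt0.
have ff0 : (0 < d - i0)%N by rewrite subn_gt0.
have slope i : (i < d)%N -> (e i0 * (d - i) <= e i * (d - i0))%N.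
  move=> id; have := hi0 (Ordinal id) isT.
  rewrite /q /= ler_pdivrMr // mulrAC ler_pdivlMr ?(dpos (Ordinal id)) //.
  by rewrite -!natrM ler_nat.
have ee_ff : (e i0 <= d - i0)%N.
  have := slope i1 i1d; have h : (e i1 <= d - i1)%N by rewrite leq_subRL 1?addnC // ltnW.
  have : (e i1 * (d - i0) <= (d - i1) * (d - i0))%N by rewrite leq_mul2r h orbT.
  have : (0 < d - i1)%N by rewrite subn_gt0.
  by move=> h1 h2 h3; rewrite -(leq_pmul2r h1) mulnC in h3 *; nia.
have i0d := ltn_ord i0.
have d0 : (0 < d)%N by exact: leq_ltn_trans i0d.
have [c1 [rho [c10 rho0 hc]]] := a0_lower ff0 ee_ff slope i0d erefl erefl.
have M1' := M1; have M0 : 0 < M by lra.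
(* If [e 0 / d] exceeded the least slope, [a 0] would decay faster along the arc than [a0_lower]
   allows. *)
have le1 : (e 0 * (d - i0) <= e i0 * d)%N.
  rewrite leqNgt; apply/negP => hlt.
  pose x := Num.min (Num.min rho r) (Num.min (eps / K) (c1 ^+ (d - i0) / M ^+ (d - i0))).
  have x0 : 0 < x by rewrite !lt_min rho0 r0 !divr_gt0 // ?exprn_gt0.
  have [w w0] := exists_small x0; rewrite !lt_min => /andP[/andP[wrho wr] /andP[wK wc]].
  have [ta tak] := exists_root (w ^+ k) ff0.
  have := hc w ta; rewrite w0 wrho => /(_ isT tak).
  have [||/andP[t0 tr] pt wn0] := @arc_small w; [by rewrite w0|by rewrite mulrC -ltr_pdivlMr|].
  have pt1 : cabs (pw w) <= cabs (w ^+ k) by apply: le_trans (ltW pt) _; rewrite ler_piMl ?cabs_ge0.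
  have := ab d0 (ltW tr) (le_trans pt1 (ltW tr)); rewrite cmax_cone //.
  set A := a 0 _ _ => h2 h1.
  have taE : ((ta ^+ e i0) ^+ d) ^+ (d - i0) = (w ^+ k) ^+ (e i0 * d).
    by rewrite -tak -!exprM; congr (ta ^+ _); ring.
  have tan0 : (ta ^+ e i0) ^+ d != 0.
    move: (expf_neq0 (e i0 * d) (expf_neq0 k wn0)); rewrite -taE.
    by apply: contra_neq => ->; rewrite expr0n (gtn_eqF ff0).
  rewrite cabsM cabsV ler_pdivlMr ?cabs_gt0 // in h1.
  have {}h1 := le_trans h1 h2.
  have : (c1 * cabs ((ta ^+ e i0) ^+ d)) ^+ (d - i0) <= (M * cabs (w ^+ k) ^+ e 0) ^+ (d - i0).
    by apply: lerXn2r h1; rewrite nnegrE mulr_ge0 ?exprn_ge0 ?cabs_ge0 // ltW.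
  rewrite !exprMn -[cabs _ ^+ (d - i0)]cabsX taE cabsX -exprM.
  set y := cabs (w ^+ k) in t0 tr *; set n1 := (e i0 * d)%N in hlt *.
  have y1 : y <= 1 by apply: le_trans (ltW tr) _.
  have yw : y <= cabs w.
    rewrite /y cabsX -[leRHS]expr1; apply: ler_wiXn2l => //; first exact: ltW.
    by apply: le_trans (ltW wr) _.
  have : y ^+ (e 0 * (d - i0)) <= y ^+ n1 * cabs w.
    apply: (@le_trans _ _ (y ^+ n1.+1)); first by apply: ler_wiXn2l => //; exact: ltW.
    by rewrite exprSr ler_wpM2l // exprn_ge0 // ltW.
  have yn : 0 < y ^+ n1 by rewrite exprn_gt0.
  have Mf : 0 < M ^+ (d - i0) by rewrite exprn_gt0.
  rewrite ltr_pdivlMr // in wc.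
  move=> h3 h4.
  have : M ^+ (d - i0) * y ^+ (e 0 * (d - i0)) <= M ^+ (d - i0) * (y ^+ n1 * cabs w).
    by rewrite ler_wpM2l // ltW.
  have : cabs w * M ^+ (d - i0) * y ^+ n1 < c1 ^+ (d - i0) * y ^+ n1 by rewrite ltr_pM2r.
  clra.
have e0E : (e 0 * (d - i0) = e i0 * d)%N.
  by apply/eqP; rewrite eqn_leq le1 /=; have := slope 0%N d0; rewrite subn0.
have lt_ff : (e i0 < d - i0)%N.
  rewrite ltn_neqAle ee_ff andbT; apply/eqP => E.
  exact: (slope_one ff0 ee_ff slope i0d erefl erefl E).
split.
  by rewrite e_gt0 //=; rewrite -(ltn_pmul2r ff0) e0E [ltnRHS]mulnC ltn_pmul2r.
move=> i /andP[i0' id]; have := slope i id.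
rewrite -(ltn_pmul2r ff0) => h.
have h2 : (e i0 * i < (d - i0) * i)%N by rewrite ltn_pmul2r.
have h3 : (e i0 * (d - i) + e i0 * i = e i0 * d)%N by rewrite -mulnDr subnK // ltnW.
by rewrite e0E mulnDl -h3 -addnS leq_add // [(i * _)%N]mulnC.
Qed.

End Core.

(** * Irreducible arc-sections *)

Lemma coef2M (A : nzRingType) (P Q : {poly {poly A}}) i j :
  (P * Q)`_i`_j = \sum_(b < i.+1) (P`_b * Q`_(i - b))`_j.
Proof. by rewrite coefM coef_sum. Qed.

Section Descent.
Context {R : realType}.
Local Notation C := (Cplx R).

Section CoefficientClass.
Variables (T : Type) (K : (T -> C) -> Prop).
Hypotheses (Kcst : forall x, K (fun=> x))
  (KD : forall f g, K f -> K g -> K (fun t => f t + g t))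
  (KM : forall f g, K f -> K g -> K (fun t => f t * g t))
  (Kext : forall f g, (forall t, f t = g t) -> K f -> K g).

(** The class [K] stands for holomorphy at a point, continuity at a point, or holomorphic germs; the
    closure properties of coefficients are proved once for all three. *)
Lemma class_sum n (F : nat -> T -> C) : (forall i, K (F i)) -> K (fun t => \sum_(i < n) F i t).
Proof.
move=> hF; elim: n => [|n IH]; first by apply: Kext (Kcst 0) => t; rewrite big_ord0.
by apply: Kext (KD IH (hF n)) => t; rewrite big_ord_recr.
Qed.

Definition coefs_in (P : T -> {poly C}) := forall i, K (fun t => (P t)`_i).

Lemma coefs_inM P Q : coefs_in P -> coefs_in Q -> coefs_in (fun t => P t * Q t).
Proof.
move=> hP hQ i; apply: Kext (@class_sum i.+1 (fun j t => (P t)`_j * (Q t)`_(i - j)) _) => [t|j].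
  by rewrite coefM.
exact: KM.
Qed.

Lemma coefs_in_prod (I : Type) (s : seq I) (P : I -> T -> {poly C}) :
  (forall m, coefs_in (P m)) -> coefs_in (fun t => \prod_(m <- s) P m t).
Proof.
move=> hP; elim: s => [|m s IH] i.
  by apply: Kext (Kcst (1%:P : {poly C})`_i) => t; rewrite big_nil.
by apply: Kext (coefs_inM (hP m) IH i) => t; rewrite big_cons.
Qed.

Definition coefs2_in (Q : T -> {poly {poly C}}) := forall i j, K (fun t => (Q t)`_i`_j).

Lemma coefs2_in_prod (I : Type) (s : seq I) (Q : I -> T -> {poly {poly C}}) :
  (forall m, coefs2_in (Q m)) -> coefs2_in (fun t => \prod_(m <- s) Q m t).
Proof.
move=> hQ; elim: s => [|m s IH] i j.
  by apply: Kext (Kcst (1%:P : {poly {poly C}})`_i`_j) => t; rewrite big_nil.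
apply: Kext (@class_sum i.+1 (fun b t => ((Q m t)`_b * (\prod_(l <- s) Q l t)`_(i - b))`_j) _) => [t|b].
  rewrite big_cons; set U := \prod_(l <- s) Q l t.
  by rewrite coef2M.
exact: (@coefs_inM (fun t => (Q m t)`_b) (fun t => (\prod_(l <- s) Q l t)`_(i - b)) (hQ m b) (IH (i - b)%N)).
Qed.

End CoefficientClass.

Lemma coefs_hol_prod (I : Type) (s : seq I) (P : I -> C -> {poly C}) t0 :
  (forall m i, hol (fun t => (P m t)`_i) t0) ->
  forall i, hol (fun t => (\prod_(m <- s) P m t)`_i) t0.
Proof.
apply: (@coefs_in_prod _ (fun f => hol f t0)).
- by move=> x; exact: hol_cst.
- by move=> f g; exact: holD.
- by move=> f g; exact: holM.
- by move=> f g; exact: hol_ext.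
Qed.

Lemma coefs2_hol_prod (I : Type) (s : seq I) (Q : I -> C -> {poly {poly C}}) t0 :
  (forall m i j, hol (fun t => (Q m t)`_i`_j) t0) ->
  forall i j, hol (fun t => (\prod_(m <- s) Q m t)`_i`_j) t0.
Proof.
apply: (@coefs2_in_prod _ (fun f => hol f t0)).
- by move=> x; exact: hol_cst.
- by move=> f g; exact: holD.
- by move=> f g; exact: holM.
- by move=> f g; exact: hol_ext.
Qed.

Lemma ccontD (f g : C -> C) z : ccont f z -> ccont g z -> ccont (fun x => f x + g x) z.
Proof.
move=> fc gc e e0; have e20 : 0 < e / 2 by rewrite divr_gt0.
have [d1 d10 h1] := fc _ e20; have [d2 d20 h2] := gc _ e20.
exists (Num.min d1 d2); first by rewrite lt_min d10.
move=> x; rewrite lt_min opprD addrACA => /andP[/h1 x1 /h2 x2].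
by apply: le_lt_trans (cabsD _ _) _; lra.
Qed.

Lemma coefs2_ccont_prod (I : Type) (s : seq I) (Q : I -> C -> {poly {poly C}}) t0 :
  (forall m i j, ccont (fun t => (Q m t)`_i`_j) t0) ->
  forall i j, ccont (fun t => (\prod_(m <- s) Q m t)`_i`_j) t0.
Proof.
apply: (@coefs2_in_prod _ (fun f => ccont f t0)).
- by move=> x e e0; exists 1 => // y _; rewrite subrr cabs0.
- by move=> f g; exact: ccontD.
- by move=> f g; exact: ccontM.
- by move=> f g fg; apply: ccont_eq; exists 1 => // x _; exact: fg.
Qed.

(** Listed with multiplicity, so that for [k > 0] there are always [k] of them, at [t = 0] too. *)
Definition kroots k (t : C) : seq C := sval (closed_field_poly_normal ('X^k - t%:P)).

Lemma kroots_prod k t : (0 < k)%N -> 'X^k - t%:P = \prod_(w <- kroots k t) ('X - w%:P).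
Proof.
move=> k0; rewrite /kroots; case: closed_field_poly_normal => rs /=.
by have [/monicP -> _] := monicd_XnsubC t k0; rewrite scale1r.
Qed.

Lemma size_kroots k t : (0 < k)%N -> size (kroots k t) = k.
Proof.
move=> k0; have /(congr1 (fun p : {poly C} => size p)) := kroots_prod t k0.
by rewrite size_XnsubC // size_prod_XsubC => -[].
Qed.

Lemma mem_kroots k t w : (0 < k)%N -> (w \in kroots k t) = (w ^+ k == t).
Proof.
by move=> k0; rewrite -root_prod_XsubC -kroots_prod // rootE !hornerE subr_eq0.
Qed.

Lemma cabs_kroots k t w : (0 < k)%N -> w \in kroots k t -> cabs w ^+ k = cabs t.
Proof. by move=> k0; rewrite mem_kroots // => /eqP <-; rewrite cabsX. Qed.

(* Away from 0 the k-th roots of t are locally holomorphic; the singularity at 0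
   is removable. *)
Lemma coefs2_hol_kroots k (q : C -> {poly {poly C}}) (rho : R) : (0 < k)%N -> 0 < rho -> rho <= 1 ->
  (forall i j w, cabs w < rho -> hol (fun w => (q w)`_i`_j) w) ->
  forall i j t, cabs t < rho ^+ k -> hol (fun t => (\prod_(w <- kroots k t) q w)`_i`_j) t.
Proof.
move=> k0 rho0 rho1 hq i j t.
have small s w : cabs s < rho ^+ k -> w ^+ k = s -> cabs w < rho.
  by move=> sr ws; rewrite -(@ltr_pXn2r _ k) ?nnegrE ?cabs_ge0 ?(ltW rho0) // -cabsX ws.
have off0 s : s != 0 -> cabs s < rho ^+ k -> hol (fun t => (\prod_(w <- kroots k t) q w)`_i`_j) s.
  move=> s0 sr; have cs0 : 0 < cabs s by rewrite cabs_gt0.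
  have near_s z : cabs (z - s) < cabs s -> z != 0.
    by apply: contraTneq => ->; rewrite sub0r cabsN ltxx.
  have [z zs|z zs|z zs m mk|xi hxi] := @hol_roots _ k (fun z => 'X^k - z%:P) s (cabs s) cs0.
  - exact: monicd_XnsubC.
  - by apply: separable_XnsubC => //; exact: near_s.
  - apply: (@hol_ext _ (fun z => (m == k)%:R - (if m == 0%N then z else 0))).
      by move=> y; rewrite coefB coefXn coefC.
    by apply: holB; [exact: hol_cst|case: eqP => _; [exact: hol_id|exact: hol_cst]].
  have prodE z : cabs (z - s) < cabs s / 4 ->
      \prod_(w <- kroots k z) q w = \prod_(m < k) q (xi m z).
    move=> zs; have [Pz xiinj _] := hxi z zs.
    have pe : perm_eq (kroots k z) [seq xi m z | m <- enum 'I_k].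
      apply: uniq_perm.
      - rewrite -separable_prod_XsubC -kroots_prod //; apply: separable_XnsubC => //.
        by apply: near_s; lra.
      - by rewrite map_inj_uniq // enum_uniq.
      move=> w; rewrite -!root_prod_XsubC -kroots_prod // big_map big_enum.
      by rewrite Pz.
    by rewrite (perm_big _ pe) big_map big_enum.
  apply: (@hol_eq _ (fun t => (\prod_(m < k) q (xi m t))`_i`_j)).
    by exists (cabs s / 4) => [|z zs]; rewrite ?divr_gt0 // prodE.
  apply: coefs2_hol_prod => m i' j'.
  have ss : cabs (s - s) < cabs s / 4 by rewrite subrr cabs0 divr_gt0.
  have [Ps _ hh] := hxi s ss.
  apply: (@hol_comp _ (xi m) (fun w => (q w)`_i'`_j')); first exact: hh.
  apply: hq; apply: (small s) => //.
  have : root ('X^k - s%:P) (xi m s).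
    by rewrite Ps /root horner_prod (bigD1 m) //= hornerXsubC subrr mul0r.
  by rewrite rootE !hornerE subr_eq0 => /eqP.
move=> tr; have [->|t0] := eqVneq t 0; last exact: off0.
apply: hol_removable.
  by exists (rho ^+ k) => [|z z0]; rewrite ?exprn_gt0 // subr0; exact: off0.
apply: (@ccont_eq _ (fun t => (\prod_(m < k) q (nth 0 (kroots k t) m))`_i`_j)).
  by exists 1 => // z _; rewrite (big_nth 0) size_kroots // big_mkord.
have nth0 m : (m < k)%N -> nth 0 (kroots k 0) m = 0.
  move=> mk; have : nth 0 (kroots k 0) m \in kroots k 0 by rewrite mem_nth ?size_kroots.
  by rewrite mem_kroots // expf_eq0 => /andP[_ /eqP].
(* All k-th roots tend to 0 with [t], so continuity at 0 holds entry by entry, whatever the order of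
   the list. *)
apply: (@coefs2_ccont_prod _ _ (fun (m : 'I_k) t => q (nth 0 (kroots k t) m))) => m i' j' e e0.
have mk := ltn_ord m.
have [|d d0 hd] := hol_ccont (hq i' j' 0 _) e0; first by rewrite cabs0.
exists (d ^+ k); first by rewrite exprn_gt0.
move=> z; rewrite !subr0 nth0 // => zd; apply: hd; rewrite subr0.
rewrite -(@ltr_pXn2r _ k) ?nnegrE ?cabs_ge0 ?(ltW d0) //.
by rewrite (@cabs_kroots _ z) // mem_nth // size_kroots.
Qed.

End Descent.

(** Degree bounds that depend only on the number of factors let the norm be expanded, by
    [horner2_wide], into a sum over a fixed range of indices. *)
Lemma size2_prod (A : idomainType) (I : Type) (s : seq I) (q : I -> {poly {poly A}}) (n m : nat) :
  (forall w, (size (q w) <= n)%N /\ forall i, (size ((q w)`_i)%R <= m)%N) ->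
  (size (\prod_(w <- s) q w)%R <= size s * n + 1)%N /\
  forall i, (size ((\prod_(w <- s) q w)`_i)%R <= size s * m + 1)%N.
Proof.
move=> hq; elim: s => [|w s [IH1 IH2]].
  rewrite big_nil size_poly1; split => // i; rewrite coef1.
  by case: eqP; rewrite ?size_poly1 ?size_poly0.
have [q1 q2] := hq w; rewrite big_cons /=; split.
  apply: leq_trans (size_polyMleq _ _) (leq_trans (leq_pred _) _).
  by rewrite mulSn -addnA leq_add.
move=> i; rewrite coefM; apply: leq_trans (size_sum _ _ _) _.
apply/bigmax_leqP => j _; apply: leq_trans (size_polyMleq _ _) (leq_trans (leq_pred _) _).
by rewrite mulSn -addnA leq_add.
Qed.

Lemma horner2_wide (A : comNzRingType) (Q : {poly {poly A}}) (n m : nat) (z p : A) :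
  (size Q <= n)%N -> (forall i, (size (Q`_i)%R <= m)%N) ->
  Q.[z%:P].[p] = \sum_(i < n) (\sum_(j < m) Q`_i`_j * p ^+ j) * z ^+ i.
Proof.
move=> sQ si; rewrite (horner_coef_wide _ sQ) horner_sum; apply: eq_bigr => i _.
rewrite hornerM -rmorphXn hornerC; congr (_ * _).
by rewrite (horner_coef_wide _ (si i)).
Qed.

(** * Factors cut out by a locally constant condition on the roots *)

Section Separation.
Context {R : realType}.
Local Notation C := (Cplx R).

Lemma diff_sum (V : normedModType C) n (F : nat -> V -> C) x :
  (forall i, (i < n)%N -> differentiable (F i) x) -> differentiable (fun y => \sum_(i < n) F i y) x.
Proof.
elim: n => [|n IH] hF.
  rewrite (_ : (fun y => _) = cst 0); first exact: differentiable_cst.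
  by apply: funext => y; rewrite big_ord0.
rewrite (_ : (fun y => _) = (fun y => \sum_(i < n) F i y) + F n).
  by apply: differentiableD; [apply: IH => i id; apply: hF; exact: ltnW|exact: hF].
by apply: funext => y; rewrite big_ord_recr.
Qed.

Lemma near_small (V : normedModType C) (f : V -> C) (x0 : V) : {for x0, continuous f} -> f x0 = 0 ->
  forall del : R, 0 < del -> \forall x \near x0, cabs (f x) < del.
Proof.
move=> fc f0 del del0.
have := (@cvgrPdist_lt _ C _ _ (nbhs_filter x0) f (f x0)).1 fc (del%:C)%C.
rewrite ltcR => /(_ del0); apply: filterS => x.
by rewrite f0 sub0r normrN cabsE ltcR.
Qed.

Lemma hol_coef_XsubC (x : C -> C) w0 i : hol x w0 -> hol (fun w => ('X - (x w)%:P)`_i) w0.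
Proof.
move=> hx; apply: (@hol_ext _ (fun w => (i == 1%N)%:R - (if i == 0%N then x w else 0))).
  by move=> w; rewrite coefB coefX coefC.
by apply: holB; [exact: hol_cst|case: eqP => _; [exact: hx|exact: hol_cst]].
Qed.

Section Selection.
Variables (d : nat) (G : C -> {poly C}) (S : C -> C -> Prop) (rho : R).
Hypotheses (rho0 : 0 < rho)
  (Gm : forall w, monicd d (G w))
  (Gsep : forall w, 0 < cabs w < rho -> separable_poly (G w))
  (Gh : forall w, cabs w < rho -> forall i, (i < d)%N -> hol (fun w => (G w)`_i) w)
  (G0 : forall i, (i < d)%N -> (G 0)`_i = 0)
  (Sloc : forall w0 z0, 0 < cabs w0 < rho -> root (G w0) z0 ->
     exists2 e : R, 0 < e & forall w z, cabs (w - w0) < e -> cabs (z - z0) < e ->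
       root (G w) z -> (S w z <-> S w0 z0)).

Definition groots w : seq C := sval (closed_field_poly_normal (G w)).

Lemma groots_prod w : G w = \prod_(x <- groots w) ('X - x%:P).
Proof.
rewrite /groots; case: closed_field_poly_normal => rs /=.
by have [/monicP -> _] := Gm w; rewrite scale1r.
Qed.

Definition selpoly b w : {poly C} := \prod_(x <- groots w | `[< S w x >] == b) ('X - x%:P).

Lemma selpolyM w : G w = selpoly true w * selpoly false w.
Proof.
rewrite groots_prod (bigID (fun x => `[< S w x >] == true)) /=; congr (_ * _).
by apply: eq_bigl => x; case: `[< _ >].
Qed.

Lemma root_selpoly b w x : root (selpoly b w) x = (root (G w) x && (`[< S w x >] == b)).
Proof.
rewrite /selpoly -big_filter root_prod_XsubC mem_filter andbC groots_prod.
by rewrite root_prod_XsubC.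
Qed.

(** Near [w0] the roots are holomorphic functions of [w] and [S] is constant along each of them, so
    the same functions are selected for all [w]. *)
Lemma selpoly_local b w0 : 0 < cabs w0 < rho -> exists (s : seq 'I_d) (x : 'I_d -> C -> C) (e : R),
  [/\ 0 < e, forall m, hol (x m) w0 &
    forall w, cabs (w - w0) < e -> selpoly b w = \prod_(m <- s) ('X - (x m w)%:P)].
Proof.
move=> /andP[w00 w0r].
pose r := Num.min (cabs w0) (rho - cabs w0).
have r0 : 0 < r by rewrite lt_min w00 subr_gt0.
have in_r w : cabs (w - w0) < r -> 0 < cabs w < rho.
  rewrite lt_min => /andP[h1 h2]; apply/andP; split.
    by have := cabs_le_add w0 w; rewrite (cabs_subC w0); lra.
  by have := cabs_le_add w w0; lra.
have [w wr|w wr|w wr i id|x hx] := @hol_roots _ d G w0 r r0.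
- exact: Gm.
- exact/Gsep/in_r.
- by apply: Gh => //; case/andP: (in_r w wr).
have r40 : 0 < r / 4 by rewrite divr_gt0.
have ww : cabs (w0 - w0) < r / 4 by rewrite subrr cabs0.
have xroot w m : cabs (w - w0) < r / 4 -> root (G w) (x m w).
  by move=> /hx[-> _ _]; rewrite /root horner_prod (bigD1 m) //= hornerXsubC subrr mul0r.
have [_ _ xh] := hx w0 ww.
have [i id|e e0 he] := @ball_all R d (fun i w => forall m : 'I_d, nat_of_ord m = i ->
    cabs (w - w0) < r / 4 -> (S w (x m w) <-> S w0 (x m w0))) w0.
  have w0in : 0 < cabs w0 < rho by rewrite w00.
  pose m := Ordinal id.
  have [e e0 he] := Sloc w0in (xroot w0 m ww).
  have [e' e'0 he'] := hol_ccont (xh m) e0.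
  exists (Num.min e e'); first by rewrite lt_min e0.
  move=> w; rewrite lt_min => /andP[we we'] m' m'i wr.
  have -> : m' = m by exact: val_inj.
  by apply: he => //; [exact: he'|exact: xroot].
exists [seq m <- enum 'I_d | `[< S w0 (x m w0) >] == b], x, (Num.min e (r / 4)).
split; [by rewrite lt_min e0|exact: xh|].
move=> w; rewrite lt_min => /andP[we wr].
have wr' : cabs (w - w0) < r by lra.
have pe : perm_eq (groots w) [seq x m w | m <- enum 'I_d].
  have [Pw xinj _] := hx w wr.
  apply: uniq_perm.
  - by rewrite -separable_prod_XsubC -groots_prod; exact/Gsep/in_r.
  - by rewrite map_inj_uniq // enum_uniq.
  by move=> z; rewrite -!root_prod_XsubC -groots_prod big_map big_enum Pw.
rewrite /selpoly (perm_big _ pe) big_map big_filter; apply: eq_bigl => m.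
congr (_ == _); apply: asbool_equiv_eq; exact: (he w we m (ltn_ord m) m).
Qed.

Lemma selpoly_hol b i w0 : 0 < cabs w0 < rho -> hol (fun w => (selpoly b w)`_i) w0.
Proof.
move=> w0r; have [s [x [e [e0 xh he]]]] := selpoly_local b w0r.
apply: (@hol_eq _ (fun w => (\prod_(m <- s) ('X - (x m w)%:P))`_i)).
  by exists e => // w /he ->.
by apply: coefs_hol_prod => m j; apply: hol_coef_XsubC; exact: xh.
Qed.

Lemma size_selpoly b w : (size (selpoly b w) <= d.+1)%N.
Proof.
have [mG <-] := Gm w; rewrite selpolyM.
have h c : selpoly c w != 0 by rewrite monic_neq0 // monic_prod_XsubC.
by apply: dvdp_leq; [rewrite mulf_neq0|case: b; [exact: dvdp_mulr|exact: dvdp_mull]].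
Qed.

(** The size is locally constant, hence holomorphic and bounded on the punctured disk. Its extension
    is continuous at 0, which makes an integer constant nearby; this replaces connectedness. *)
Lemma selpoly_degree b : exists n (r : R), 0 < r /\
  forall w, 0 < cabs w < r -> size (selpoly b w) = n.+1.
Proof.
have [w w0|w w0|g gh gE] := @hol_removable_bounded _ (fun w => (size (selpoly b w))%:R) 0 rho d.+1%:R rho0.
- rewrite subr0 => wr; have w0r : 0 < cabs w < rho by rewrite cabs_gt0 w0.
  have [s [x [e [e0 xh he]]]] := selpoly_local b w0r.
  apply: (@hol_eq _ (fun=> (size s).+1%:R)); last exact: hol_cst.
  by exists e => // z /he ->; rewrite size_prod_XsubC.
- by move=> _; rewrite cabs_nat ler_nat size_selpoly.
have gc : ccont g 0 by apply/hol_ccont/gh; rewrite subrr cabs0.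
have h20 : 0 < 1 / 2 :> R by lra.
have [r r0 hr] := gc _ h20.
have [w1 w10 w1r] := exists_small r0.
exists (size (selpoly b w1)).-1, r; split => // w /andP[w0 wr].
rewrite prednK; last by rewrite size_poly_gt0 monic_neq0 // monic_prod_XsubC.
have := hr w; have := hr w1; rewrite !subr0 => /(_ w1r) h1 /(_ wr) h2.
rewrite gE -?cabs_gt0 // in h1; rewrite gE -?cabs_gt0 // in h2.
have : cabs ((size (selpoly b w))%:R - (size (selpoly b w1))%:R : C) < 1.
  have tri (x y : C) : cabs (x - g 0) < 1 / 2 -> cabs (y - g 0) < 1 / 2 -> cabs (x - y) < 1.
    by move=> hx hy; have := cabs_triangle (g 0) x y; rewrite (cabs_subC (g 0)); lra.
  exact: tri.
have key (m n : nat) : cabs (m%:R - n%:R : C) < 1 -> (m <= n)%N.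
  move=> h; rewrite leqNgt; apply/negP => nm.
  move: h; rewrite -natrB ?(ltnW nm) // cabs_nat ltrn1 => /eqP h.
  by move: nm h; clear; lia.
by move=> h; apply/eqP; rewrite eqn_leq !key // cabs_subC.
Qed.

Lemma small_roots (B : R) : 0 < B -> exists2 del : R, 0 < del &
  forall w x, cabs w < del -> root (G w) x -> cabs x < B.
Proof.
move=> B0; have [e e0 he] := close_roots d (@ler01 R) B0.
have e10 : 0 < Num.min e 1 by rewrite lt_min e0 ltr01.
have [i id|del del0 hdel] := @ball_all R d (fun i w => cabs (G w)`_i < Num.min e 1) 0.
  have c00 : cabs (0 : C) < rho by rewrite cabs0.
  have [del del0 hdel] := hol_ccont (Gh c00 id) e10.
  by exists del => // w /hdel; rewrite G0 // subr0.
exists del => // w x wd xr.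
have := hdel w; rewrite subr0 => /(_ wd) {}hdel.
have [||||y] := he (G w) 'X^d _ _ _ _ x xr.
- exact: Gm.
- by split; [exact: monicXn|exact: size_polyXn].
- by move=> i id; have := hdel i id; rewrite lt_min => /andP[_ /ltW].
- move=> i id; rewrite coefXn ltn_eqF // sub0r cabsN.
  by have := hdel i id; rewrite lt_min => /andP[/ltW].
by rewrite rootE hornerXn expf_eq0 => /andP[_ /eqP ->]; rewrite subr0.
Qed.

(** By [G0] all roots tend to 0, so the factor tends to ['X^n]; with this value at 0 the singularity
    is removable. *)
Lemma selpoly_extend b : exists n (F : C -> {poly C}) (r : R),
  [/\ 0 < r, r <= rho, F 0 = 'X^n,
      forall w, 0 < cabs w < r -> F w = selpoly b w /\ size (selpoly b w) = n.+1
    & forall i w, cabs w < r -> hol (fun w => (F w)`_i) w].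
Proof.
have [n [r1 [r10 hn]]] := selpoly_degree b.
pose F w := if w == 0 then 'X^n else selpoly b w.
pose r := Num.min r1 rho.
have Foff w : w != 0 -> F w = selpoly b w by rewrite /F => /negPf ->.
exists n, F, r; split.
- by rewrite lt_min r10.
- by rewrite ge_min lexx orbT.
- by rewrite /F eqxx.
- by move=> w; rewrite lt_min => /andP[w0 /andP[wr1 _]]; rewrite Foff -?cabs_gt0 // hn // w0.
have Fh i w : w != 0 -> cabs w < r -> hol (fun w => (F w)`_i) w.
  rewrite lt_min => w0 /andP[_ wr].
  apply: (@hol_eq _ (fun w => (selpoly b w)`_i)); last by apply: selpoly_hol; rewrite cabs_gt0 w0.
  exists (cabs w) => [|z zw]; first by rewrite cabs_gt0.
  by rewrite Foff //; apply: contraTneq zw => ->; rewrite sub0r cabsN ltxx.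
move=> i w wr; have [w0|w0] := eqVneq w 0; last exact: Fh.
rewrite w0; apply: hol_removable.
  exists r; first by rewrite lt_min r10.
  by move=> z z0; rewrite subr0; exact: Fh.
move=> e e0.
pose B := Num.min 1 (e / 2 ^+ n / 2).
have B0 : 0 < B by rewrite lt_min ltr01 !divr_gt0 // exprn_gt0.
have B1 : B <= 1 by rewrite ge_min lexx.
have Be : 2 ^+ n * B < e.
  have : B <= e / 2 ^+ n / 2 by rewrite ge_min lexx orbT.
  rewrite ler_pdivlMr // ler_pdivlMr ?exprn_gt0 // => h.
  have : 0 < B * 2 ^+ n by rewrite mulr_gt0 // exprn_gt0.
  lra.
have [del del0 hdel] := small_roots B0.
exists (Num.min del r); first by rewrite !lt_min del0 r10.
move=> z; rewrite subr0 lt_min => /andP[zd zr].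
have [->|z0] := eqVneq z 0; first by rewrite subrr cabs0.
have zr' : 0 < cabs z < r1 by move: zr; rewrite lt_min cabs_gt0 z0 => /andP[].
have sz := hn z zr'; rewrite Foff //.
have -> : (F 0)`_i = ('X^n : {poly C})`_i by rewrite /F eqxx.
pose rs := [seq x <- groots z | `[< S z x >] == b].
have selE : selpoly b z = \prod_(x <- rs) ('X - x%:P) by rewrite /selpoly big_filter.
have srs : size rs = n by apply/eqP; rewrite -eqSS -sz selE size_prod_XsubC.
rewrite coefXn; have [i_n|n_i|->] := ltngtP i n.
- rewrite subr0 selE; apply: le_lt_trans (coef_prod_bound i (ltW B0) _) _.
    move=> x; rewrite mem_filter => /andP[_ xr]; apply/ltW/(hdel z) => //.
    by rewrite groots_prod root_prod_XsubC.
  rewrite srs; apply: le_lt_trans Be; apply: ler_wpM2l; first exact: exprn_ge0.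
  by rewrite -[leRHS]expr1; apply: ler_wiXn2l; rewrite ?subn_gt0 // ltW.
- by rewrite nth_default ?sz // subrr cabs0.
- have : lead_coef (selpoly b z) = 1 by apply/monicP; exact: monic_prod_XsubC.
  by rewrite lead_coefE sz /= => ->; rewrite subrr cabs0.
Qed.

End Selection.
End Separation.

Section LinearFactor.
Variables (A : comNzRingType) (F : {poly A}) (l p : A).

(** This is the factor [F(Z) + l * (P - p)] of the norms below, as a polynomial in [Z] whose
    coefficients are polynomials in [P]. *)
Lemma coef_linear_factor i j : (map_poly polyC F + (l *: ('X - p%:P))%:P)`_i`_j =
  (if j == 0%N then F`_i else 0) + (if i == 0%N then l * ('X - p%:P)`_j else 0).
Proof.
have -> : (map_poly polyC F + (l *: ('X - p%:P))%:P)`_i =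
    (F`_i)%:P + (if i == 0%N then l *: ('X - p%:P) else 0) by rewrite coefD coef_map coefC.
rewrite coefD coefC; congr (_ + _).
by case: (i == 0%N); rewrite ?coefZ ?coef0.
Qed.

Lemma size_linear_factor :
  (size (map_poly polyC F + (l *: ('X - p%:P))%:P)%R <= maxn (size F) 1)%N /\
  forall i, (size ((map_poly polyC F + (l *: ('X - p%:P))%:P)`_i)%R <= 2)%N.
Proof.
split.
  apply: leq_trans (size_polyD _ _) _.
  by rewrite size_map_polyC geq_max leq_maxl (leq_trans (size_polyC_leq1 _)) // leq_maxr.
move=> i; rewrite coefD coef_map coefC; apply: leq_trans (size_polyD _ _) _.
rewrite geq_max; apply/andP; split; first by apply: leq_trans (size_polyC_leq1 _) _.
case: (i == 0%N); last by rewrite size_poly0.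
by apply: leq_trans (size_scale_leq _ _) _; rewrite size_XsubC.
Qed.

End LinearFactor.

(** * From factors over the arc to analytic germs *)

Section Irreducible.
Context {R : realType}.
Local Notation C := (Cplx R).

Lemma germ_eq_refl (U : normedModType C) (A : set U) : germ_eq A A.
Proof. by rewrite /germ_eq; near=> x; split. Unshelve. all: by end_near. Qed.

Lemma differentiable_hol (V : normedModType C) (f : C -> C) (T : V -> C) x :
  hol f (T x) -> differentiable T x -> differentiable (fun y => f (T y)) x.
Proof. by move=> [hf] hT; exact: (differentiable_comp hT hf). Qed.

Lemma differentiable_mul (V : normedModType C) (f g : V -> C) x :
  differentiable f x -> differentiable g x -> differentiable (fun y => f y * g y) x.
Proof. exact: differentiableM. Qed.

Lemma differentiable_pow (V : normedModType C) (f : V -> C) n x :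
  differentiable f x -> differentiable (fun y => f y ^+ n) x.
Proof.
move=> hf; apply: (@differentiable_hol _ (fun z => z ^+ n)) => //.
exact/holX/hol_id.
Qed.

Lemma pigeonhole_pow k (P : 'I_k.+1 -> 'I_k -> Prop) : (forall l, exists m, P l m) ->
  exists l l' m, [/\ l != l', P l m & P l' m].
Proof.
move=> h; have [f hf] := choice h.
have : ~~ injectiveb [ffun l => f l].
  apply/injectiveP => /leq_card; rewrite !card_ord ltnn //.
move=> /injectivePn[l [l' ll' E]]; exists l, l', (f l); split => //.
by move: E; rewrite !ffunE => ->.
Qed.

Variables (d k : nat) (a : nat -> C -> C -> C) (pw : C -> C) (A : set 'rV[C]_3)
  (T Pf Z : 'rV[C]_3 -> C) (rho0 : R).
Let G w := gpoly d (fun i => a i (w ^+ k) (pw w)).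
Hypotheses (k0 : (0 < k)%N) (rho00 : 0 < rho0) (rho01 : rho0 <= 1)
  (diffTPZ : \forall x \near (0 : 'rV[C]_3),
     [/\ differentiable T x, differentiable Pf x & differentiable Z x])
  (T0 : T 0 = 0)
  (coords : forall U : set 'rV[C]_3, nbhs (0 : 'rV[C]_3) U -> exists2 del : R, 0 < del &
     forall t p z, cabs t < del -> cabs p < del -> cabs z < del ->
     exists x, [/\ U x, T x = t, Pf x = p & Z x = z])
  (AE : \forall x \near (0 : 'rV[C]_3), A x <->
     exists w, [/\ cabs w < rho0, T x = w ^+ k, Pf x = pw w & root (G w) (Z x)])
  (irr : irreducible_germ A)
  (arc_hol : forall i, (i < d)%N -> forall w, cabs w < rho0 -> hol (fun w => a i (w ^+ k) (pw w)) w)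
  (pwh : forall w, cabs w < rho0 -> hol pw w) (pw0 : pw 0 = 0)
  (a0 : forall i, (i < d)%N -> a i 0 0 = 0)
  (arc_inj : forall w w', cabs w < rho0 -> cabs w' < rho0 -> w ^+ k = w' ^+ k -> pw w = pw w' -> w = w')
  (Gsep : forall w, 0 < cabs w < rho0 -> separable_poly (G w)).

(* A factor F of G over the arc cuts out the set of the x such that
   (T x, Pf x) = (w ^ k, pw w) and F w (Z x) = 0 for some w; it is the common zero
   set of the norms \prod_(w ^ k = T x) (F w (Z x) + l (Pf x - pw w)), l = 0, .., k,
   because two values of l share the index w of a vanishing factor. *)
Definition norm_eq (F : C -> {poly C}) (l : C) (x : 'rV[C]_3) : C :=
  \prod_(w <- kroots k (T x)) ((F w).[Z x] + l * (Pf x - pw w)).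

(** A single factor is no function of [x], since it needs a k-th root of [T x]. The product is a
    polynomial in [Z x] and [Pf x] whose coefficients are symmetric in these roots, hence
    holomorphic in [T x]. *)
Lemma norm_eq_differentiable (F : C -> {poly C}) (l : C) (r : R) : 0 < r -> r <= rho0 ->
  (forall w, (size (F w) <= d.+1)%N) ->
  (forall i w, cabs w < r -> hol (fun w => (F w)`_i) w) ->
  holomorphic_germ (norm_eq F l).
Proof.
move=> r0 r_rho0 sF Fh.
pose q w : {poly {poly C}} := map_poly polyC (F w) + (l *: ('X - (pw w)%:P))%:P.
have qh i j w : cabs w < r -> hol (fun w => (q w)`_i`_j) w.
  move=> wr.
  apply: (@hol_ext _ (fun w => (if j == 0%N then (F w)`_i else 0) +
      (if i == 0%N then l * ('X - (pw w)%:P)`_j else 0))).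
    by move=> z; rewrite /q coef_linear_factor.
  apply: holD.
    by case: (j == 0%N); [exact: Fh|exact: hol_cst].
  case: (i == 0%N); last exact: hol_cst.
  apply: holM; first exact: hol_cst.
  by apply: hol_coef_XsubC; apply: pwh; exact: lt_le_trans r_rho0.
have r1 : r <= 1 by exact: le_trans r_rho0 rho01.
pose Q t := \prod_(w <- kroots k t) q w.
have Qh := coefs2_hol_kroots k0 r0 r1 qh.
have NE x : norm_eq F l x = (Q (T x)).[(Z x)%:P].[Pf x].
  rewrite /norm_eq /Q !horner_prod; apply: eq_bigr => w _.
  by rewrite hornerD horner_map /= !hornerE.
have sq w : (size (q w) <= d.+1)%N /\ forall i, (size ((q w)`_i)%R <= 2)%N.
  have [h1 h2] := size_linear_factor (F w) l (pw w).
  by split; [apply: leq_trans h1 _; rewrite geq_max sF|exact: h2].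
pose I := (k * d.+1 + 1)%N; pose J := (k * 2 + 1)%N.
have sQ t : (size (Q t) <= I)%N /\ forall i, (size ((Q t)`_i)%R <= J)%N.
  by have := size2_prod (kroots k t) sq; rewrite size_kroots.
pose f x := \sum_(i < I) (\sum_(j < J) (Q (T x))`_i`_j * Pf x ^+ j) * Z x ^+ i.
have NE2 : norm_eq F l = f.
  by apply: funext => x; rewrite NE; have [s1 s2] := sQ (T x); exact: horner2_wide.
rewrite /holomorphic_germ NE2.
have rk : 0 < r ^+ k by rewrite exprn_gt0.
have [dT0 _ _] := nbhs_singleton diffTPZ.
have := near_small (differentiable_continuous dT0) T0 rk.
apply: filterS2 diffTPZ => x [dT dP dZ] Tr.
apply: (@diff_sum _ _ I (fun i x => (\sum_(j < J) (Q (T x))`_i`_j * Pf x ^+ j) * Z x ^+ i)) => i _.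
apply: differentiable_mul; last exact: differentiable_pow.
apply: (@diff_sum _ _ J (fun j x => (Q (T x))`_i`_j * Pf x ^+ j)) => j _; apply: differentiable_mul; last exact: differentiable_pow.
apply: (@differentiable_hol _ (fun t => (Q t)`_i`_j)) => //.
exact: Qh.
Qed.

Lemma norm_eq_root (F : C -> {poly C}) x :
  (forall l : 'I_k.+1, norm_eq F (nat_of_ord l)%:R x = 0) ->
  exists w, [/\ T x = w ^+ k, Pf x = pw w & root (F w) (Z x)].
Proof.
move=> h; pose us := kroots k (T x).
have sus : size us = k by exact: size_kroots.
have hl (l : 'I_k.+1) : exists m : 'I_k,
    (F (nth 0 us m)).[Z x] + (nat_of_ord l)%:R * (Pf x - pw (nth 0 us m)) = 0.
  have := h l; rewrite /norm_eq (big_nth 0) -/us sus big_mkord => /eqP.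
  by rewrite prodf_seq_eq0 => /hasP[m _ /= /eqP E]; exists m.
have [l [l' [m [ll' E E']]]] := pigeonhole_pow hl.
set w := nth 0 us m in E E'.
have wk : w ^+ k = T x.
  by apply/eqP; rewrite -mem_kroots // mem_nth // sus.
have : ((nat_of_ord l)%:R - (nat_of_ord l')%:R) * (Pf x - pw w) = 0.
  have -> : ((nat_of_ord l)%:R - (nat_of_ord l')%:R) * (Pf x - pw w) =
    ((F w).[Z x] + (nat_of_ord l)%:R * (Pf x - pw w)) -
    ((F w).[Z x] + (nat_of_ord l')%:R * (Pf x - pw w)) by ring.
  by rewrite E E' subrr.
move=> /eqP; rewrite mulf_eq0 subr_eq0 eqr_nat => /orP[/eqP ll|].
  by rewrite (val_inj ll) eqxx in ll'.
rewrite subr_eq0 => /eqP pE; exists w; split => //.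
by move: E; rewrite pE subrr mulr0 addr0 => /rootP.
Qed.

Lemma root_norm_eq (F : C -> {poly C}) l x w : T x = w ^+ k -> Pf x = pw w ->
  root (F w) (Z x) -> norm_eq F l x = 0.
Proof.
move=> Tw Pw /rootP Fw; rewrite /norm_eq.
have wk : w \in kroots k (T x) by rewrite mem_kroots // Tw.
by apply/eqP; rewrite prodf_seq_eq0; apply/hasP; exists w; rewrite //= Fw Pw subrr mulr0 addr0.
Qed.

(** The roots selected by [S] and the others give two factors of [G] that extend across 0. Their
    zero sets over the arc are analytic germs with union [A], so one of them is all of [A]. A point
    of [A] determines [w] by injectivity of the arc, so every root over a small [w] belongs to that
    factor. *)
Theorem nosplit_of_irreducible : nosplit d k a pw.
Proof.
move=> S rho rho_gt0 G' Sloc'; rewrite -/G in G' Sloc' *.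
pose r1 := Num.min rho rho0.
have r10 : 0 < r1 by rewrite lt_min rho_gt0.
have r1_rho : r1 <= rho by rewrite ge_min lexx.
have r1_rho0 : r1 <= rho0 by rewrite ge_min lexx orbT.
have Gm w : monicd d (G w) by exact: monicd_gpoly.
have Gs w : 0 < cabs w < r1 -> separable_poly (G w).
  by move=> /andP[w0 wr]; apply: Gsep; rewrite w0 (lt_le_trans wr).
have Gh w : cabs w < r1 -> forall i, (i < d)%N -> hol (fun w => (G w)`_i) w.
  move=> wr i id; apply: (@hol_ext _ (fun w => a i (w ^+ k) (pw w))).
    by move=> z; rewrite /G coef_gpoly.
  by apply: arc_hol => //; exact: lt_le_trans r1_rho0.
have G0 i : (i < d)%N -> (G 0)`_i = 0.
  by move=> id; rewrite /G coef_gpoly // expr0n (gtn_eqF k0) pw0 a0.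
have Sloc w0 z0 : 0 < cabs w0 < r1 -> root (G w0) z0 ->
     exists2 e : R, 0 < e & forall w z, cabs (w - w0) < e -> cabs (z - z0) < e ->
       root (G w) z -> (S w z <-> S w0 z0).
  by move=> /andP[w00 w0r]; apply: Sloc'; rewrite w00 (lt_le_trans w0r).
have ext := selpoly_extend r10 Gm Gs Gh G0 Sloc.
have [n1 [F1 [s1 [s10 s1r F10 F1E F1h]]]] := ext true.
have [n2 [F2 [s2 [s20 s2r F20 F2E F2h]]]] := ext false.
pose F b := if b then F1 else F2.
pose s := Num.min s1 s2.
have s0 : 0 < s by rewrite lt_min s10.
have ss1 : s <= s1 by rewrite ge_min lexx.
have ss2 : s <= s2 by rewrite ge_min lexx orbT.
clearbody s.
have s_rho0 : s <= rho0 by apply: le_trans ss1 (le_trans s1r r1_rho0).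
have FE b w : 0 < cabs w < s -> F b w = selpoly G S b w.
  move=> /andP[w0 ws]; case: b.
    by have [] := F1E w _; rewrite ?w0 ?(lt_le_trans ws).
  by have [] := F2E w _; rewrite ?w0 ?(lt_le_trans ws).
(* Off 0 the degrees of the two factors add up to [d], which fixes the product of their values at
   0. *)
have F0 : F true 0 * F false 0 = 'X^d.
  rewrite /F F10 F20 -exprD; congr ('X^_).
  have [w w0 ws] := exists_small s0.
  have [_ z1] := F1E w ltac:(by rewrite w0 (lt_le_trans ws)).
  have [_ z2] := F2E w ltac:(by rewrite w0 (lt_le_trans ws)).
  have [_ sG] := Gm w; have := congr1 (fun p : {poly C} => size p) (selpolyM S Gm w).
  have nz b : selpoly G S b w != 0 by rewrite monic_neq0 // monic_prod_XsubC.
  by rewrite sG size_mul // z1 z2 addSn /= addnS => -[].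
have GF w : cabs w < s -> G w = F true w * F false w.
  move=> ws; have [->|w0] := eqVneq w 0.
    rewrite F0; apply/polyP => i; rewrite coefXn.
    have [id|di|->] := ltngtP i d; first exact: G0.
      by rewrite nth_default //; have [_ ->] := Gm 0.
    by have [/monicP + sG] := Gm 0; rewrite lead_coefE sG.
  by rewrite !FE ?cabs_gt0 ?w0 // (selpolyM S Gm).
(* Set to 0 outside the disk, so that the degree bound holds for every [w]. *)
pose FF b w := if cabs w < s then F b w else 0.
have sFF b w : (size (FF b w) <= d.+1)%N.
  rewrite /FF; case: ifPn => [ws|_]; last by rewrite size_poly0.
  have [mG <-] := Gm w; rewrite (GF w ws); apply: dvdp_leq.
    by rewrite -GF // monic_neq0.
  by case: b; [exact: dvdp_mulr|exact: dvdp_mull].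
have FFh b i w : cabs w < s -> hol (fun w => (FF b w)`_i) w.
  move=> ws; apply: (@hol_eq _ (fun w => (F b w)`_i)).
    exists (s - cabs w); first by rewrite subr_gt0.
    by move=> z zw; rewrite /FF; have -> : cabs z < s by have := cabs_le_add z w; lra.
  by case: b; [apply: F1h|apply: F2h]; exact: lt_le_trans ws _.
pose Ab b := [set x | forall l : 'I_k.+1, norm_eq (FF b) (nat_of_ord l)%:R x = 0].
have anA b : analytic_germ (Ab b).
  exists k.+1, (fun l => norm_eq (FF b) (nat_of_ord l)%:R); split.
    by move=> l; exact: (norm_eq_differentiable _ s0 s_rho0 (sFF b) (FFh b)).
  exact: germ_eq_refl.
have sk : 0 < s ^+ k by rewrite exprn_gt0.
have [dT0 dP0 dZ0] := nbhs_singleton diffTPZ.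
have Tsmall := near_small (differentiable_continuous dT0) T0 sk.
have w_small x w : cabs (T x) < s ^+ k -> T x = w ^+ k -> cabs w < s.
  move=> Tx Tw; rewrite -(@ltr_pXn2r _ k) ?nnegrE ?cabs_ge0 ?(ltW s0) //.
  by rewrite -cabsX -Tw.
have AbE b x : cabs (T x) < s ^+ k -> Ab b x <->
    exists w, [/\ cabs w < s, T x = w ^+ k, Pf x = pw w & root (F b w) (Z x)].
  move=> Tx; split.
    move=> /norm_eq_root[w [Tw Pw]]; have ws := w_small _ _ Tx Tw.
    by rewrite /FF ws => Fw; exists w.
  move=> [w [ws Tw Pw Fw]] l; apply: root_norm_eq Tw Pw _.
  by rewrite /FF ws.
have AU : germ_eq A (Ab true `|` Ab false).
  rewrite /germ_eq; apply: filterS2 AE Tsmall => x Ax Tx; rewrite Ax; split.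
    move=> [w [_ Tw Pw]]; have ws := w_small _ _ Tx Tw; rewrite GF // rootM => /orP[h|h].
      by left; apply/AbE => //; exists w.
    by right; apply/AbE => //; exists w.
  by move=> [/(AbE _ _ Tx)|/(AbE _ _ Tx)] [w [ws Tw Pw h]]; exists w;
    split => //; [exact: lt_le_trans s_rho0|rewrite GF // rootM h ?orbT
                 |exact: lt_le_trans s_rho0|rewrite GF // rootM h ?orbT].
(* By [coords], every root over a small [w] is the [Z] coordinate of a point of [A] in the
   neighbourhood where the germs agree. *)
have main b : germ_eq A (Ab b) -> exists2 e : R, 0 < e &
    forall w z, 0 < cabs w < e -> root (G w) z -> `[< S w z >] == b.
  rewrite /germ_eq => AAb.
  have [del del0 hdel] := coords (filterI AAb (filterI AE Tsmall)).
  have [e1 e10 he1] := small_roots r10 Gm Gh G0 del0.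
  have c00 : cabs (0 : C) < rho0 by rewrite cabs0.
  have [e2 e20 he2] := hol_ccont (pwh c00) del0.
  exists (Num.min (Num.min del 1) (Num.min s (Num.min e1 e2))).
    by rewrite !lt_min del0 ltr01 s0 e10.
  move=> w z; rewrite !lt_min => /andP[w0 /andP[/andP[wd w1] /and3P[ws we1 we2]]] zr.
  have wkd : cabs (w ^+ k) < del.
    rewrite cabsX; apply: le_lt_trans wd; rewrite -[leRHS]expr1.
    by apply: ler_wiXn2l => //; exact: ltW.
  have pwd : cabs (pw w) < del by have := he2 w; rewrite pw0 !subr0; exact.
  have [x [[xA [AEx Tx]] Tw Pw Zx]] := hdel _ _ _ wkd pwd (he1 w z we1 zr).
  have : Ab b x.
    by apply/xA/AEx; exists w; rewrite Zx; split => //; exact: lt_le_trans s_rho0.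
  move=> /(AbE _ _ Tx)[w' [ws' Tw' Pw' Fw']].
  have ww' : w = w'.
    by apply: arc_inj; [exact: lt_le_trans s_rho0|exact: lt_le_trans s_rho0|rewrite -Tw|rewrite -Pw].
  by move: Fw'; rewrite -ww' Zx FE ?w0 // (root_selpoly S Gm) => /andP[].
have [_ /(_ _ _ (anA true) (anA false) AU)[]] := irr.
  by move=> /main[e e0 he]; left; exists e => // w z we /(he _ _ we)/eqP/asboolP.
by move=> /main[e e0 he]; right; exists e => // w z we /(he _ _ we)/eqP/negbT/asboolPn.
Qed.

End Irreducible.

(** * Arcs and tangent cones *)

Section VectorGerms.
Context {R : realType}.
Local Notation C := (Cplx R).

Lemma nearV n (P : set 'rV[C]_n) (x : 'rV[C]_n) : nbhs x P <->
  exists2 d : R, 0 < d & forall y : 'rV[C]_n, (forall j, cabs (y 0 j - x 0 j) < d) -> P y.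
Proof.
split.
  move=> /nbhs_ballP[e /= e0 he].
  have eE : e = ((complex.Re e)%:C)%C by rewrite RRe_real ?gtr0_real.
  have e0' : 0 < complex.Re e by move: e0; rewrite eE ltcR.
  exists (complex.Re e) => // y yx; apply: he; split => // i j; rewrite !ord1.
  rewrite -ball_normE /= eE cabsE ltcR cabs_subC; exact: yx.
move=> [d d0 hd]; apply/nbhs_ballP; exists (d%:C)%C; first by rewrite /= ltcR.
move=> y [_ xy]; apply: hd => j; have := xy 0 j.
by rewrite -ball_normE /= cabsE ltcR cabs_subC.
Qed.

Lemma cvg_rowP n (x : nat -> 'rV[C]_n) (v : 'rV[C]_n) : x k @[k --> \oo] --> v <->
  forall e : R, 0 < e -> exists N, forall k, (N <= k)%N -> forall j, cabs (x k 0 j - v 0 j) < e.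
Proof.
split=> [xv e e0|h U /nearV[d d0 hd]].
  have : nbhs v [set y : 'rV[C]_n | forall j, cabs (y 0 j - v 0 j) < e].
    by apply/nearV; exists e.
  by move=> /xv[N _ hN]; exists N => k Nk; exact: hN.
by have [N hN] := h _ d0; exists N => // k /= Nk; apply: hd; exact: hN.
Qed.

Lemma mulmx_small m n (M : 'M[C]_(m, n)) (e : R) : 0 < e -> exists2 d : R, 0 < d &
  forall x : 'rV[C]_m, (forall j, cabs (x 0 j) < d) -> forall j, cabs ((x *m M) 0 j) < e.
Proof.
move=> e0; pose K : R := \sum_i \sum_j cabs (M i j).
have K0 : 0 <= K by apply: sumr_ge0 => i _; apply: sumr_ge0 => j _; exact: cabs_ge0.
exists (e / (K + 1)); first by rewrite divr_gt0 // ltr_wpDl.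
move=> x xd j; rewrite mxE; apply: le_lt_trans (cabs_sum _ _ _) _.
have d0 : 0 <= e / (K + 1) by rewrite ltW // divr_gt0 // ltr_wpDl.
apply: (@le_lt_trans _ _ (e / (K + 1) * K)).
  rewrite mulr_sumr; apply: ler_sum => i _; rewrite cabsM.
  apply: ler_pM; rewrite ?cabs_ge0 ?(ltW (xd i)) //.
  by rewrite (bigD1 j) //= lerDl sumr_ge0 // => l _; exact: cabs_ge0.
by rewrite mulrAC ltr_pdivrMr ?ltr_wpDl // ltr_pM2l // ltrDl.
Qed.

(** Sequences are exchanged for single points at every precision, measured in the coordinates given
    by the invertible matrix [B]. *)
Lemma tangent_coneP n (B : 'M[C]_n) (A : set 'rV[C]_n) (v : 'rV[C]_n) : B \in unitmx ->
  tangent_cone A v <-> forall e : R, 0 < e -> exists x (c : C),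
    [/\ A x, forall j, cabs ((x *m B) 0 j) < e
      & forall j, cabs ((c *: (x *m B) - v *m B) 0 j) < e].
Proof.
move=> uB; split.
  move=> [x [c [xA /cvg_rowP x0 /cvg_rowP xv]]] e e0.
  have [d d0 hd] := mulmx_small B e0.
  have [N1 h1] := x0 d d0; have [N2 h2] := xv d d0.
  exists (x (maxn N1 N2)), (c (maxn N1 N2)); split => //.
    by apply: hd => j; have := h1 _ (leq_maxl N1 N2) j; rewrite mxE subr0.
  move=> j; rewrite scalemxAl -mulmxBl; apply: hd => i.
  by have := h2 _ (leq_maxr N1 N2) i; rewrite !mxE.
move=> h.
have h' (k : nat) : exists xc : 'rV[C]_n * C, [/\ A xc.1,
    forall j, cabs (xc.1 0 j) < k.+1%:R^-1 & forall j, cabs ((xc.2 *: xc.1 - v) 0 j) < k.+1%:R^-1].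
  have k0 : 0 < k.+1%:R^-1 :> R by rewrite invr_gt0.
  have [d d0 hd] := mulmx_small (invmx B) k0.
  have [x [c [Ax xd cd]]] := h d d0; exists (x, c); split => //= j.
    by rewrite -[x](mulmxK uB); apply: hd.
  by rewrite -[_ - v](mulmxK uB); apply: hd => i; rewrite mulmxBl -scalemxAl.
have [xc hxc] := choice h'.
have small (e : R) : 0 < e -> exists N, forall k, (N <= k)%N -> k.+1%:R^-1 < e.
  move=> e0; have /ltr_add_invr[N] := e0.
  rewrite add0r => hN; exists N => k Nk; apply: le_lt_trans hN.
  by rewrite lef_pV2 ?posrE // ler_nat.
exists (fun k => (xc k).1), (fun k => (xc k).2); split.
- by move=> k; have [] := hxc k.
- apply/cvg_rowP => e /small[N hN]; exists N => k /hN ke j; rewrite [(0 : 'rV_n) _ _]mxE subr0.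
  by apply: lt_trans ke; have [_ + _] := hxc k; apply.
- apply/cvg_rowP => e /small[N hN]; exists N => k /hN ke j.
  by apply: lt_trans ke; have [_ _ /(_ j)] := hxc k; rewrite !mxE.
Qed.

Lemma tangent_cone_germ n (A B : set 'rV[C]_n) : germ_eq A B ->
  tangent_cone A = tangent_cone B.
Proof.
move=> /nearV[d d0 hd]; apply/seteqP.
have sub (A' B' : set 'rV[C]_n) : (forall x : 'rV[C]_n, (forall j, cabs (x 0 j) < d) -> A' x -> B' x) ->
    tangent_cone A' `<=` tangent_cone B'.
  move=> AB v /(tangent_coneP _ _ (unitmx1 _ _)) h; apply/(tangent_coneP _ _ (unitmx1 _ _)).
  move=> e e0; have m0 : 0 < Num.min e d by rewrite lt_min e0.
  have [x [c [Ax xe xv]]] := h _ m0; exists x, c; split.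
  - by apply: AB => // j; have := xe j; rewrite mulmx1 lt_min => /andP[].
  - by move=> j; have := xe j; rewrite lt_min => /andP[].
  - by move=> j; have := xv j; rewrite lt_min => /andP[].
by split; apply: sub => x xd; apply hd => j; rewrite [(0 : 'rV_n) _ _]mxE subr0.
Qed.

(** A nonzero row has rank 1, so its rank decomposition is a scalar times the first unit row times
    an invertible matrix. *)
Lemma straighten n (v : 'rV[C]_n.+1) : v != 0 ->
  exists2 D : 'M[C]_n.+1, D \in unitmx & v *m D = delta_mx 0 0.
Proof.
move=> v0; have rv : \rank v = 1%N by rewrite rank_rV v0.
have uc : col_ebase v 0 0 != 0.
  by have := col_ebase_unit v; rewrite unitmxE det_mx11 unitfE.
exists ((col_ebase v 0 0)^-1 *: invmx (row_ebase v)).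
  by rewrite unitmxZ ?unitfE ?invr_neq0 // unitmx_inv row_ebase_unit.
have [E uR] := (mulmx_ebase v, row_ebase_unit v).
move: (row_ebase v) uR E => U uU E.
rewrite -scalemxAr; have -> : v *m invmx U = col_ebase v *m pid_mx 1.
  by rewrite -{1}E rv mulmxK.
move: (col_ebase v) uc => cE uc.
rewrite [X in X *m _]mx11_scalar mul_scalar_mx scalerA mulVf // scale1r.
by apply/rowP => -[[|j] jn]; rewrite !mxE.
Qed.

End VectorGerms.

(** * Local inverse of a holomorphic function with a simple zero *)

Section LocalInverse.
Context {R : realType}.
Local Notation C := (Cplx R).

Variables (W g : C -> C) (r : R).
Hypotheses (r0 : 0 < r) (gh : forall u, cabs u <= r -> hol g u) (g0 : g 0 != 0)
  (WE : forall u, W u = u * g u).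

Let m := cabs (g 0).

(** In [W u - W v = g u * (u - v) - v * (g v - g u)] the first term dominates, because [g] is
    Lipschitz and [v] is small. *)
Lemma lower_lipschitz : exists s : R, [/\ 0 < s, s < r,
  forall u, cabs u <= s -> cabs (W u) <= 5 / 4 * m * cabs u
  & forall u v, cabs u <= s -> cabs v <= s -> m / 2 * cabs (u - v) <= cabs (W u - W v)].
Proof.
have m0 : 0 < m by rewrite cabs_gt0.
have rp := r0.
have h00 : cabs (0 : C) <= r by rewrite cabs0 ltW.
have m4 : 0 < m / 4 by lra.
have [d d0 hd] := hol_ccont (gh h00) m4.
pose r' := Num.min (r / 2) (d / 2).
have r'0 : 0 < r' by rewrite lt_min; apply/andP; split; lra.
have r'r : r' <= r / 2 by rewrite ge_min lexx.
have r'd : r' <= d / 2 by rewrite ge_min lexx orbT.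
clearbody r'.
have near u : cabs u <= r' -> cabs (g u - g 0) < m / 4.
  by move=> ur; apply: hd; rewrite subr0; lra.
have up u : cabs u <= r' -> cabs (g u) <= 5 / 4 * m.
  by move=> ur; have := cabs_le_add (g u) (g 0); have := near u ur; rewrite -/m; lra.
have low u : cabs u <= r' -> 3 / 4 * m <= cabs (g u).
  move=> ur; have := cabs_le_add (g 0) (g u); have := near u ur.
  by rewrite -/m (cabs_subC (g 0)); lra.
(* [g] has Lipschitz constant [5 * m / r'], so [cabs v <= r' / 20] makes the second term at most
   [m / 4 * cabs (u - v)]. *)
exists (r' / 20); split; [lra|lra| |].
  move=> u us; rewrite WE cabsM mulrC; apply: ler_wpM2r; first exact: cabs_ge0.
  by apply: up; lra.
move=> u v us vs.
have ur : cabs u <= r' by lra.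
have vr : cabs (v - 0) <= r' / 2 by rewrite subr0; lra.
have gr z : cabs (z - 0) <= r' -> hol g z by rewrite subr0 => zr; apply: gh; clra.
have ghv : hol g v by apply: gr; rewrite subr0 in vr *; clra.
have L : cabs (g u - g v) <= 4 * (5 / 4 * m) / r' * cabs (u - v).
  apply: (@cauchy_lipschitz _ [::] g 0 r' (5 / 4 * m)) => //.
  - by move=> z zr; apply: hol_ccont; exact: gr.
  - by move=> z zr _; exact: gr.
  - by move=> z zr; apply: up; rewrite subr0 in zr; lra.
  - by rewrite subr0.
have -> : W u - W v = g u * (u - v) - v * (g v - g u) by rewrite !WE; ring.
have T := cabs_le_add (g u * (u - v)) (v * (g v - g u)).
have Lv : cabs (v * (g v - g u)) <= m / 4 * cabs (u - v).
  rewrite cabsM cabs_subC.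
  apply: (@le_trans _ _ (r' / 20 * (4 * (5 / 4 * m) / r' * cabs (u - v)))).
    by apply: ler_pM => //; exact: cabs_ge0.
  rewrite le_eqVlt; apply/orP; left; apply/eqP.
  by field; rewrite gt_eqF.
have U : 3 / 4 * m * cabs (u - v) <= cabs (g u * (u - v)).
  by rewrite cabsM; apply: ler_wpM2r; [exact: cabs_ge0|exact: low].
lra.
Qed.

(** If [w] had no preimage, the inverse of [W u - w] would be holomorphic with larger modulus at 0
    than its bound on the circle. The bounds on [om] come from [lower_lipschitz], its
    differentiability from the difference quotient of [W], which stays away from 0. *)
Lemma local_inverse : exists (s K : R) (om : C -> C), [/\ 0 < s, 0 < K,
  forall w, cabs w < s -> [/\ hol om w, W (om w) = w & cabs (om w) <= K * cabs w]
  & exists2 s1 : R, 0 < s1 & forall u, cabs u < s1 -> cabs (W u) < s /\ om (W u) = u].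
Proof.
have m0 : 0 < m by rewrite cabs_gt0.
have [s0 [s00 s0r Wup Wlow]] := lower_lipschitz.
have Wh u : cabs u <= r -> hol W u.
  move=> ur; apply: (@hol_ext _ (fun u => u * g u)); first by move=> z; rewrite WE.
  by apply: (holM (hol_id _)); exact: gh.
have W0 : W 0 = 0 by rewrite WE mul0r.
(* On the circle of radius [s0] one has [cabs (W u) >= 2 * s], so [cabs (W u - w) > cabs w] whenever
   [cabs w < s]. *)
pose s := m * s0 / 4.
have s_gt0 : 0 < s by rewrite /s divr_gt0 // mulr_gt0.
have sE : m * s0 = 4 * s by rewrite /s; field.
have low0 u : cabs u <= s0 -> m / 2 * cabs u <= cabs (W u).
  by move=> us; have := @Wlow u 0 us; rewrite cabs0 W0 !subr0; apply; exact: ltW.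
have onto w : exists u, cabs w < s -> cabs u <= s0 /\ W u = w.
  apply: contrapT => /forallNP no.
  have ws : cabs w < s by apply: contrapT => nw; apply: (no 0).
  have nW u : cabs u <= s0 -> W u - w != 0.
    by move=> us; apply/eqP => /subr0_eq Ww; apply: (no u).
  have w0 : 0 < cabs w.
    by have := nW 0; rewrite W0 sub0r oppr_eq0 cabs_gt0 cabs0; apply; exact: ltW.
  have := @maximum_principle _ (fun u => (W u - w)^-1) 0 s0 ((4 * s / 2 - cabs w)^-1) _ _ 0.
  rewrite subrr cabs0 W0 sub0r cabsV cabsN lef_pV2 ?posrE //; last by lra.
  move=> h; suff : 4 * s / 2 - cabs w <= cabs w by lra.
  apply: h; last exact: ltW.
    move=> z; rewrite subr0 => zs; apply: holV; last exact: nW.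
    by apply: (holB (Wh _ _) (hol_cst _ _)); lra.
  move=> z; rewrite subr0 => zs; rewrite cabsV.
  have zs' : cabs z <= s0 by rewrite zs.
  rewrite lef_pV2 ?posrE ?cabs_gt0 ?nW //; last by lra.
  have := low0 z zs'; rewrite zs.
  have := cabs_le_add (W z) (W z - w); have -> : W z - (W z - w) = w by ring.
  by rewrite mulrAC sE; lra.
have [om homs] := choice onto.
have oms w : cabs w < s -> cabs (om w) <= s0 by move=> /homs[].
have omW w : cabs w < s -> W (om w) = w by move=> /homs[].
have lip w w' : cabs w < s -> cabs w' < s -> cabs (om w - om w') <= 2 / m * cabs (w - w').
  move=> ws ws'; have := Wlow _ _ (oms _ ws) (oms _ ws'); rewrite !omW // => h.
  by rewrite mulrAC ler_pdivlMr //; lra.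
have om0 : om 0 = 0.
  have z0 : cabs (0 : C) < s by rewrite cabs0.
  have := low0 _ (oms _ z0); rewrite omW // cabs0 pmulr_rle0 ?divr_gt0 // => h.
  by apply/eqP; rewrite -cabs_eq0 eq_le h cabs_ge0.
exists s, (2 / m), om; split => //; first by rewrite divr_gt0.
  move=> w0 w0s; split; [|exact: omW|]; last first.
    by have := lip w0 0 w0s; rewrite om0 !subr0 cabs0; exact.
  have u0r : cabs (om w0) <= r by have := oms _ w0s; lra.
  have [q [qE qc _ _]] := hol_quotient (Wh _ u0r).
  pose del := s - cabs w0; have del0 : 0 < del by rewrite subr_gt0.
  have nears x : cabs (x - w0) < del -> cabs x < s.
    by move=> xd; have := cabs_le_add x w0; rewrite /del in xd; lra.
  have neq x : cabs x < s -> x != w0 -> om x - om w0 != 0.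
    move=> xs xw; rewrite subr_eq0; apply: contraNneq xw => E.
    by rewrite -(omW x) // E omW.
  have qlow x : cabs x < s -> x != w0 -> m / 2 <= cabs (q (om x)).
    move=> xs xw; have := Wlow _ _ (oms _ xs) (oms _ w0s).
    by rewrite qE cabsM ler_pM2r // cabs_gt0 neq.
  have ccom : ccont (fun x => q (om x)) w0.
    move=> e /qc[d d0 hd]; exists (Num.min del (d * m / 2)).
      by rewrite lt_min del0 !(divr_gt0, mulr_gt0).
    move=> x; rewrite lt_min => /andP[xd xd2]; apply: hd.
    apply: le_lt_trans (lip _ _ (nears _ xd) w0s) _.
    by rewrite mulrAC ltr_pdivrMr //; lra.
  have q0 : m / 4 <= cabs (q (om w0)).
    rewrite leNgt; apply/negP => h; have m4 : 0 < m / 4 by lra.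
    have [d d0 hd] := ccom _ m4.
    have [x [xw xd xd']] := @near_disk _ w0 w0 del d d0 ltac:(by rewrite subrr cabs0).
    have := qlow x (nears _ xd') xw; have := hd x xd.
    by have := cabs_le_add (q (om x)) (q (om w0)); clra.
  have qnz x : cabs x < s -> m / 4 <= cabs (q (om x)).
    by move=> xs; have [->//|xw] := eqVneq x w0; have := qlow x xs xw; clra.
  pose q' x := if x == w0 then (q (om w0))^-1 else (om x - om w0) / (x - w0).
  have q'E x : cabs x < s -> q' x = (q (om x))^-1.
    move=> xs; rewrite /q'; have [->//|xw] := eqVneq x w0.
    have := qE (om x); rewrite !omW // => ->.
    by rewrite invfM mulrCA divff ?mulr1 // neq.
  apply: (@hol_caratheodory _ _ q').
    move=> x; rewrite /q'; have [->|xw] := eqVneq x w0; first by rewrite !subrr mulr0.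
    by rewrite divfK // subr_eq0.
  apply: (@ccont_eq _ (fun x => (q (om x))^-1)).
    by exists del => // x xd; rewrite q'E // nears.
  move=> e e0; have e'0 : 0 < e * (m / 4) * (m / 4) by rewrite !mulr_gt0 // divr_gt0.
  have [d d0 hd] := ccom _ e'0; exists (Num.min d del); first by rewrite lt_min d0.
  move=> x; rewrite lt_min => /andP[xd xdel].
  have h1 := qnz _ (nears _ xdel); have h2 := qnz _ w0s.
  have nz1 : q (om x) != 0 by rewrite -cabs_gt0; clra.
  have nz2 : q (om w0) != 0 by rewrite -cabs_gt0; clra.
  have -> : (q (om x))^-1 - (q (om w0))^-1 = (q (om w0) - q (om x)) / (q (om x) * q (om w0)).
    by field; rewrite nz1 nz2.
  rewrite cabsM cabsV cabsM cabs_subC ltr_pdivrMr; last by rewrite mulr_gt0 // cabs_gt0.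
  apply: (lt_le_trans (hd x xd)); rewrite -mulrA ler_pM2l //.
  by apply: ler_pM => //; clra.
exists (s0 / 5); first by rewrite divr_gt0.
move=> u us; have us0 : cabs u <= s0 by lra.
have Wu : cabs (W u) < s.
  apply: le_lt_trans (Wup _ us0) _.
  have : m * cabs u < m * (s0 / 5) by rewrite ltr_pM2l.
  by lra.
split => //; have := Wlow _ _ (oms _ Wu) us0; rewrite omW // subrr cabs0.
rewrite pmulr_rle0 ?divr_gt0 // => h; apply/eqP.
by rewrite -subr_eq0 -cabs_eq0 eq_le h cabs_ge0.
Qed.

End LocalInverse.

(** * Parametrisation of the arc by a k-th power *)

Section ArcNormalForm.
Context {R : realType}.
Local Notation C := (Cplx R).

Lemma hol_coord n (f : C -> 'rV[C]_n) j z : differentiable f z -> hol (fun u => f u 0 j) z.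
Proof.
move=> hf; split.
by apply: (@differentiable_comp _ _ _ _ f (fun M : 'rV[C]_n => M 0 j)) => //; exact: differentiable_coord.
Qed.

Lemma hol_mulmx n m (f : C -> 'rV[C]_n) (M : 'M[C]_(n, m)) j z :
  (forall i, hol (fun u => f u 0 i) z) -> hol (fun u => (f u *m M) 0 j) z.
Proof.
move=> hf; apply: (@hol_ext _ (fun u => \sum_i f u 0 i * M i j)).
  by move=> u; rewrite mxE.
apply: (@hol_sum _ _ _ _ (fun i u => f u 0 i * M i j)) => i _.
exact: (holM (hf i) (hol_cst _ _)).
Qed.

Lemma common_order (f1 f2 : C -> C) (r : R) : 0 < r ->
  (forall z, cabs z <= r -> hol f1 z) -> (forall z, cabs z <= r -> hol f2 z) ->
  (exists M, forall z, cabs z <= r -> cabs (f1 z) <= M) ->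
  (exists M, forall z, cabs z <= r -> cabs (f2 z) <= M) ->
  (exists2 z, cabs z < r & (f1 z != 0) || (f2 z != 0)) ->
  exists k (g1 g2 : C -> C), [/\ (g1 0 != 0) || (g2 0 != 0),
    forall z, cabs z < r -> hol g1 z /\ hol g2 z
    & forall z, cabs z < r -> f1 z = z ^+ k * g1 z /\ f2 z = z ^+ k * g2 z].
Proof.
move=> r0 h1 h2 b1 b2 [z0 z0r nz].
have zero (f : C -> C) : (forall z, cabs z < r -> f z = 0) -> forall k z, cabs z < r -> f z = z ^+ k * 0.
  by move=> f0 k z zr; rewrite f0 // mulr0.
have [f10|[k1 [g1 [g10 g1h f1E]]]] := hol_order r0 h1 b1.
  have [f20|[k2 [g2 [g20 g2h f2E]]]] := hol_order r0 h2 b2.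
    by move: nz; rewrite f10 // f20 // eqxx.
  exists k2, (fun=> 0), g2; rewrite g20 orbT; split=> // z zr.
    by split; [exact: hol_cst|apply: g2h; exact: ltW].
  by split => //; exact: zero.
have [f20|[k2 [g2 [g20 g2h f2E]]]] := hol_order r0 h2 b2.
  exists k1, g1, (fun=> 0); rewrite g10; split=> // z zr.
    by split; [apply: g1h; exact: ltW|exact: hol_cst].
  by split => //; exact: zero.
have hX (g : C -> C) n z : hol g z -> hol (fun z => z ^+ n * g z) z.
  by move=> gh; apply: (holM _ gh); exact: (holX _ (hol_id _)).
exists (minn k1 k2), (fun z => z ^+ (k1 - minn k1 k2) * g1 z), (fun z => z ^+ (k2 - minn k1 k2) * g2 z).
split.
- have [k12|k21] := leqP k1 k2.
    by rewrite subnn expr0 mul1r g10.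
  by rewrite subnn expr0 mul1r g20 orbT.
- by move=> z /ltW zr; split; apply: hX; [exact: g1h|exact: g2h].
- move=> z zr; rewrite !mulrA -!exprD f1E f2E.
  by rewrite !subnKC // ?geq_minl ?geq_minr.
Qed.

Lemma cabs_far (x y : C) (e : R) :
  cabs (y - x) < cabs x / 2 -> cabs y < e -> e < cabs x / 2 -> False.
Proof. by move=> h1 h2 h3; have := cabs_le_add x y; rewrite (cabs_subC x); lra. Qed.

(** Puiseux form: in the coordinates [D], whose first axis is tangent to the arc, the image near 0
    is [(w ^+ k, pw w)] with [pw] of order greater than [k]. It describes the image of the whole
    disk of radius [r], since the arc-section is taken over that disk. *)
Definition arc_normal (gamma : C -> 'rV[C]_2) (r : R) (D : 'M[C]_2) k (pw : C -> C) (rho K : R) :=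
  [/\ (0 < k)%N /\ 0 < K, 0 < rho <= 1,
    forall w, cabs w < rho -> hol pw w /\ cabs (pw w) <= K * cabs w ^+ k.+1,
    forall w w', cabs w < rho -> cabs w' < rho -> w ^+ k = w' ^+ k -> pw w = pw w' -> w = w'
  & exists2 del : R, 0 < del & forall y : 'rV[C]_2,
      cabs ((y *m D) 0 0) < del -> cabs ((y *m D) 0 1) < del ->
      (exists2 u, cabs u <= r & gamma u = y) <->
      exists w, [/\ cabs w < rho, (y *m D) 0 0 = w ^+ k & (y *m D) 0 1 = pw w]].

Lemma row2P (x y : 'rV[C]_2) : x 0 0 = y 0 0 -> x 0 1 = y 0 1 -> x = y.
Proof.
move=> h0 h1; apply/rowP => -[[|[|//]] jn].
  by rewrite (_ : Ordinal jn = 0) //; exact: val_inj.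
by rewrite (_ : Ordinal jn = 1) //; exact: val_inj.
Qed.

Variables (gamma : C -> 'rV[C]_2) (r : R).
Hypotheses (r0 : 0 < r) (gd : forall u, cabs u <= r -> differentiable gamma u)
  (g0 : gamma 0 = 0)
  (ginj : forall u u', cabs u <= r -> cabs u' <= r -> gamma u = gamma u' -> u = u').

Let gh j u : cabs u <= r -> hol (fun u => gamma u 0 j) u.
Proof. by move=> ur; apply: hol_coord; exact: gd. Qed.

(** By injectivity the arc does not return to 0, and compactness of the disk makes this uniform. *)
Lemma arc_small_inv (D : 'M[C]_2) (eta : R) : D \in unitmx -> 0 < eta -> exists2 del : R, 0 < del &
  forall u, cabs u <= r -> cabs ((gamma u *m D) 0 0) < del -> cabs ((gamma u *m D) 0 1) < del ->
  cabs u < eta.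
Proof.
move=> uD eta0.
pose Q (e : R) s := cabs s <= r -> cabs ((gamma s *m D) 0 0) < e ->
   cabs ((gamma s *m D) 0 1) < e -> cabs s < eta.
have [|e0 e00 he] := @disk_uniform _ 0 r Q r0.
  move=> s0 _; have [rs|sr] := ltP r (cabs s0).
    exists (cabs s0 - r), 1; split; rewrite ?subr_gt0 //.
    by move=> s ss0 e _ sr; have := cabs_le_add s0 s; rewrite cabs_subC; lra.
  have [sn|sn] := ltP (cabs s0) eta.
    exists (eta - cabs s0), 1; split; rewrite ?subr_gt0 //.
    by move=> s ss0 e _ _ _ _; have := cabs_le_add s s0; lra.
  have nz : gamma s0 != 0.
    apply/eqP => E; have s00 : s0 = 0.
      by apply: ginj => //; [rewrite cabs0 ltW|rewrite g0].
    by rewrite s00 cabs0 leNgt eta0 in sn.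
  have [j nzj] : exists j, (gamma s0 *m D) 0 j != 0.
    apply: contrapT => /forallNP h; case/eqP: nz.
    rewrite -[gamma s0](mulmxK uD) (_ : _ *m D = 0) ?mul0mx //.
    by apply/rowP => j; rewrite [RHS]mxE; apply/eqP; apply: contrapT => /negP; exact: h.
  have hj : hol (fun u => (gamma u *m D) 0 j) s0 by apply: hol_mulmx => i; exact: gh.
  have a2 : 0 < cabs ((gamma s0 *m D) 0 j) / 2 by rewrite divr_gt0 // cabs_gt0.
  have [d d0 hd] := hol_ccont hj a2.
  exists d, (cabs ((gamma s0 *m D) 0 j) / 2); split => // s sd e /andP[e0 ee] _ l0 l1.
  have lj : cabs ((gamma s *m D) 0 j) < e.
    by have [->|->] : j = 0 \/ j = 1 by case: j {nzj hj a2 hd ee} => -[|[|//]] jn;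
      [left|right]; exact: val_inj.
  by case: (cabs_far (hd s sd) lj ee).
exists (e0 / 2); first by rewrite divr_gt0.
move=> u ur; have := he (e0 / 2) _ u; rewrite subr0; apply=> //.
by apply/andP; split; lra.
Qed.
(** [gamma u = u ^+ k *: gv u] with [gv 0 != 0], the tangent. In straightened coordinates the first
    component is [u ^+ k * h u] with [h 0 = 1], and a k-th root of [h] gives the parameter [w = W u]
    whose power [w ^+ k] is this component. The second component is [u ^+ k * q u] with [q 0 = 0],
    which gains one order. *)
Theorem arc_normal_form : exists v D k pw (rho K : R),
  [/\ tangent_vector gamma v, D \in unitmx, v *m D = delta_mx 0 0
    & arc_normal gamma r D k pw rho K].
Proof.
have c0r : cabs (0 : C) <= r by rewrite cabs0 ltW.
have bnd j : exists2 d : R, 0 < d & forall u, cabs u < d -> cabs (gamma u 0 j) <= 1.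
  have [d d0 hd] := hol_ccont (gh j c0r) ltr01.
  exists d => // u ud; have := hd u; rewrite subr0 g0 [X in _ - X]mxE subr0 => h.
  by rewrite ltW // h.
have [d0 d00 hd0] := bnd 0; have [d1 d10 hd1] := bnd 1.
pose r1 := Num.min r (Num.min (d0 / 2) (d1 / 2)).
have r10 : 0 < r1 by rewrite !lt_min r0 !divr_gt0.
have r1r : r1 <= r by rewrite ge_min lexx.
have r1d0 : r1 < d0 by rewrite !gt_min; apply/or3P/Or32; lra.
have r1d1 : r1 < d1 by rewrite !gt_min; apply/or3P/Or33; lra.
clearbody r1.
have [k [ga [gb [gnz gabh gabE]]]] : exists k (ga gb : C -> C),
   [/\ (ga 0 != 0) || (gb 0 != 0), forall z, cabs z < r1 -> hol ga z /\ hol gb z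
    & forall z, cabs z < r1 -> gamma z 0 0 = z ^+ k * ga z /\ gamma z 0 1 = z ^+ k * gb z].
  apply: common_order => //.
  - by move=> z zr; apply: gh; exact: le_trans r1r.
  - by move=> z zr; apply: gh; exact: le_trans r1r.
  - by exists 1 => z zr; apply: hd0; exact: le_lt_trans r1d0.
  - by exists 1 => z zr; apply: hd1; exact: le_lt_trans r1d1.
  have [z z0 zr] := exists_small r10; exists z => //.
  rewrite -negb_and; apply/negP => /andP[/eqP x0 /eqP x1].
  have : z = 0.
    apply: ginj => //; first by apply: le_trans (ltW zr) r1r.
    by rewrite g0; apply: row2P; rewrite [RHS]mxE.
  by move=> zz; rewrite zz cabs0 ltxx in z0.
pose gv u : 'rV[C]_2 := \row_j (if j == 0 then ga u else gb u).
have gv0 u : gv u 0 0 = ga u by rewrite mxE.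
have gv1 u : gv u 0 1 = gb u by rewrite mxE.
have gvE u : cabs u < r1 -> gamma u = u ^+ k *: gv u.
  by move=> /gabE[E0 E1]; apply: row2P; rewrite [RHS]mxE ?gv0 ?gv1.
have gvh j u : cabs u < r1 -> hol (fun u => gv u 0 j) u.
  move=> /gabh[ha hb]; have [->|->] : j = 0 \/ j = 1.
    by case: j => -[|[|//]] jn; [left|right]; exact: val_inj.
  + by apply: hol_ext ha => z; rewrite gv0.
  + by apply: hol_ext hb => z; rewrite gv1.
pose v := gv 0.
have v0 : v != 0.
  by apply: contraTneq gnz => vE; rewrite -gv0 -gv1 -/v vE !mxE eqxx.
have z0r1 : cabs (0 : C) < r1 by rewrite cabs0.
have k0 : (0 < k)%N.
  rewrite lt0n; apply: contraNneq v0 => kz.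
  by have := gvE 0 z0r1; rewrite g0 kz expr0 scale1r /v => <-.
have tv : tangent_vector gamma v.
  split; first exact: v0.
  exists (fun t => t ^- k); move=> U Uv; have [d d_gt0 hd] := (nearV U v).1 Uv.
  suff : nbhs (0 : C) (fun t => t != 0 -> U (t ^- k *: gamma t)) by [].
  apply/nearC.
  have [da da0 hda] := hol_ccont (gvh 0 0 z0r1) d_gt0.
  have [db db0 hdb] := hol_ccont (gvh 1 0 z0r1) d_gt0.
  exists (Num.min r1 (Num.min da db)); first by rewrite !lt_min r10 da0.
  move=> t; rewrite !lt_min => /and3P[tr ta tb] t0; apply: hd => j.
  have tk : t ^+ k != 0 by rewrite expf_neq0.
  have tr' : cabs t < r1 by rewrite subr0 in tr.
  have -> : t ^- k *: gamma t = gv t by rewrite gvE // scalerA mulVf // scale1r.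
  have [->|->] : j = 0 \/ j = 1 by case: j => -[|[|//]] jn; [left|right]; exact: val_inj.
    exact: hda.
  exact: hdb.
have [D uD vD] := straighten v0.
pose h u := (gv u *m D) 0 0; pose q u := (gv u *m D) 0 1.
have hh u : cabs u < r1 -> hol h u by move=> ur; apply: hol_mulmx => i; exact: gvh.
have qh u : cabs u < r1 -> hol q u by move=> ur; apply: hol_mulmx => i; exact: gvh.
have h0 : h 0 = 1 by rewrite /h -/v vD mxE.
have q0 : q 0 = 0 by rewrite /q -/v vD mxE.
have tE u : cabs u < r1 -> (gamma u *m D) 0 0 = u ^+ k * h u.
  by move=> ur; rewrite gvE // -scalemxAl mxE.
have pE u : cabs u < r1 -> (gamma u *m D) 0 1 = u ^+ k * q u.
  by move=> ur; rewrite gvE // -scalemxAl mxE.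
have r12 : 0 < r1 / 2 by rewrite divr_gt0.
have [|q1 q1h q1E] := @hol_divide _ q _ r12.
  by move=> z zr; apply: qh; clra.
have [da' da'0 hda'] := hol_ccont (hh _ z0r1) ltr01.
have z0r12 : cabs (0 : C) <= r1 / 2 by rewrite cabs0 ltW.
have [db' db'0 hdb'] := hol_ccont (q1h _ z0r12) ltr01.
pose r2 := Num.min (r1 / 2) (Num.min da' db').
have r20 : 0 < r2 by rewrite !lt_min r12 da'0.
have r2r1 : r2 <= r1 / 2 by rewrite ge_min lexx.
have r2a : r2 <= da' by rewrite !ge_min lexx orbT.
have r2b : r2 <= db' by rewrite !ge_min lexx !orbT.
clearbody r2.
pose K1 := cabs (q1 0) + 1.
have K10 : 0 < K1 by have := cabs_ge0 (q1 0); rewrite /K1; clra.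
have q1K u : cabs u < r2 -> cabs (q1 u) <= K1.
  move=> ur; have ub : cabs (u - 0) < db' by rewrite subr0; clra.
  by have := hdb' u ub; have := cabs_le_add (q1 u) (q1 0); rewrite /K1; clra.
have hnz u : cabs u < r2 -> h u != 0.
  move=> ur; have ua : cabs (u - 0) < da' by rewrite subr0; clra.
  have := hda' u ua; rewrite h0 -cabs_gt0; have := cabs_le_add 1 (h u).
  by rewrite cabs1 (cabs_subC 1); clra.
have [||rt hrt] := @hol_nth_root _ k h 0 r2 k0 r20.
- by move=> s; rewrite subr0 => sr; apply: hh; clra.
- by move=> s; rewrite subr0; exact: hnz.
have rth u : cabs u < r2 / 4 -> hol rt u /\ rt u ^+ k = h u.
  by move=> ur; apply: hrt; rewrite subr0.
have z0r24 : cabs (0 : C) < r2 / 4 by rewrite cabs0 divr_gt0.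
have rt0 : rt 0 != 0.
  apply/eqP => rtz; have [_] := rth 0 z0r24.
  by rewrite rtz h0 expr0n gtn_eqF // => /esym/eqP; rewrite oner_eq0.
pose W u := u * rt u.
have r28 : 0 < r2 / 8 by rewrite divr_gt0.
have [|s [K2 [om [s_gt0 K20 omE [s1 s10 hs1]]]]] := @local_inverse _ W rt _ r28 _ rt0 (fun=> erefl).
  by move=> u ur; have [] := rth u _ => //; clra.
pose rho := Num.min (Num.min s 1) (r2 / 8 / K2).
have rho0 : 0 < rho by rewrite !lt_min s_gt0 ltr01 divr_gt0.
have rho1 : rho <= 1 by rewrite !ge_min lexx orbT.
have rhos : rho <= s by rewrite !ge_min lexx.
have rhoK : rho <= r2 / 8 / K2 by rewrite ge_min lexx orbT.
clearbody rho.
have [r28r r28r1 r284 r28r2] : [/\ r2 / 8 <= r, r2 / 8 < r1, r2 / 8 < r2 / 4 & r2 / 8 < r2] by split; lra.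
have omr w : cabs w < rho -> cabs (om w) <= r2 / 8.
  move=> wr; have [_ _ h1] := omE w (lt_le_trans wr rhos); apply: le_trans h1 _.
  by rewrite mulrC -ler_pdivlMr // (le_trans (ltW wr)).
pose pw w := (gamma (om w) *m D) 0 1.
have tom w : cabs w < rho -> (gamma (om w) *m D) 0 0 = w ^+ k.
  move=> wr; have omw := omr w wr; rewrite tE; last exact: le_lt_trans omw r28r1.
  have [|_ <-] := rth (om w); first exact: le_lt_trans omw r284.
  have [_ E _] := omE w (lt_le_trans wr rhos).
  by rewrite -exprMn -/(W (om w)) E.
have unD (x y : 'rV[C]_2) : (x *m D) 0 0 = (y *m D) 0 0 -> (x *m D) 0 1 = (y *m D) 0 1 -> x = y.
  by move=> e0 e1; rewrite -(mulmxK uD x) (row2P e0 e1) mulmxK.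
exists v, D, k, pw, rho, (K2 ^+ k.+1 * K1); split; [exact: tv|exact: uD|exact: vD|split].
- by rewrite mulr_gt0 // exprn_gt0.
- by rewrite rho0.
- move=> w wr; have omw := omr w wr; have ws := lt_le_trans wr rhos.
  have [omh _ omK] := omE w ws; split.
    apply: (@hol_comp _ om (fun u => (gamma u *m D) 0 1)) => //.
    by apply: hol_mulmx => i; exact: (gh i (le_trans omw r28r)).
  rewrite /pw pE; last exact: le_lt_trans omw r28r1.
  have -> : om w ^+ k * q (om w) = om w ^+ k.+1 * q1 (om w).
    by rewrite q1E q0 add0r mulrA -exprSr.
  rewrite cabsM cabsX mulrAC; apply: ler_pM; rewrite ?exprn_ge0 ?cabs_ge0 //.
    by rewrite -exprMn; apply: lerXn2r; rewrite ?nnegrE ?cabs_ge0 // mulr_ge0 ?cabs_ge0 // ltW.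
  exact: q1K (le_lt_trans omw r28r2).
- move=> w w' wr wr' tt pp; have ww : om w = om w'.
    apply: ginj; [exact: le_trans (omr w wr) r28r|exact: le_trans (omr w' wr') r28r|].
    by apply: unD; [rewrite !tom|exact: pp].
  have [_ E _] := omE w (lt_le_trans wr rhos).
  by have [_ E' _] := omE w' (lt_le_trans wr' rhos); rewrite -E -E' ww.
have Wh : hol W 0 by apply: (holM (hol_id _)); have [] := rth 0 z0r24.
have [eta eta0 heta] := hol_ccont Wh rho0.
have e0 : 0 < Num.min (Num.min eta s1) (r2 / 8) by rewrite !lt_min eta0 s10.
have [del del0 hdel] := arc_small_inv uD e0.
exists del => // y y0 y1; split.
  move=> [u ur uy]; rewrite -uy in y0 y1 *.
  have := hdel u ur y0 y1; rewrite !lt_min => /andP[/andP[ueta us1] u8].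
  have [_ oW] := hs1 u us1.
  have Wr : cabs (W u) < rho by have := heta u; rewrite subr0 [W 0]mul0r subr0; exact.
  by exists (W u); split; [exact: Wr|rewrite -(tom _ Wr) oW|rewrite /pw oW].
move=> [w [wr t p]]; exists (om w); first exact: le_trans (omr w wr) r28r.
by apply: unD; [rewrite tom // t|rewrite p].
Qed.

End ArcNormalForm.

Lemma third_lt (R : realFieldType) (m : R) : 0 < m -> m / 3 < 2 / 3 * m.
Proof. by lra. Qed.

(** * Tangent cone of a hypersurface whose leading form is a product of linear forms *)

Section TangentCone.
Context {R : realType}.
Local Notation C := (Cplx R).
Local Notation "x %:CC" := ((x : R)%:C%C : C) (at level 2, format "x %:CC").

Definition vsum n (x : 'rV[C]_n) : R := \sum_j cabs (x 0 j).

Lemma vsum_ge0 n (x : 'rV[C]_n) : 0 <= vsum x.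
Proof. by apply: sumr_ge0 => j _; exact: cabs_ge0. Qed.

Lemma vsumD n (x y : 'rV[C]_n) : vsum (x + y) <= vsum x + vsum y.
Proof.
by rewrite /vsum -big_split; apply: ler_sum => j _; rewrite mxE; exact: cabsD.
Qed.

Lemma vsumZ n (c : C) (x : 'rV[C]_n) : vsum (c *: x) = cabs c * vsum x.
Proof. by rewrite /vsum mulr_sumr; apply: eq_bigr => j _; rewrite mxE cabsM. Qed.

Lemma coord_le_vsum n (x : 'rV[C]_n) j : cabs (x 0 j) <= vsum x.
Proof.
by rewrite /vsum (bigD1 j) //= lerDl sumr_ge0 // => i _; exact: cabs_ge0.
Qed.

Lemma vsum_le n (x : 'rV[C]_n) (e : R) : (forall j, cabs (x 0 j) < e) -> vsum x <= n%:R * e.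
Proof.
move=> h; apply: (@le_trans _ _ (\sum_(j < n) e)).
  by apply: ler_sum => j _; exact: ltW.
by rewrite sumr_const card_ord mulr_natl.
Qed.

Lemma coord_mulmx_le m n (M : 'M[C]_(m, n)) : exists2 K : R, 0 <= K &
  forall x j, cabs ((x *m M) 0 j) <= K * vsum x.
Proof.
pose K : R := \sum_i \sum_j cabs (M i j).
have nn i : 0 <= \sum_j cabs (M i j) by apply: sumr_ge0 => j _; exact: cabs_ge0.
exists K; first by apply: sumr_ge0.
move=> x j; rewrite mxE; apply: le_trans (cabs_sum _ _ _) _; rewrite /vsum mulr_sumr.
apply: ler_sum => i _; rewrite cabsM mulrC; apply: ler_wpM2r; first exact: cabs_ge0.
apply: (@le_trans _ _ (\sum_j cabs (M i j))).
  by rewrite (bigD1 j) //= lerDl sumr_ge0 // => l _; exact: cabs_ge0.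
by rewrite /K (bigD1 i) //= lerDl sumr_ge0.
Qed.

Lemma hol_affine n (f : 'rV[C]_n -> C) (x u : 'rV[C]_n) z :
  differentiable f (x + z *: u) -> hol (fun z => f (x + z *: u)) z.
Proof.
move=> hf; split; apply: (@differentiable_comp _ _ _ _ (fun z : C => x + z *: u) f) => //.
Qed.

Lemma avoid_reals (s : seq R) (d : R) : 0 < d -> exists2 e : R, 0 < e < d & e \notin s.
Proof.
move=> d0; have [d' d'0 hd] := punctured_notin [seq x%:CC | x <- s] 0.
have m0 : 0 < Num.min d d' by rewrite lt_min d0.
have [m1 m2] : Num.min d d' <= d /\ Num.min d d' <= d' by rewrite !ge_min !lexx orbT.
exists (Num.min d d' / 2); first by apply/andP; split; lra.
have e0 : 0 < Num.min d d' / 2 by lra.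
apply/negP => es.
have : (Num.min d d' / 2)%:CC \notin [seq x%:CC | x <- s].
  by apply: hd; rewrite ?subr0 -?cabs_gt0 cabsR gtr0_norm //; lra.
by rewrite map_f.
Qed.

(** On the moment curve [(1, s, s ^+ 2)] a nonzero linear form is a nonzero polynomial in [s], so it
    has finitely many zeros there. *)
Lemma avoid_hyperplanes (ls : seq 'cV[C]_3) : (forall l, l \in ls -> l != 0) ->
  exists u : 'rV[C]_3, forall l, l \in ls -> (u *m l) 0 0 != 0.
Proof.
move=> ls0; pose q (l : 'cV[C]_3) : {poly C} := \poly_(i < 3) l (inord i) 0.
have q0 l : l \in ls -> q l != 0.
  move=> /ls0; apply: contra_neq => ql; apply/colP => i.
  have : (q l)`_i = 0 by rewrite ql coef0.
  by rewrite coef_poly ltn_ord inord_val mxE.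
have P0 : \prod_(l <- ls) q l != 0.
  by rewrite prodf_seq_neq0; apply/allP => l /q0.
have [s _ sP] := nonroot_near0 P0 ltr01.
exists (\row_i s ^+ i) => l ll.
have -> : ((\row_(i < 3) s ^+ i) *m l) 0 0 = (q l).[s].
  rewrite mxE horner_poly; apply: eq_bigr => i _.
  by rewrite mxE inord_val mulrC.
apply: contraNneq sP => ql; rewrite horner_prod prodf_seq_eq0.
by apply/hasP; exists l => //=; rewrite ql.
Qed.

Definition form_prod (ls : seq 'cV[C]_3) (x : 'rV[C]_3) : C := \prod_(l <- ls) (x *m l) 0 0.

Lemma form_prodZ ls (c : C) x : form_prod ls (c *: x) = c ^+ size ls * form_prod ls x.
Proof.
rewrite /form_prod; elim: ls => [|l ls IH] /=; first by rewrite !big_nil mulr1.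
by rewrite !big_cons IH -scalemxAl mxE exprS; ring.
Qed.

Lemma differentiable_mulmx n (M : 'M[C]_(3, n)) j v :
  differentiable (fun x : 'rV[C]_3 => (x *m M) 0 j) v.
Proof.
rewrite (_ : (fun _ => _) = (fun x : 'rV[C]_3 => \sum_(i < 3) x 0 (inord i) * M (inord i) j)).
  apply: (@diff_sum _ _ 3 (fun i (x : 'rV[C]_3) => x 0 (inord i) * M (inord i) j)) => i _.
  by apply: differentiable_mul; [exact: differentiable_coord|exact: differentiable_cst].
by apply: funext => x; rewrite mxE; apply: eq_bigr => i _; rewrite inord_val.
Qed.

Lemma form_prod_continuous ls (v : 'rV[C]_3) (e : R) : 0 < e -> exists2 d : R, 0 < d &
  forall x, (forall j, cabs ((x - v) 0 j) < d) -> cabs (form_prod ls x - form_prod ls v) < e.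
Proof.
move=> e0.
have hp : differentiable (form_prod ls) v.
  elim: ls => [|l ls IH].
    rewrite (_ : form_prod _ = fun=> 1); first exact: differentiable_cst.
    by apply: funext => x; rewrite /form_prod big_nil.
  rewrite (_ : form_prod _ = fun x => (x *m l) 0 0 * form_prod ls x).
    by apply: differentiable_mul => //; exact: differentiable_mulmx.
  by apply: funext => x; rewrite /form_prod big_cons.
have hs : differentiable (fun x => form_prod ls x - form_prod ls v) v.
  by apply: differentiableB => //; exact: differentiable_cst.
have := @near_small _ _ _ v (differentiable_continuous hs) (subrr _) _ e0.
by move=> /nearV[d d0 hd]; exists d => // x xd; apply: hd => j; have := xd j; rewrite !mxE.
Qed.

Section LeadingForm.
Variables (Phi : 'rV[C]_3 -> C) (X : set 'rV[C]_3) (ls : seq 'cV[C]_3) (kap : C) (K del : R).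
Let n := size ls.
Hypotheses (Phih : holomorphic_germ Phi) (XE : germ_eq X [set x | Phi x = 0])
  (ls0 : forall l, l \in ls -> l != 0) (n0 : (0 < n)%N) (kap0 : kap != 0) (K0 : 0 <= K) (del0 : 0 < del)
  (lead : forall x, vsum x < del ->
    cabs (Phi x - kap * form_prod ls x) <= K * vsum x ^+ n.+1).

(** By homogeneity, for [x] in [X] the modulus of [form_prod ls (c *: x)] is at most a constant
    times [(cabs c * vsum x) ^+ n * vsum x]; near [v] the power stays bounded, and the last factor
    tends to 0. *)
Lemma tangent_cone_sub v : tangent_cone X v -> form_prod ls v = 0.
Proof.
rewrite (tangent_cone_germ XE) => /(tangent_coneP _ _ (unitmx1 _ _)) h.
apply: cabs_small0 => e e0.
have e2 : 0 < e / 2 by rewrite divr_gt0.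
have [d d0 hd] := form_prod_continuous ls v e2.
pose V := vsum v + 3; have V0 : 0 < V by have := vsum_ge0 v; rewrite /V; lra.
have kap1 : 0 < cabs kap by rewrite cabs_gt0.
pose B := K * V ^+ n / cabs kap + 1.
have B0 : 0 < B by rewrite /B ltr_wpDl // divr_ge0 ?mulr_ge0 ?exprn_ge0 // ltW.
pose g := Num.min (Num.min d 1) (Num.min (del / 4) (e / (8 * B))).
have g0 : 0 < g by rewrite !lt_min d0 ltr01 !divr_gt0 // mulr_gt0.
have gd : g <= d by rewrite !ge_min lexx.
have g1 : g <= 1 by rewrite !ge_min lexx orbT.
have gdel : g <= del / 4 by rewrite !ge_min lexx !orbT.
have ge : g <= e / (8 * B) by rewrite !ge_min lexx !orbT.
clearbody g.
have [x [c [/= Px xg xv]]] := h g g0; rewrite !mulmx1 in xg xv.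
have xs : vsum x <= 3 * g by have := vsum_le xg.
have cx : vsum (c *: x) <= V.
  have -> : c *: x = v + (c *: x - v) by rewrite addrC subrK.
  apply: le_trans (vsumD _ _) _; rewrite /V lerD2l.
  by have := vsum_le xv; lra.
have xdel : vsum x < del by lra.
have := lead xdel; rewrite Px sub0r cabsN cabsM => L.
have PK : cabs (form_prod ls (c *: x)) <= e / 2.
  rewrite form_prodZ cabsM cabsX -/n.
  have cx' : (cabs c * vsum x) ^+ n <= V ^+ n.
    by apply: lerXn2r; rewrite ?nnegrE ?mulr_ge0 ?cabs_ge0 ?vsum_ge0 ?(ltW V0) // -vsumZ.
  have L' : cabs (form_prod ls x) <= K * vsum x ^+ n.+1 / cabs kap.
    by rewrite ler_pdivlMr // mulrC.
  apply: (@le_trans _ _ (cabs c ^+ n * (K * vsum x ^+ n.+1 / cabs kap))).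
    by apply: ler_wpM2l => //; rewrite exprn_ge0 ?cabs_ge0.
  have -> : cabs c ^+ n * (K * vsum x ^+ n.+1 / cabs kap) =
      (cabs c * vsum x) ^+ n * (K / cabs kap) * vsum x by rewrite exprMn exprS; ring.
  apply: (@le_trans _ _ (B * (3 * g))).
    apply: ler_pM => //; rewrite ?vsum_ge0 //.
      by rewrite mulr_ge0 ?divr_ge0 ?exprn_ge0 ?mulr_ge0 ?cabs_ge0 ?vsum_ge0.
    apply: (@le_trans _ _ (V ^+ n * (K / cabs kap))).
      by apply: ler_wpM2r => //; rewrite divr_ge0 ?cabs_ge0.
    by rewrite /B mulrCA mulrA; clra.
  by move: ge; rewrite ler_pdivlMr ?mulr_gt0 //; clra.
have xvd j : cabs ((c *: x - v) 0 j) < d by apply: lt_le_trans (xv j) gd.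
have := hd _ xvd; have := cabs_le_add (form_prod ls v) (form_prod ls (c *: x)).
by rewrite (cabs_subC (form_prod ls v)); clra.
Qed.

(** Hurwitz's argument on the line [v + z *: u], with [u] on none of the hyperplanes:
    [Phi (s (v + z u)) / s ^+ n] is close to [h z], which vanishes at 0 but not on the circle of
    radius [ep]. Without a zero in the disk, the maximum principle for the inverse would fail at the
    centre. *)
Lemma tangent_cone_sup v : form_prod ls v = 0 -> tangent_cone X v.
Proof.
move=> Pv; rewrite (tangent_cone_germ XE); apply/(tangent_coneP _ _ (unitmx1 _ _)) => e e0.
have [u hu] := avoid_hyperplanes ls0.
have [rho rho0 hrho] := (nearV _ _).1 Phih.
pose V := vsum v + vsum u + 1.
have V1 : 1 <= V by have := vsum_ge0 v; have := vsum_ge0 u; rewrite /V; lra.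
have Vu : vsum u <= V by have := vsum_ge0 v; rewrite /V; lra.
pose ze (l : 'cV[C]_3) := - (v *m l) 0 0 / (u *m l) 0 0.
have eV : 0 < Num.min 1 (e / V) by rewrite lt_min ltr01 divr_gt0 //; lra.
have [ep /andP[ep0 epe] epn] := avoid_reals [seq cabs (ze l) | l <- ls] eV.
have ep1 : ep < 1 by move: epe; rewrite lt_min => /andP[].
have epV : ep * V < e.
  by move: epe; rewrite lt_min => /andP[_]; rewrite ltr_pdivlMr //; lra.
(* The zeros of [h] below are the [ze l]; [ep] avoids their moduli, so [m] is a positive lower bound
   of [cabs (h z)] on the circle. *)
pose m := cabs kap * \prod_(l <- ls) (cabs ((u *m l) 0 0) * `|ep - cabs (ze l)|).
have m0 : 0 < m.
  apply: mulr_gt0; first by rewrite cabs_gt0.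
  rewrite big_seq; apply: prodr_gt0 => l ll; apply: mulr_gt0; first by rewrite cabs_gt0 hu.
  rewrite normr_gt0 subr_eq0; apply: contraNneq epn => ->; exact: map_f.
pose h z := kap * form_prod ls (v + z *: u).
have hlow z : cabs z = ep -> m <= cabs (h z).
  move=> zep; rewrite /h cabsM ler_pM2l ?cabs_gt0 // /form_prod cabs_prod.
  rewrite big_seq [leRHS]big_seq; apply: ler_prod => l ll; rewrite mulr_ge0 ?cabs_ge0 //=.
  have -> : ((v + z *: u) *m l) 0 0 = (u *m l) 0 0 * (z - ze l).
    rewrite mulmxDl -scalemxAl !mxE /ze -/(mulmx _ _) !mxE.
    by field; have := hu l ll; rewrite mxE.
  rewrite cabsM ler_pM2l ?cabs_gt0 ?hu // -zep ler_norml.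
  have := cabs_le_add z (ze l); have := cabs_le_add (ze l) z; rewrite (cabs_subC (ze l)).
  by move=> h1 h2; apply/andP; split; [rewrite lerNl opprB lerBlDl|rewrite lerBlDl].
have KV : 0 < K * V ^+ n.+1 + 1 by rewrite ltr_wpDl // mulr_ge0 // exprn_ge0 //; lra.
(* For this [s] the remainder is at most [s ^+ n * (m / 3)]: [Phi] is at least [s ^+ n] times two
   thirds of [m] on the circle, and at most one third at the centre. *)
pose s := Num.min (Num.min rho del) (Num.min e (m / 3 / (K * V ^+ n.+1 + 1))) / (2 * V).
have V20 : 0 < 2 * V by lra.
have s0 : 0 < s by rewrite !(divr_gt0, lt_min) ?rho0 ?del0 ?e0 // m0.
have sV (x : R) : Num.min (Num.min rho del) (Num.min e (m / 3 / (K * V ^+ n.+1 + 1))) <= x ->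
    0 < x -> s * V < x.
  move=> mx x0; apply: (@le_lt_trans _ _ (x / 2)); last by lra.
  have : s * (2 * V) <= x by rewrite /s divfK ?gt_eqF.
  by clra.
have srho : s * V < rho by apply: sV => //; rewrite !ge_min lexx.
have sdel : s * V < del by apply: sV => //; rewrite !ge_min lexx orbT.
have se : s * V < e by apply: sV => //; rewrite !ge_min lexx !orbT.
have sm : s * (K * V ^+ n.+1) <= m / 3.
  have : s * V < m / 3 / (K * V ^+ n.+1 + 1).
    by apply: sV; [rewrite !ge_min lexx !orbT|rewrite !divr_gt0].
  rewrite ltr_pdivlMr // => h1.
  have KV0 : 0 <= K * V ^+ n.+1 by rewrite mulr_ge0 // exprn_ge0 //; clra.
  have : s * (K * V ^+ n.+1) <= s * V * (K * V ^+ n.+1 + 1).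
    by rewrite -mulrA ler_pM2l //; nra.
  by clra.
clearbody s.
have cs : cabs s%:CC = s by rewrite cabsR gtr0_norm.
pose x z := s%:CC *: v + z *: (s%:CC *: u).
have xE z : x z = s%:CC *: (v + z *: u) by rewrite /x scalerDr !scalerA mulrC.
have xV z : cabs z <= ep -> vsum (x z) <= s * V.
  move=> zep; rewrite xE vsumZ cs ler_pM2l //.
  apply: le_trans (vsumD _ _) _; rewrite vsumZ.
  have : cabs z * vsum u <= 1 * vsum u by apply: ler_wpM2r; [exact: vsum_ge0|clra].
  by rewrite /V; clra.
have xh z : cabs z <= ep -> hol (fun z => Phi (x z)) z.
  move=> zep; apply: hol_affine; apply: hrho => j; rewrite [(0 : 'rV_3) _ _]mxE subr0.
  exact: le_lt_trans (coord_le_vsum _ _) (le_lt_trans (xV _ zep) srho).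
have approx z : cabs z <= ep -> cabs (Phi (x z) - s%:CC ^+ n * h z) <= s ^+ n * (m / 3).
  move=> zep; have xd := le_lt_trans (xV _ zep) sdel.
  have -> : s%:CC ^+ n * h z = kap * form_prod ls (x z) by rewrite xE form_prodZ /h mulrCA.
  apply: le_trans (lead xd) _.
  apply: (@le_trans _ _ (K * (s * V) ^+ n.+1)).
    apply: ler_wpM2l => //; apply: lerXn2r; rewrite ?nnegrE ?vsum_ge0 ?xV //.
    by rewrite mulr_ge0 ?(ltW s0) // (le_trans ler01 V1).
  have -> : K * (s * V) ^+ n.+1 = s ^+ n * (s * (K * V ^+ n.+1)) by rewrite exprMn exprS; ring.
  by rewrite ler_pM2l // exprn_gt0.
have sn0 : 0 < s ^+ n by rewrite exprn_gt0.
have [z zep zz] : exists2 z, cabs z <= ep & Phi (x z) = 0.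
  apply: contrapT => no.
  have nz z : cabs z <= ep -> Phi (x z) != 0.
    by move=> zep; apply/eqP => E; apply: no; exists z.
  have z0 : cabs (0 : C) <= ep by rewrite cabs0 ltW.
  have := @maximum_principle _ (fun z => (Phi (x z))^-1) 0 ep (s ^+ n * (2 / 3 * m))^-1 _ _ 0.
  have b0 : 0 < s ^+ n * (2 / 3 * m) by rewrite mulr_gt0 //; clra.
  rewrite subrr cabsV lef_pV2 ?posrE ?cabs_gt0 ?nz // => mp.
  have : s ^+ n * (2 / 3 * m) <= cabs (Phi (x 0)).
    apply: mp; last exact: z0.
      by move=> z; rewrite subr0 => zep; apply: holV; [exact: xh|exact: nz].
    move=> z; rewrite subr0 => zep; have zep' : cabs z <= ep by rewrite zep.
    rewrite cabsV lef_pV2 ?posrE ?cabs_gt0 ?nz //.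
    have := approx z zep'; have := cabs_le_add (s%:CC ^+ n * h z) (Phi (x z)).
    rewrite cabs_subC [cabs (s%:CC ^+ n * h z)]cabsM cabsX cs.
    have : s ^+ n * m <= s ^+ n * cabs (h z) by rewrite ler_pM2l // hlow.
    by clra.
  have := approx 0 z0; rewrite /h scale0r addr0 Pv mulr0 mulr0 subr0.
  move=> up low; have := le_trans low up.
  by rewrite ler_pM2l // leNgt third_lt.
exists (x z), (s%:CC)^-1; rewrite !mulmx1; split => // j.
  exact: le_lt_trans (coord_le_vsum _ _) (le_lt_trans (xV _ zep) se).
have -> : (s%:CC)^-1 *: x z - v = z *: u.
  by rewrite xE scalerA mulVf ?scale1r ?(addrC v) ?addrK // -cabs_gt0 cs.
apply: le_lt_trans (coord_le_vsum _ _) _; rewrite vsumZ.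
apply: le_lt_trans epV; apply: ler_pM; rewrite ?cabs_ge0 ?vsum_ge0 //.
Qed.

Theorem tangent_cone_leading_form : line_or_union_of_lines (proj_tangent_cone X).
Proof.
have nn : n.-1.+1 = n by rewrite prednK.
have ltn (i : 'I_n.-1.+1) : (i < size ls)%N by apply: leq_trans (ltn_ord i) _; rewrite nn.
exists n.-1, (fun i => nth 0 ls i); split.
  by move=> i; apply: ls0; exact: mem_nth.
apply/seteqP; split => [v [v0 /tangent_cone_sub/eqP]|v [i [v0 vl]]].
  rewrite prodf_seq_eq0 => /hasP[l ll /= /eqP vl].
  have ln : (index l ls < n.-1.+1)%N by rewrite nn index_mem.
  exists (Ordinal ln); split => //=; rewrite nth_index //.
  by apply/matrixP => a b; rewrite !ord1 vl mxE.
split => //; apply: tangent_cone_sup; apply/eqP; rewrite prodf_seq_eq0; apply/hasP.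
exists (nth 0 ls i); first exact: mem_nth.
by rewrite /= vl mxE.
Qed.

End LeadingForm.
End TangentCone.

(** * Leading forms of surfaces *)

Section Centered.
Context {R : realType}.
Local Notation C := (Cplx R).

(* Tschirnhaus: translating by the mean of the roots kills the coefficient of
   degree d - 1. *)
Definition centered d (p : {poly C}) : {poly C} := p \Po ('X - (p`_d.-1 / d%:R)%:P).

Lemma horner_centered d p z : (centered d p).[z] = p.[z - p`_d.-1 / d%:R].
Proof. by rewrite /centered horner_comp !hornerE. Qed.

Lemma monicd_centered d p : monicd d p -> monicd d (centered d p).
Proof.
move=> [pm sp]; split; last by rewrite size_comp_poly2 // size_XsubC.
apply/monicP; rewrite lead_coef_comp ?size_XsubC // (monicP pm).
by rewrite lead_coefXsubC expr1n mulr1.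
Qed.

Lemma coef_centered d p : (0 < d)%N -> monicd d p -> (centered d p)`_d.-1 = 0.
Proof.
move=> d0 /[dup] /monicd_prod[rs srs pE] mp.
have h (s : seq C) : size s = d -> (\prod_(z <- s) ('X - z%:P))`_d.-1 = - \sum_(z <- s) z.
  by move=> ss; rewrite -{1}ss coefPn_prod_XsubC // ss -lt0n.
set b := p`_d.-1 / d%:R.
have cE : centered d p = \prod_(z <- [seq z + b | z <- rs]) ('X - z%:P).
  rewrite /centered -/b {1}pE rmorph_prod big_map; apply: eq_bigr => z _ /=.
  by rewrite comp_polyB comp_polyX comp_polyC polyCD opprD addrA addrAC.
rewrite cE h ?size_map // big_map big_split /= big_const_seq count_predT iter_addr_0.
have -> : \sum_(z <- rs) z = - p`_d.-1 by rewrite {1}pE h // opprK.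
rewrite srs -(mulr_natr b) /b divfK ?pnatr_eq0 -?lt0n ?addNr ?oppr0 //.
Qed.

Lemma separable_centered d p : separable_poly p -> separable_poly (centered d p).
Proof.
move=> /separableP h; apply/separableP => x.
rewrite /root horner_centered => /h.
by rewrite /centered deriv_comp derivXsubC mulr1 horner_comp !hornerE.
Qed.

Lemma centeredXn d : (0 < d)%N -> centered d 'X^d = 'X^d.
Proof.
by move=> d0; rewrite /centered coefXn ltn_eqF ?prednK // mul0r subr0 comp_polyXr.
Qed.

Lemma gpoly_coef d (p : {poly C}) : monicd d p -> gpoly d (fun i => p`_i) = p.
Proof.
move=> [pm sp]; apply/polyP => i; rewrite coef_poly.
have [->|id] := eqVneq i d; first by rewrite ltnSn -(monicP pm) lead_coefE sp.
case: ltnP => // di; first by rewrite nth_default // sp.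
Qed.

End Centered.

Section HolomorphicGerms.
Context {R : realType}.
Local Notation C := (Cplx R).
Variable V : normedModType C.

Lemma holomorphic_germ_all (f : V -> C) : (forall y, differentiable f y) -> holomorphic_germ f.
Proof. exact: filterE. Qed.

Lemma holomorphic_germ_cst (x : C) : holomorphic_germ (fun _ : V => x).
Proof. by apply: holomorphic_germ_all => y; exact: differentiable_cst. Qed.

Lemma holomorphic_germD (f g : V -> C) : holomorphic_germ f -> holomorphic_germ g ->
  holomorphic_germ (fun y => f y + g y).
Proof. by apply: filterS2 => y; exact: differentiableD. Qed.

Lemma holomorphic_germM (f g : V -> C) : holomorphic_germ f -> holomorphic_germ g ->
  holomorphic_germ (fun y => f y * g y).
Proof. by apply: filterS2 => y; exact: differentiableM. Qed.

Lemma holomorphic_germ_ext (f g : V -> C) : (forall y, f y = g y) ->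
  holomorphic_germ f -> holomorphic_germ g.
Proof. by move=> /funext ->. Qed.

Lemma holomorphic_germ_sum n (F : nat -> V -> C) : (forall i, holomorphic_germ (F i)) ->
  holomorphic_germ (fun y => \sum_(i < n) F i y).
Proof.
exact: (class_sum holomorphic_germ_cst holomorphic_germD holomorphic_germ_ext).
Qed.

Lemma holomorphic_germX (f : V -> C) n : holomorphic_germ f -> holomorphic_germ (fun y => f y ^+ n).
Proof. by apply: filterS => y; exact: differentiable_pow. Qed.

Lemma coefs_centered d (G : V -> {poly C}) : (forall y, monicd d (G y)) ->
  (forall i, holomorphic_germ (fun y => (G y)`_i)) ->
  forall i, holomorphic_germ (fun y => (centered d (G y))`_i).
Proof.
move=> Gm Gh i.
pose b y := (G y)`_d.-1 / d%:R.
have bh j : holomorphic_germ (fun y => ('X - (b y)%:P)`_j).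
  apply: (@holomorphic_germ_ext (fun y => 'X`_j + (if j == 0%N then -1 else 0) * (b y))).
    by move=> y; rewrite coefB coefC; case: (j == 0%N); rewrite ?mulN1r ?mul0r ?subr0 ?addr0.
  apply: holomorphic_germD; first exact: holomorphic_germ_cst.
  apply: holomorphic_germM; first exact: holomorphic_germ_cst.
  by apply: holomorphic_germM; [exact: Gh|exact: holomorphic_germ_cst].
have ph n j : holomorphic_germ (fun y => (('X - (b y)%:P) ^+ n)`_j).
  elim: n j => [|n IH] j.
    by apply: (@holomorphic_germ_ext (fun y => (1 : {poly C})`_j)) => //; exact: holomorphic_germ_cst.
  apply: (@holomorphic_germ_ext (fun y => (('X - (b y)%:P) * ('X - (b y)%:P) ^+ n)`_j)).
    by move=> y; rewrite exprS.
  exact: (coefs_inM holomorphic_germ_cst holomorphic_germD holomorphic_germM holomorphic_germ_ext bh IH).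
apply: (@holomorphic_germ_ext (fun y => \sum_(n < d.+1) (G y)`_n * (('X - (b y)%:P) ^+ n)`_i)).
  move=> y; have [_ sG] := Gm y; rewrite /centered -/(b y) comp_polyE sG coef_sum.
  by apply: eq_bigr => n _; rewrite coefZ.
apply: (@holomorphic_germ_sum d.+1 (fun n y => (G y)`_n * (('X - (b y)%:P) ^+ n)`_i)) => n.
by apply: holomorphic_germM; [exact: Gh|exact: ph].
Qed.

End HolomorphicGerms.

Section PlaneCoordinates.
Context {R : realType}.
Local Notation C := (Cplx R).
Variable D : 'M[C]_2.
Hypothesis uD : D \in unitmx.

Definition row2 (t p : C) : 'rV[C]_2 := \row_j (if j == 0 then t else p).
Definition plane_pt (t p : C) : 'rV[C]_2 := row2 t p *m invmx D.

Lemma plane_ptK t p : plane_pt t p *m D = row2 t p.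
Proof. by rewrite /plane_pt mulmxKV. Qed.

Lemma plane_ptE y : plane_pt ((y *m D) 0 0) ((y *m D) 0 1) = y.
Proof.
by rewrite /plane_pt -[RHS](mulmxK uD); congr (_ *m _); apply: row2P; rewrite mxE.
Qed.

Lemma plane_pt_affl t p : plane_pt t p = plane_pt 0 p + t *: plane_pt 1 0.
Proof.
rewrite /plane_pt scalemxAl -mulmxDl; congr (_ *m _).
by apply: row2P; rewrite !mxE /= ?mulr1 ?mulr0 ?add0r ?addr0.
Qed.

Lemma plane_pt_affr t p : plane_pt t p = plane_pt t 0 + p *: plane_pt 0 1.
Proof.
rewrite /plane_pt scalemxAl -mulmxDl; congr (_ *m _).
by apply: row2P; rewrite !mxE /= ?mulr1 ?mulr0 ?add0r ?addr0.
Qed.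

Lemma plane_pt_lin t p : plane_pt t p = t *: plane_pt 1 0 + p *: plane_pt 0 1.
Proof.
rewrite /plane_pt !scalemxAl -mulmxDl; congr (_ *m _).
by apply: row2P; rewrite !mxE /= ?mulr1 ?mulr0 ?add0r ?addr0.
Qed.

Lemma plane_pt00 : plane_pt 0 0 = 0.
Proof.
rewrite /plane_pt (_ : row2 0 0 = 0) ?mul0mx //.
by apply: row2P; rewrite !mxE.
Qed.

Lemma plane_pt_small (U : set 'rV[C]_2) : nbhs (0 : 'rV[C]_2) U -> exists2 r : R, 0 < r &
  forall t p, cabs t <= r -> cabs p <= r -> U (plane_pt t p).
Proof.
move=> /nearV[d d0 hd]; have [d' d'0 hd'] := mulmx_small (invmx D) d0.
exists (d' / 2); first by rewrite divr_gt0.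
move=> t p tr pr; apply: hd => j; rewrite [(0 : 'rV_2) _ _]mxE subr0; apply: hd' => i.
by rewrite mxE; case: (i == 0); lra.
Qed.

Lemma bihol_germ (f : 'rV[C]_2 -> C) : holomorphic_germ f -> exists r M : R, 0 < r /\
  bihol r M (fun t p => f (plane_pt t p)).
Proof.
move=> fh; have f0 := differentiable_continuous (nbhs_singleton fh).
have fs : \forall y \near (0 : 'rV[C]_2), cabs (f y - f 0) < 1.
  have : differentiable (fun y => f y - f 0) 0.
    by apply: differentiableB; [exact: nbhs_singleton fh|exact: differentiable_cst].
  by move=> /differentiable_continuous hc; apply: near_small hc _ _ ltr01; rewrite subrr.
have [r r0 hr] := plane_pt_small (filterI fh fs).
exists r, (cabs (f 0) + 1); split; [exact: r0|move=> t p tr pr].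
have [fd fb] := hr t p tr pr; split.
- apply: (@hol_ext _ (fun x => f (plane_pt 0 p + x *: plane_pt 1 0))).
    by move=> x; rewrite -plane_pt_affl.
  by apply: hol_affine; rewrite -plane_pt_affl.
- apply: (@hol_ext _ (fun x => f (plane_pt t 0 + x *: plane_pt 0 1))).
    by move=> x; rewrite -plane_pt_affr.
  by apply: hol_affine; rewrite -plane_pt_affr.
- by have := cabs_le_add (f (plane_pt t p)) (f 0); lra.
Qed.

End PlaneCoordinates.

Section LeadingFormOfSurface.
Context {R : realType}.
Local Notation C := (Cplx R).

Lemma form_prod_nseq n (l : 'cV[C]_3) u : form_prod (nseq n l) u = (u *m l) 0 0 ^+ n.
Proof. by rewrite /form_prod big_nseq iter_mulr_1. Qed.

Definition lin_col (x y z : C) : 'cV[C]_3 := \col_i (if i == 0 then x else if i == 1 then y else z).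

Lemma mulmx_lin_col (x y z : C) (u : 'rV[C]_3) :
  (u *m lin_col x y z) 0 0 = u 0 0 * x + u 0 1 * y + u 0 ord_max * z.
Proof.
rewrite mxE 3!big_ord_recr big_ord0 /= add0r !mxE /=.
by congr (u _ _ * _ + u _ _ * _ + u _ _ * _); exact: val_inj.
Qed.

(** For [t != 0] the form is [t ^+ n * q.[p / t]]: the roots [z] of [q] give the factors
    [p - z * t], and the degree that [q] lacks to reach [n] gives factors [t]. The columns end in 0,
    as the third coordinate does not occur. *)
Lemma hsum_factor (c : nat -> nat -> C) n : (exists2 l, (l <= n)%N & c (n - l)%N l != 0) ->
  exists (cols : seq 'cV[C]_3) kap, [/\ size cols = n, forall l, l \in cols -> l != 0, kap != 0
    & forall u : 'rV[C]_3, hsum c n (u 0 0) (u 0 1) = kap * form_prod cols u].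
Proof.
move=> [l0 l0n cl0].
pose q : {poly C} := \poly_(l < n.+1) c (n - l)%N l.
have q0 : q != 0.
  by apply: contraNneq cl0 => E; have := coef0 C l0; rewrite -E coef_poly ltnS l0n => ->.
have [rs qE] := closed_field_poly_normal q.
have k0 : lead_coef q != 0 by rewrite lead_coef_eq0.
have sq : size q = (size rs).+1 by rewrite qE size_scale // size_prod_XsubC.
have mn : (size rs <= n)%N by rewrite -ltnS -sq; exact: size_poly.
exists (nseq (n - size rs) (lin_col 1 0 0) ++ [seq lin_col (- z) 1 0 | z <- rs]), (lead_coef q).
split => //.
- by rewrite size_cat size_nseq size_map subnK.
- move=> l; rewrite mem_cat => /orP[|/mapP[z _ ->]].
    rewrite mem_nseq => /andP[_ /eqP->].
    by apply/eqP => /colP/(_ 0); rewrite !mxE /= => /eqP; rewrite oner_eq0.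
  by apply/eqP => /colP/(_ 1); rewrite !mxE /= => /eqP; rewrite oner_eq0.
move=> u; set t := u 0 0; set p := u 0 1.
have -> : form_prod (nseq (n - size rs) (lin_col 1 0 0) ++ [seq lin_col (- z) 1 0 | z <- rs]) u =
    t ^+ (n - size rs) * \prod_(z <- rs) (p - z * t).
  rewrite /form_prod big_cat big_map /= -/(form_prod _ _) form_prod_nseq mulmx_lin_col.
  rewrite !mulr0 !addr0 mulr1; congr (_ * _); apply: eq_bigr => z _.
  by rewrite mulmx_lin_col mulr0 addr0 mulr1 mulrN addrC [_ * z]mulrC.
have [->|t0] := eqVneq t 0.
  rewrite /hsum big_ord_recr /= subnn expr0 mulr1 big1 ?add0r; last first.
    by move=> l _; rewrite expr0n subn_eq0 leqNgt ltn_ord mulr0 mul0r.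
  have -> : c 0%N n = q`_n by rewrite coef_poly ltnSn subnn.
  have [mn'|nm] := ltnP (size rs) n.
    by rewrite expr0n subn_eq0 leqNgt mn' mul0r mulr0 nth_default ?mul0r // sq.
  have {nm} nm : size rs = n by apply/eqP; rewrite eqn_leq mn.
  rewrite nm subnn expr0 mul1r lead_coefE sq nm; congr (_ * _).
  by rewrite -nm -(count_predT rs) -iter_mulr_1 -big_const_seq; apply: eq_bigr => z _; rewrite mulr0 subr0.
have -> : \prod_(z <- rs) (p - z * t) = t ^+ size rs * \prod_(z <- rs) (p / t - z).
  rewrite -(count_predT rs) -iter_mulr_1 -big_const_seq -big_split; apply: eq_bigr => z _ /=.
  by rewrite mulrBr mulrCA divff // mulr1 [t * z]mulrC.
rewrite [t ^+ _ * (_ * _)]mulrA -exprD subnK //.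
have -> : lead_coef q * (t ^+ n * \prod_(z <- rs) (p / t - z)) = t ^+ n * q.[p / t].
  rewrite {2}qE hornerZ horner_prod mulrCA; congr (_ * (_ * _)).
  by apply: eq_bigr => z _; rewrite !hornerE.
rewrite horner_poly mulr_sumr /hsum; apply: eq_bigr => l _.
have ln : (l <= n)%N by rewrite -ltnS.
rewrite [RHS]mulrCA -mulrA; congr (_ * _).
have -> : t ^+ n = t ^+ (n - l) * t ^+ l by rewrite -exprD subnK.
rewrite exprMn exprVn -[RHS]mulrA; congr (_ * _).
by rewrite mulrCA divff ?mulr1 // expf_neq0.
Qed.

Variables (d : nat) (a : nat -> C -> C -> C) (c : nat -> nat -> nat -> C) (e : nat -> nat)
  (r M M2 : R) (b1 b2 : C).
Hypotheses (d0 : (0 < d)%N) (r1 : r <= 1) (M1 : 1 <= M) (M20 : 0 <= M2)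
  (ab : forall i, (i < d)%N -> forall t p, cabs t <= r -> cabs p <= r ->
     cabs (a i t p) <= M * cmax t p ^+ e i)
  (ac : forall i, (i < d)%N -> (e i < d.+1)%N -> forall t p, cabs t <= r -> cabs p <= r ->
     cabs (a i t p - hsum (c i) (e i) t p) <= M * cmax t p ^+ (e i).+1)
  (cn0 : forall i, (i < d)%N -> (e i < d.+1)%N -> exists2 l, (l <= e i)%N & c i (e i - l)%N l != 0).

(** [be] stands for the translation of the last coordinate, known through its linear part
    [b1 * u 0 0 + b2 * u 0 1] up to second order. *)
Let form_spec (cols : seq 'cV[C]_3) (kap : C) (K : R) := forall (u : 'rV[C]_3) be, vsum u < r ->
  cabs (be - (b1 * u 0 0 + b2 * u 0 1)) <= M2 * vsum u ^+ 2 ->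
  cabs ((gpoly d (fun i => a i (u 0 0) (u 0 1))).[u 0 ord_max + be] - kap * form_prod cols u) <=
    K * vsum u ^+ (size cols).+1.

Let B := cabs b1 + cabs b2 + 1 + M2.

Let B1 : 1 <= B.
Proof.
by have := M20; have := cabs_ge0 b1; have := cabs_ge0 b2; rewrite /B; lra.
Qed.

Lemma root_scale (u : 'rV[C]_3) be : vsum u < r ->
  cabs (be - (b1 * u 0 0 + b2 * u 0 1)) <= M2 * vsum u ^+ 2 ->
  cabs (u 0 ord_max + be) <= B * vsum u /\
  cabs (u 0 ord_max + (b1 * u 0 0 + b2 * u 0 1)) <= B * vsum u.
Proof.
move=> ur beu; have N1 : vsum u <= 1 by have := r1; lra.
have h0 := vsum_ge0 u; have m20 := M20.
have L : cabs (u 0 ord_max + (b1 * u 0 0 + b2 * u 0 1)) <= (cabs b1 + cabs b2 + 1) * vsum u.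
  apply: le_trans (cabsD _ _) _; have := cabsD (b1 * u 0 0) (b2 * u 0 1); rewrite !cabsM.
  have := ler_wpM2l (cabs_ge0 b1) (coord_le_vsum u 0).
  have := ler_wpM2l (cabs_ge0 b2) (coord_le_vsum u 1).
  by have := coord_le_vsum u ord_max; lra.
have M2N : 0 <= M2 * vsum u by rewrite mulr_ge0.
split; last by rewrite /B; lra.
have := cabs_le_add (u 0 ord_max + be) (u 0 ord_max + (b1 * u 0 0 + b2 * u 0 1)).
rewrite opprD addrACA subrr add0r.
have : M2 * vsum u ^+ 2 <= M2 * vsum u.
  by rewrite ler_wpM2l // expr2 ler_piMr.
by rewrite /B; lra.
Qed.

Lemma term_bound i m (u : 'rV[C]_3) z : (i < d)%N -> (m <= e i + i)%N -> vsum u < r ->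
  cabs z <= B * vsum u ->
  cabs (a i (u 0 0) (u 0 1) * z ^+ i) <= M * B ^+ d * vsum u ^+ m.
Proof.
move=> id mi ur zB; have N1 : vsum u <= 1 by have := r1; lra.
have h0 := vsum_ge0 u; have m1 := M1; have b1' := B1.
have t0 := coord_le_vsum u 0; have p0 := coord_le_vsum u 1.
rewrite cabsM cabsX.
have h1 : cabs (a i (u 0 0) (u 0 1)) <= M * vsum u ^+ e i.
  apply: le_trans (ab id _ _) _; try lra.
  apply: ler_wpM2l; first lra.
  by apply: lerXn2r; rewrite ?nnegrE ?cmax_ge0 ?cmax_le.
have h2 : cabs z ^+ i <= B ^+ d * vsum u ^+ i.
  apply: (@le_trans _ _ ((B * vsum u) ^+ i)).
    by apply: lerXn2r; rewrite ?nnegrE ?cabs_ge0 // mulr_ge0 //; lra.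
  rewrite exprMn; apply: ler_wpM2r; first by rewrite exprn_ge0.
  by apply: ler_weXn2l => //; exact: ltnW.
apply: (@le_trans _ _ (M * vsum u ^+ e i * (B ^+ d * vsum u ^+ i))).
  by apply: ler_pM; rewrite ?exprn_ge0 ?cabs_ge0.
have -> : M * vsum u ^+ e i * (B ^+ d * vsum u ^+ i) = M * B ^+ d * vsum u ^+ (e i + i).
  by rewrite exprD; ring.
apply: ler_wpM2l; first by rewrite mulr_ge0 ?exprn_ge0 //; lra.
exact: ler_wiXn2l.
Qed.

(** Every term [a i * z ^+ i] has order above [d], so [z ^+ d] leads. As [z] is the linear form [L]
    up to second order, the leading form is [L ^+ d], a plane with multiplicity. *)
Lemma leading_form_steep : (forall i, (i < d)%N -> (d < e i + i)%N) ->
  exists K, 0 <= K /\ form_spec (nseq d (lin_col b1 b2 1)) 1 K.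
Proof.
move=> he; have m1 := M1; have b1' := B1; have m20 := M20.
exists (M2 * (d%:R * B ^+ d) + d%:R * (M * B ^+ d)); split.
  by rewrite addr_ge0 // !mulr_ge0 ?exprn_ge0 //; lra.
move=> u be ur beu; have h0 := vsum_ge0 u; have N1 : vsum u <= 1 by have := r1; lra.
have [zB LB] := root_scale ur beu.
rewrite mul1r form_prod_nseq mulmx_lin_col size_nseq horner_gpoly mulr1.
have -> : u 0 0 * b1 + u 0 1 * b2 + u 0 ord_max = u 0 ord_max + (b1 * u 0 0 + b2 * u 0 1) by ring.
set z := u 0 ord_max + be in zB *; set L := u 0 ord_max + _ in LB *.
have zL : cabs (z - L) <= M2 * vsum u ^+ 2 by rewrite /z /L opprD addrACA subrr add0r.
rewrite addrAC; apply: le_trans (cabsD _ _) _; rewrite mulrDl; apply: lerD.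
  rewrite subrXX cabsM.
  have S : cabs (\sum_(i < d) z ^+ (d.-1 - i) * L ^+ i) <= d%:R * B ^+ d * vsum u ^+ d.-1.
    apply: le_trans (cabs_sum _ _ _) _.
    apply: (@le_trans _ _ (\sum_(i < d) B ^+ d * vsum u ^+ d.-1)); last first.
      by rewrite sumr_const card_ord -[_ *+ d]mulr_natl mulrA.
    apply: ler_sum => i _; rewrite cabsM !cabsX.
    have id : (i <= d.-1)%N by rewrite -ltnS prednK.
    have BN : 0 <= B * vsum u by rewrite mulr_ge0 //; lra.
    apply: (@le_trans _ _ ((B * vsum u) ^+ (d.-1 - i) * (B * vsum u) ^+ i)).
      by apply: ler_pM; rewrite ?exprn_ge0 ?cabs_ge0 //; apply: lerXn2r; rewrite ?nnegrE ?cabs_ge0.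
    rewrite -exprD subnK // exprMn; apply: ler_wpM2r; first by rewrite exprn_ge0.
    by apply: ler_weXn2l => //; exact: leq_pred.
  apply: (@le_trans _ _ (M2 * vsum u ^+ 2 * (d%:R * B ^+ d * vsum u ^+ d.-1))).
    by apply: ler_pM; rewrite ?cabs_ge0.
  rewrite le_eqVlt; apply/orP; left; apply/eqP.
  have -> : vsum u ^+ d.+1 = vsum u ^+ 2 * vsum u ^+ d.-1 by rewrite -exprD add2n prednK.
  by ring.
apply: le_trans (cabs_sum _ _ _) _.
apply: (@le_trans _ _ (\sum_(i < d) M * B ^+ d * vsum u ^+ d.+1)).
  by apply: ler_sum => i _; apply: term_bound => //; exact: he.
by rewrite sumr_const card_ord -[_ *+ d]mulr_natl !mulrA.
Qed.

(** Here [z ^+ d] and the terms with [i > 0] have order above [e 0], so the leading form is that of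
    [a 0] and involves the first two coordinates only. *)
Lemma leading_form_flat : (0 < e 0 < d)%N -> (forall i, (0 < i < d)%N -> (e 0 < e i + i)%N) ->
  exists cols kap K, [/\ size cols = e 0%N, forall l, l \in cols -> l != 0, kap != 0, 0 <= K
    & form_spec cols kap K].
Proof.
move=> /andP[e0 ed] he; have m1 := M1; have b1' := B1; have m20 := M20.
have ed1 : (e 0 < d.+1)%N by apply: ltn_trans ed _.
have [cols [kap [sc cols0 kap0 cE]]] := hsum_factor (cn0 d0 ed1).
exists cols, kap, (B ^+ d + M + d%:R * (M * B ^+ d)); split => //.
  by rewrite !(addr_ge0, mulr_ge0) ?exprn_ge0 //; clra.
move=> u be ur beu; have h0 := vsum_ge0 u; have N1 : vsum u <= 1 by have := r1; lra.
have [zB _] := root_scale ur beu.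
have t0 := coord_le_vsum u 0; have p0 := coord_le_vsum u 1.
rewrite horner_gpoly sc -cE; set z := u 0 ord_max + be in zB *.
have [d' dE] : exists d', d = d'.+1 by exists d.-1; rewrite prednK.
have -> : \sum_(i < d) a i (u 0 0) (u 0 1) * z ^+ i =
   a 0%N (u 0 0) (u 0 1) + \sum_(i < d | (0 < i)%N) a i (u 0 0) (u 0 1) * z ^+ i.
  rewrite (bigD1 (Ordinal d0)) //= expr0 mulr1; congr (_ + _).
  by apply: eq_bigl => i; rewrite lt0n.
set S := \sum_(i < d | _) _; set H := hsum _ _ _ _; set A0 := a 0%N _ _.
have -> : z ^+ d + (A0 + S) - H = z ^+ d + (A0 - H) + S by ring.
apply: le_trans (cabsD _ _) _; rewrite mulrDl; apply: lerD.
  apply: le_trans (cabsD _ _) _; rewrite mulrDl; apply: lerD.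
    rewrite cabsX; apply: (@le_trans _ _ ((B * vsum u) ^+ d)).
      by apply: lerXn2r; rewrite ?nnegrE ?cabs_ge0 // mulr_ge0 //; clra.
    rewrite exprMn; apply: ler_wpM2l; first by rewrite exprn_ge0 //; clra.
    exact: ler_wiXn2l.
  apply: le_trans (ac d0 ed1 _ _) _; try lra.
  apply: ler_wpM2l; first lra.
  by apply: lerXn2r; rewrite ?nnegrE ?cmax_ge0 ?cmax_le.
apply: le_trans (cabs_sum _ _ _) _.
apply: (@le_trans _ _ (\sum_(i < d) M * B ^+ d * vsum u ^+ (e 0%N).+1)); last first.
  by rewrite sumr_const card_ord -[_ *+ d]mulr_natl !mulrA.
rewrite big_mkcond; apply: ler_sum => i _; case: ifP => [i0|_].
  by apply: term_bound => //; apply: he; rewrite i0 ltn_ord.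
by rewrite !mulr_ge0 ?exprn_ge0 //; clra.
Qed.

Theorem leading_form : (forall i, (i < d)%N -> (d < e i + i)%N) \/
    ((0 < e 0 < d)%N /\ forall i, (0 < i < d)%N -> (e 0 < e i + i)%N) ->
  exists cols kap K, [/\ (0 < size cols)%N, forall l, l \in cols -> l != 0, kap != 0, 0 <= K
    & form_spec cols kap K].
Proof.
move=> [/leading_form_steep[K [K0 hK]]|[/[dup] /andP[e0 _] ed /(leading_form_flat ed)]].
  exists (nseq d (lin_col b1 b2 1)), 1, K; split; [by rewrite size_nseq| |exact: oner_neq0|exact: K0|exact: hK].
  move=> l; rewrite mem_nseq => /andP[_ /eqP->].
  apply/eqP => /colP/(_ ord_max); rewrite !mxE /= => /eqP; exact/negP/oner_neq0.
by move=> [cols [kap [K [sc ? ? ? ?]]]]; exists cols, kap, K; rewrite sc.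
Qed.

End LeadingFormOfSurface.

Section CoefficientOrders.
Context {R : realType}.
Local Notation C := (Cplx R).

Lemma separable_of_discriminant d (p : {poly C}) : monicd d p -> discriminant p != 0 ->
  separable_poly p.
Proof.
move=> [pm sp]; rewrite /discriminant !mulf_eq0 !negb_or => /andP[/andP[_ rp] _].
move: rp; rewrite resultant_eq0 -leqNgt => g1.
apply/separableP => x px; apply/negP => px'.
have : 'X - x%:P %| gcdp p p^`() by rewrite dvdp_gcd !dvdp_XsubCl px.
move=> /dvdp_leq; rewrite size_XsubC gcdp_eq0 negb_and monic_neq0 // => /(_ isT).
by rewrite ltnNge g1.
Qed.

Lemma linear_part (be : C -> C -> C) (r M : R) : 0 < r -> bihol r M be -> be 0 0 = 0 ->
  exists (b1 b2 : C) (r' M' : R), [/\ 0 < r', 0 <= M' & forall t p, cabs t <= r' -> cabs p <= r' ->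
    cabs (be t p - (b1 * t + b2 * p)) <= M' * cmax t p ^+ 2].
Proof.
move=> r0 hb be0; have [c [r' [M' [r'0 h]]]] := taylor2 2 r0 hb.
have sE t p : \sum_(k < 2) hsum c k t p = c 0%N 0%N + (c 1%N 0%N * t + c 0%N 1%N * p).
  rewrite !big_ord_recr big_ord0 /hsum !big_ord_recr !big_ord0 /=.
  by rewrite !subn0 subnn !expr0 !expr1; ring.
have c00 : c 0%N 0%N = 0.
  have := h 0 0; rewrite sE be0 cabs0 /cmax cabs0 maxxx expr0n !mulr0 !addr0 sub0r cabsN.
  by move=> /(_ (ltW r'0) (ltW r'0)) h0; apply/eqP; rewrite -cabs_eq0 eq_le cabs_ge0 h0.
exists (c 1%N 0%N), (c 0%N 1%N), r', `|M'|; split; [exact: r'0|exact: normr_ge0|].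
move=> t p tr pr; have := h t p tr pr; rewrite sE c00 add0r => h1.
apply: le_trans h1 _; apply: ler_wpM2r; last exact: ler_norm.
by rewrite exprn_ge0 // cmax_ge0.
Qed.

(** Orders are capped at [d.+1]: an order above [d] already exceeds every value it is compared with,
    and its leading form plays no part. One radius and one constant serve all coefficients. *)
Lemma order_data d (a : nat -> C -> C -> C) :
  (forall i, (i < d)%N -> exists r M : R, 0 < r /\ bihol r M (a i)) ->
  exists (c : nat -> nat -> nat -> C) (e : nat -> nat) (r M : R), [/\ 0 < r, 1 <= M,
    forall i, (i < d)%N -> (e i < d.+1)%N -> exists2 l, (l <= e i)%N & c i (e i - l)%N l != 0
  & forall i, (i < d)%N -> forall t p, cabs t <= r -> cabs p <= r ->
      [/\ hol (a i t) p, cabs (a i t p) <= M * cmax t p ^+ e i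
        & (e i < d.+1)%N -> cabs (a i t p - hsum (c i) (e i) t p) <= M * cmax t p ^+ (e i).+1]].
Proof.
move=> ha.
pose Q (ce : (nat -> nat -> C) * nat) i (r M : R) := forall t p, cabs t <= r -> cabs p <= r ->
  [/\ hol (a i t) p, cabs (a i t p) <= M * cmax t p ^+ ce.2
    & (ce.2 < d.+1)%N -> cabs (a i t p - hsum ce.1 ce.2 t p) <= M * cmax t p ^+ ce.2.+1].
have h i : exists ce : (nat -> nat -> C) * nat, (i < d)%N ->
    ((ce.2 < d.+1)%N -> exists2 l, (l <= ce.2)%N & ce.1 (ce.2 - l)%N l != 0) /\
    exists r M : R, 0 < r /\ Q ce i r M.
  have [id|_] := boolP (i < d)%N; last by exists (fun _ _ => 0, 0%N).
  have [r [M [r0 bh]]] := ha i id.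
  have [c [e [r' [M' [r'0 M'0 cn0 ab ac]]]]] := taylor_order d.+1 r0 bh.
  exists (c, e) => _; split=> //; exists (Num.min r r'), M'; split; first by rewrite lt_min r0.
  move=> t p; rewrite !le_min => /andP[tr tr'] /andP[pr pr']; split.
  - by have [] := bh t p tr pr.
  - exact: ab.
  - by move=> ed; exact: ac.
have [ce hce] := choice h.
have [||r [M [r0 M0 hQ]]] := @uniform_radius R d (fun i => Q (ce i) i).
- move=> i r r' M M' hQ r'0 r'r MM' t p tr pr.
  have [h1 h2 h3] := hQ t p (le_trans tr r'r) (le_trans pr r'r); split => //.
    by apply: le_trans h2 _; apply: ler_wpM2r => //; rewrite exprn_ge0 // cmax_ge0.
  move=> ed; apply: le_trans (h3 ed) _; apply: ler_wpM2r => //.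
  by rewrite exprn_ge0 // cmax_ge0.
- by move=> i id; have [_] := hce i id.
exists (fun i => (ce i).1), (fun i => (ce i).2), r, (M + 1); split=> //.
- by rewrite lerDr.
- by move=> i id; have [] := hce i id.
- move=> i id t p tr pr; have [h1 h2 h3] := hQ i id t p tr pr.
  have MM : M <= M + 1 by rewrite lerDl.
  split => //.
    by apply: le_trans h2 _; apply: ler_wpM2r => //; rewrite exprn_ge0 // cmax_ge0.
  move=> ed; apply: le_trans (h3 ed) _; apply: ler_wpM2r => //.
  by rewrite exprn_ge0 // cmax_ge0.
Qed.

End CoefficientOrders.

Lemma row_mx3 (A : nmodType) (a : 'rV[A]_2) (b : 'rV[A]_1) : let z : 'rV[A]_3 := row_mx a b in
  [/\ z 0 0 = a 0 0, z 0 1 = a 0 1 & z 0 ord_max = b 0 0].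
Proof.
split; rewrite mxE; case: splitP => j /= jE.
- by congr (a _ _); exact: val_inj.
- by have := ltn_ord j; lia.
- by congr (a _ _); exact: val_inj.
- by have := ltn_ord j; lia.
- by have := ltn_ord j; lia.
- by congr (b _ _); exact: ord1.
Qed.

(** * The surface in coordinates adapted to the arc *)

Section SurfaceOverPlane.
Context {R : realType}.
Local Notation C := (Cplx R).
Variables (pr : 'rV[C]_3 -> 'rV[C]_2) (A : 'M[C]_3) (D : 'M[C]_2) (F : 'rV[C]_2 -> {poly C}) (d : nat).
Hypotheses (uA : A \in unitmx) (prE : forall x, pr x = lsubmx (x *m A : 'rV[C]_(2 + 1)))
  (uD : D \in unitmx) (d0 : (0 < d)%N)
  (Fm : \forall y \near (0 : 'rV[C]_2), F y \is monic /\ size (F y) = d.+1)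
  (Fh : forall i, (i < d)%N -> holomorphic_germ (fun y => (F y)`_i : C))
  (F0 : forall i, (i < d)%N -> (F 0)`_i = 0).

(** [F y] is known to be monic of degree [d] only for [y] near 0; this polynomial agrees with it
    there and is monic of degree [d] everywhere. *)
Definition monic_of y : {poly C} := gpoly d (fun i => (F y)`_i).
Definition reduced_coef i y : C := (centered d (monic_of y))`_i.
(** Minus the mean of the roots: a root [z] of [monic_of y] becomes the root [z + root_shift y] of
    the centered polynomial. *)
Definition root_shift y : C := (monic_of y)`_d.-1 / d%:R.
Definition plane_coef i (t p : C) := reduced_coef i (plane_pt D t p).

Lemma monic_of_monicd y : monicd d (monic_of y). Proof. exact: monicd_gpoly. Qed.

Lemma monic_ofE : \forall y \near (0 : 'rV[C]_2), F y = monic_of y.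
Proof.
apply: filterS Fm => y [Fym sF]; rewrite /monic_of.
by rewrite [RHS](gpoly_coef (p := F y)).
Qed.

Lemma monic_of_hol i : holomorphic_germ (fun y => (monic_of y)`_i).
Proof.
have [id|] := ltnP i d.
  by apply: holomorphic_germ_ext (Fh id) => y; rewrite coef_gpoly.
rewrite leq_eqVlt => /orP[/eqP <-|di].
  apply: (@holomorphic_germ_ext _ _ (fun=> 1)); last exact: holomorphic_germ_cst.
  by move=> y; rewrite coef_poly ltnSn eqxx.
apply: (@holomorphic_germ_ext _ _ (fun=> 0)); last exact: holomorphic_germ_cst.
by move=> y; rewrite coef_poly ltnS leqNgt di.
Qed.

Lemma reduced_coef_hol i : holomorphic_germ (reduced_coef i).
Proof. by apply: coefs_centered; [exact: monic_of_monicd|exact: monic_of_hol]. Qed.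

Lemma reduced_coef_differentiable : \forall y \near (0 : 'rV[C]_2),
  forall i, (i < d)%N -> differentiable (reduced_coef i) y.
Proof.
have h n : \forall y \near (0 : 'rV[C]_2), forall i, (i < n)%N -> differentiable (reduced_coef i) y.
  elim: n => [|n IH]; first by near=> y.
  apply: filterS2 IH (reduced_coef_hol n) => y h1 h2 i.
  by rewrite ltnS leq_eqVlt => /orP[/eqP->|/h1].
exact: h.
Unshelve. all: by end_near. Qed.

Lemma root_shift_hol : holomorphic_germ root_shift.
Proof. by apply: holomorphic_germM; [exact: monic_of_hol|exact: holomorphic_germ_cst]. Qed.

Lemma monic_of0 : monic_of 0 = 'X^d.
Proof.
apply/polyP => i; rewrite coefXn coef_poly.
have [->|id] := eqVneq i d; first by rewrite ltnSn.
by case: ltnP => // id'; rewrite F0 // ltn_neqAle id -ltnS.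
Qed.

Lemma root_shift0 : root_shift 0 = 0.
Proof. by rewrite /root_shift monic_of0 coefXn ltn_eqF ?prednK // mul0r. Qed.

Lemma reduced_coef0 i : (i < d)%N -> reduced_coef i 0 = 0.
Proof. by move=> id; rewrite /reduced_coef monic_of0 centeredXn // coefXn ltn_eqF. Qed.

Lemma gpoly_reduced y : gpoly d (fun i => reduced_coef i y) = centered d (monic_of y).
Proof. exact/gpoly_coef/monicd_centered/monic_of_monicd. Qed.

Lemma plane_coef_top t p : plane_coef d.-1 t p = 0.
Proof. by apply: coef_centered => //; exact: monic_of_monicd. Qed.

Definition space_mx : 'M[C]_3 := A *m (block_mx D 0 0 1%:M : 'M[C]_(2 + 1)).

Lemma space_mx_unit : space_mx \in unitmx.
Proof.
have uDb : (block_mx D 0 0 1%:M : 'M[C]_(2 + 1)) \in unitmx.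
  by rewrite unitmxE det_lblock det1 mulr1 -unitmxE.
by rewrite unitmx_mul uA; exact: uDb.
Qed.

Lemma mulmx_space x : x *m space_mx =
  row_mx (pr x *m D) (rsubmx (x *m A : 'rV[C]_(2 + 1))) :> 'rV[C]_(2 + 1).
Proof.
have E (z : 'rV[C]_(2 + 1)) : z *m block_mx D 0 0 1%:M = row_mx (lsubmx z *m D) (rsubmx z).
  by rewrite -{1}(hsubmxK z) mul_row_block !mulmx0 addr0 add0r mulmx1.
by rewrite /space_mx mulmxA prE; exact: E.
Qed.

Lemma space_coords x : [/\ (x *m space_mx) 0 0 = (pr x *m D) 0 0,
  (x *m space_mx) 0 1 = (pr x *m D) 0 1 & (x *m space_mx) 0 ord_max = (x *m A) 0 ord_max].
Proof.
have [h0 h1 h2] := row_mx3 (pr x *m D) (rsubmx (x *m A : 'rV[C]_(2 + 1))).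
rewrite -mulmx_space in h0 h1 h2; split; [exact: h0|exact: h1|].
by rewrite h2 mxE; congr ((x *m A) _ _); exact: val_inj.
Qed.

Definition shifted_coord x : C := (x *m A) 0 ord_max + root_shift (pr x).

Lemma prE_plane x : pr x = (x *m space_mx) 0 0 *: plane_pt D 1 0 + (x *m space_mx) 0 1 *: plane_pt D 0 1.
Proof.
have [-> -> _] := space_coords x.
by rewrite -plane_pt_lin plane_ptE.
Qed.

Lemma pr_differentiable x : differentiable pr x.
Proof.
rewrite (_ : pr = fun x => (x *m space_mx) 0 0 *: plane_pt D 1 0 + (x *m space_mx) 0 1 *: plane_pt D 0 1).
  by apply: differentiableD; apply: differentiableZl; exact: differentiable_mulmx.
by apply: funext => y; exact: prE_plane.
Qed.

Lemma pr0 : pr 0 = 0.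
Proof. by rewrite prE_plane !mul0mx !mxE !scale0r addr0. Qed.

Lemma near_pr (P : set 'rV[C]_2) : (\forall y \near (0 : 'rV[C]_2), P y) ->
  \forall x \near (0 : 'rV[C]_3), P (pr x).
Proof.
by move=> nP; have := differentiable_continuous (pr_differentiable 0); apply; rewrite pr0.
Qed.

Lemma holomorphic_germ_pr (f : 'rV[C]_2 -> C) : holomorphic_germ f ->
  holomorphic_germ (fun x => f (pr x)).
Proof.
by move=> /near_pr; apply: filterS => x fx; exact: differentiable_comp (pr_differentiable x) fx.
Qed.

Lemma shifted_coord_hol : holomorphic_germ shifted_coord.
Proof.
apply: holomorphic_germD; last exact: holomorphic_germ_pr root_shift_hol.
by apply: holomorphic_germ_all => x; exact: differentiable_mulmx.
Qed.

Definition surface_eq x : C := (centered d (monic_of (pr x))).[shifted_coord x].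

Lemma surface_eq_hol : holomorphic_germ surface_eq.
Proof.
apply: (@holomorphic_germ_ext _ _ (fun x => \sum_(i < d.+1) reduced_coef i (pr x) * shifted_coord x ^+ i)).
  move=> x; rewrite /surface_eq horner_coef.
  by have [_ ->] := monicd_centered (monic_of_monicd (pr x)).
apply: (@holomorphic_germ_sum _ _ d.+1 (fun i x => reduced_coef i (pr x) * shifted_coord x ^+ i)) => i.
apply: holomorphic_germM; first exact: holomorphic_germ_pr (reduced_coef_hol i).
exact: holomorphic_germX shifted_coord_hol.
Qed.

Lemma surface_eqE : \forall x \near (0 : 'rV[C]_3),
  weierstrass_fun F (x *m A) = surface_eq x.
Proof.
apply: filterS (near_pr monic_ofE) => x Fx.
rewrite /weierstrass_fun -prE Fx /surface_eq horner_centered /shifted_coord.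
by rewrite /root_shift addrK.
Qed.

(** The third coordinate is a linear one translated by a function of the first two, so the point is
    found explicitly. *)
Lemma surface_coords (U : set 'rV[C]_3) : nbhs (0 : 'rV[C]_3) U -> exists2 del : R, 0 < del &
  forall t p z, cabs t < del -> cabs p < del -> cabs z < del ->
  exists x, [/\ U x, (x *m space_mx) 0 0 = t, (x *m space_mx) 0 1 = p & shifted_coord x = z].
Proof.
move=> /nearV[r r0 hU]; have [r' r'0 hr'] := mulmx_small (invmx space_mx) r0.
have r'2 : 0 < r' / 2 by rewrite divr_gt0.
have bs := near_small (differentiable_continuous (nbhs_singleton root_shift_hol)) root_shift0 r'2.
have [r2 r20 hr2] := plane_pt_small D bs.
exists (Num.min (r' / 2) r2); first by rewrite lt_min r'2.
move=> t p z; rewrite !lt_min => /andP[tr tr2] /andP[pr' pr2] /andP[zr zr2].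
pose u : 'rV[C]_3 := \row_i (if i == 0 then t else if i == 1 then p else z - root_shift (plane_pt D t p)).
pose x := u *m invmx space_mx.
have xu : x *m space_mx = u by rewrite /x mulmxKV // space_mx_unit.
have [e0 e1 e2] := space_coords x; rewrite xu in e0 e1 e2.
have prx : pr x = plane_pt D t p by rewrite -[LHS](plane_ptE uD) -e0 -e1 !mxE.
exists x; split.
- apply: hU => j; rewrite [(0 : 'rV_3) _ _]mxE subr0; apply: hr' => i; rewrite mxE.
  case: (i == 0); first lra.
  case: (i == 1); first lra.
  have := hr2 t p (ltW tr2) (ltW pr2); have := cabsB z (root_shift (plane_pt D t p)); clra.
- by rewrite xu mxE.
- by rewrite xu mxE.
- by rewrite /shifted_coord -e2 prx mxE subrK.
Qed.

Lemma hol_plane_pt (f : 'rV[C]_2 -> C) (t p : C -> C) w : hol t w -> hol p w ->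
  differentiable f (plane_pt D (t w) (p w)) -> hol (fun w => f (plane_pt D (t w) (p w))) w.
Proof.
move=> [th] [ph] fd; split.
apply: (@differentiable_comp _ _ _ _ (fun w => plane_pt D (t w) (p w)) f) => //.
rewrite (_ : (fun w => _) = fun w => t w *: plane_pt D 1 0 + p w *: plane_pt D 0 1).
  by apply: differentiableD; apply: differentiableZl.
by apply: funext => u; exact: plane_pt_lin.
Qed.

End SurfaceOverPlane.

Section Disks.
Context {R : realType}.
Local Notation C := (Cplx R).

Lemma diskE (r : R) (t : C) : disk r t <-> cabs t <= r.
Proof. by rewrite /disk /= cabsE lecR. Qed.

Lemma not_tangent_coneP n (B : 'M[C]_n) (A : set 'rV[C]_n) (v : 'rV[C]_n) : B \in unitmx ->
  ~ tangent_cone A v -> exists2 e : R, 0 < e & forall x (c : C), A x ->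
    (forall j, cabs ((x *m B) 0 j) < e) -> ~ (forall j, cabs ((c *: (x *m B) - v *m B) 0 j) < e).
Proof.
move=> uB nTC; apply: contrapT => no; apply: nTC; apply/(tangent_coneP _ _ uB) => e e0.
apply: contrapT => nx; apply: no; exists e => // x c Ax xe xv.
by apply: nx; exists x, c.
Qed.

End Disks.

(** * The arc-section and the tangent cone of the surface *)

Section Irreducibility.
Context {R : realType}.
Local Notation C := (Cplx R).
Variables (X : set 'rV[C]_3) (pr : 'rV[C]_3 -> 'rV[C]_2) (gamma : C -> 'rV[C]_2) (r0 : R)
  (A : 'M[C]_3) (D : 'M[C]_2) (F : 'rV[C]_2 -> {poly C}) (d k : nat) (pw : C -> C) (rho K e0 : R).
Hypotheses (uA : A \in unitmx) (prE : forall x, pr x = lsubmx (x *m A : 'rV[C]_(2 + 1)))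
  (uD : D \in unitmx) (d0 : (0 < d)%N)
  (Fm : \forall y \near (0 : 'rV[C]_2), F y \is monic /\ size (F y) = d.+1)
  (Fh : forall i, (i < d)%N -> holomorphic_germ (fun y => (F y)`_i : C))
  (F0 : forall i, (i < d)%N -> (F 0)`_i = 0)
  (XE : germ_eq X [set x | weierstrass_fun F (x *m A) = 0])
  (an : arc_normal gamma r0 D k pw rho K)
  (irr : irreducible_germ (arc_section pr X gamma r0))
  (e00 : 0 < e0)
  (nD : forall y (c : C), discriminant (F y) = 0 -> (forall j, cabs ((y *m D) 0 j) < e0) ->
    ~ (forall j, cabs ((c *: (y *m D) - delta_mx 0 0) 0 j) < e0)).

Local Notation a := (plane_coef D F d).
Local Notation T x := ((x *m space_mx A D) 0 0).
Local Notation P x := ((x *m space_mx A D) 0 1).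
Local Notation Z := (shifted_coord pr A F d).

(** [(1, p / t)] is within [e0] of the tangent direction, so by [nD] with [c = t^-1] the point
    [(t, p)] is off the discriminant. *)
Lemma plane_separable : exists2 r : R, 0 < r & forall t p, 0 < cabs t < r ->
  cabs p < Num.min e0 1 * cabs t -> separable_poly (gpoly d (fun i => a i t p)).
Proof.
have [rF rF0 hF] := plane_pt_small D (monic_ofE Fm).
exists (Num.min rF e0); first by rewrite lt_min rF0.
move=> t p; rewrite lt_min => /and3P[t0 tr te] pt.
have m1 : Num.min e0 1 <= 1 by rewrite ge_min lexx orbT.
have me : Num.min e0 1 <= e0 by rewrite ge_min lexx.
have pt' : cabs p < cabs t by apply: lt_le_trans pt _; rewrite ler_piMl // ltW.
rewrite gpoly_reduced; apply: separable_centered.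
apply: (separable_of_discriminant (monic_of_monicd _ _ _)).
rewrite -hF; [|exact: ltW|by lra].
apply/eqP => disc; apply: (nD (c := t^-1) disc) => j; rewrite plane_ptK //.
  by rewrite mxE; case: (j == 0); lra.
rewrite !mxE eqxx /=; case: (j == 0).
  by rewrite mulVf ?subrr ?cabs0 // -cabs_gt0.
by rewrite subr0 cabsM cabsV mulrC ltr_pdivrMr //; apply: lt_le_trans pt _; rewrite ler_wpM2r ?cabs_ge0.
Qed.

(** The hypotheses of [slope_dichotomy] are gathered on one radius, after the arc-section has been
    written in the form that [nosplit_of_irreducible] requires. *)
Lemma arc_tangent_order : exists (c : nat -> nat -> nat -> C) (e : nat -> nat) (r M : R),
  [/\ 0 < r <= 1, 1 <= M,
    forall i, (i < d)%N -> (e i < d.+1)%N -> exists2 l, (l <= e i)%N & c i (e i - l)%N l != 0,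
    forall i, (i < d)%N -> forall t p, cabs t <= r -> cabs p <= r ->
      [/\ hol (a i t) p, cabs (a i t p) <= M * cmax t p ^+ e i
        & (e i < d.+1)%N -> cabs (a i t p - hsum (c i) (e i) t p) <= M * cmax t p ^+ (e i).+1]
  & (forall i, (i < d)%N -> (d < e i + i)%N) \/
    ((0 < e 0 < d)%N /\ forall i, (0 < i < d)%N -> (e 0 < e i + i)%N)].
Proof.
have [[k0 K0] /andP[rho0 rho1] pwP arc_inj [del del0 hdel]] := an.
have [|c [e [r1 [M [r10 M1 cn0 hord]]]]] := @order_data _ d a.
  by move=> i id; exact: bihol_germ (reduced_coef_hol Fh i).
have [rF rF0 hF] := plane_pt_small D (reduced_coef_differentiable Fh).
have [rs rs0 hs] := plane_separable.
pose eps := Num.min e0 1.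
have eps0 : 0 < eps by rewrite lt_min e00 ltr01.
have eps1 : eps <= 1 by rewrite ge_min lexx orbT.
pose m0 := Num.min (Num.min rho r1) (Num.min rF rs).
have m00 : 0 < m0 by rewrite !lt_min rho0 r10 rF0.
have m0rho : m0 <= rho by rewrite !ge_min lexx.
have m0r1 : m0 <= r1 by rewrite !ge_min lexx orbT.
have m0rF : m0 <= rF by rewrite !ge_min lexx !orbT.
have m0rs : m0 <= rs by rewrite !ge_min lexx !orbT.
(* With [eps'] and the factor [K + 1] in the radius, the second coordinate of the arc is at most
   [m0], so the arc stays in the domain of every estimate. *)
pose eps' := Num.min eps m0.
have eps'0 : 0 < eps' by rewrite lt_min eps0.
have eps'e : eps' <= eps by rewrite ge_min lexx.
have eps'm : eps' <= m0 by rewrite ge_min lexx orbT.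
clearbody m0 eps'.
pose r := Num.min m0 (eps' / (K + 1)).
have K10 : 0 < K + 1 by clra.
have r_gt0 : 0 < r by rewrite lt_min m00 divr_gt0.
have rm0 : r <= m0 by rewrite ge_min lexx.
have rK : r * (K + 1) <= eps' by rewrite -ler_pdivlMr // ge_min lexx orbT.
clearbody r.
have r1' : r <= 1 by lra.
have rrho : r <= rho by exact: le_trans m0rho.
have rrF : r <= rF by exact: le_trans m0rF.
have rrs : r <= rs by exact: le_trans m0rs.
have wK w : cabs w < r -> K * cabs w < eps'.
  move=> wr; have : cabs w * (K + 1) < r * (K + 1) by rewrite ltr_pM2r.
  by have := cabs_ge0 w; clra.
have wk w : cabs w < r -> cabs (w ^+ k) <= cabs w.
  move=> wr; rewrite cabsX -[leRHS]expr1; apply: ler_wiXn2l => //; first exact: cabs_ge0.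
  by clra.
have pwK w : cabs w < r -> cabs (pw w) <= K * cabs w ^+ k.+1.
  by move=> wr; have [_] := pwP w (lt_le_trans wr rrho).
have pwe w : cabs w < r -> cabs (pw w) <= eps' * cabs (w ^+ k).
  move=> wr; apply: le_trans (pwK w wr) _; rewrite exprS mulrA cabsX.
  by apply: ler_wpM2r; [rewrite exprn_ge0 ?cabs_ge0|exact/ltW/wK].
have pw1 w : cabs w < r -> cabs (pw w) <= m0.
  move=> wr; apply: le_trans (pwe w wr) _; apply: le_trans eps'm.
  by rewrite ler_piMr ?(ltW eps'0) // (le_trans (wk w wr)) // (le_trans (ltW wr)).
have arc_hol i : (i < d)%N -> forall w, cabs w < r -> hol (fun w => a i (w ^+ k) (pw w)) w.
  move=> id w wr; apply: (@hol_plane_pt _ D (reduced_coef F d i) (fun w => w ^+ k) pw).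
  - exact: (holX _ (hol_id _)).
  - exact: (pwP w (lt_le_trans wr rrho)).1.
  - by apply: hF => //; [exact: le_trans (wk w wr) (le_trans (ltW wr) rrF)|exact: le_trans (pw1 w wr) m0rF].
have pw0 : pw 0 = 0.
  have := pwK 0; rewrite cabs0 => /(_ r_gt0); rewrite expr0n mulr0 => h.
  by apply/eqP; rewrite -cabs_eq0 eq_le h cabs_ge0.
have a00 i : (i < d)%N -> a i 0 0 = 0.
  by move=> id; rewrite /plane_coef plane_pt00 reduced_coef0.
have sep t p : 0 < cabs t < r -> cabs p < eps * cabs t -> separable_poly (gpoly d (fun i => a i t p)).
  by move=> /andP[t0 tr]; apply: hs; rewrite t0 (lt_le_trans tr).
have Gsep w : 0 < cabs w < r -> separable_poly (gpoly d (fun i => a i (w ^+ k) (pw w))).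
  move=> /andP[w0 wr]; have wk0 : 0 < cabs (w ^+ k) by rewrite cabsX exprn_gt0.
  apply: sep; first by rewrite wk0 (le_lt_trans (wk w wr)).
  apply: le_lt_trans (pwK w wr) _; rewrite exprS mulrA cabsX ltr_pM2r -?cabsX //.
  exact: lt_le_trans (wK w wr) eps'e.
(* Near 0, [arc_normal] replaces membership of [pr x] in the image of [gamma] by a parameter [w],
   and the equation of [X] becomes a root condition on the translated last coordinate. *)
have AE : \forall x \near (0 : 'rV[C]_3), arc_section pr X gamma r0 x <->
    exists w, [/\ cabs w < r, T x = w ^+ k, P x = pw w
                & root (gpoly d (fun i => a i (w ^+ k) (pw w))) (Z x)].
  have T0 : T (0 : 'rV[C]_3) = 0 by rewrite mul0mx mxE.
  have P0 : P (0 : 'rV[C]_3) = 0 by rewrite mul0mx mxE.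
  have md : 0 < Num.min del (r ^+ k) by rewrite lt_min del0 exprn_gt0.
  have nT := near_small (differentiable_continuous (differentiable_mulmx (space_mx A D) 0 0)) T0 md.
  have nP := near_small (differentiable_continuous (differentiable_mulmx (space_mx A D) 1 0)) P0 del0.
  have nTP : \forall x \near (0 : 'rV[C]_3), cabs (T x) < Num.min del (r ^+ k) /\ cabs (P x) < del.
    by apply: filterS2 nT nP => x.
  have XE' : \forall x \near (0 : 'rV[C]_3), X x <-> weierstrass_fun F (x *m A) = 0 by exact: XE.
  apply: filterS3 XE' (surface_eqE prE uD Fm) nTP.
  move=> x XEx SEx []; rewrite lt_min => /andP[Tx Txr] Px.
  have [hT hP _] := space_coords D prE x.
  rewrite hT in Tx Txr *; rewrite hP in Px *.
  have Xroot : X x <-> root (gpoly d (fun i => a i ((pr x *m D) 0 0) ((pr x *m D) 0 1))) (Z x).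
    rewrite XEx SEx /plane_coef plane_ptE // gpoly_reduced /surface_eq.
    by split => [/eqP|/eqP].
  split.
    move=> [/= [u /diskE ur gu] /Xroot rx].
    have [|w [wr tw pw_]] := (hdel (pr x) Tx Px).1; first by exists u.
    exists w; rewrite -tw -pw_; split => //.
    by rewrite -(@ltr_pXn2r _ k) ?nnegrE ?cabs_ge0 ?(ltW r_gt0) // -cabsX -tw.
  move=> [w [wr tw pw_ rx]]; split; last by apply/Xroot; rewrite tw pw_.
  have [|u ur gu] := (hdel (pr x) Tx Px).2; first by exists w; split; [exact: lt_le_trans wr rrho|exact: tw|exact: pw_].
  by exists u => //; apply/diskE.
have ns : nosplit d k a pw.
  apply: (@nosplit_of_irreducible _ d k a pw _ (fun x => T x) (fun x => P x) Z r) => //.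
  - apply: filterS (shifted_coord_hol prE uD Fh) => x Zx.
    by split => //; exact: differentiable_mulmx.
  - by rewrite mul0mx mxE.
  - exact: surface_coords.
  - exact: AE.
  - exact: irr.
  - by move=> w wr; exact: (pwP w (lt_le_trans wr rrho)).1.
  - by move=> w w' wr wr'; exact: arc_inj (lt_le_trans wr rrho) (lt_le_trans wr' rrho).
have rr1 : r <= r1 by clra.
(* Order 0 would mean a nonzero constant term, but the coefficients vanish at 0. *)
have e_gt0 i : (i < d)%N -> (0 < e i)%N.
  move=> id; rewrite lt0n; apply/eqP => ei; have ed : (e i < d.+1)%N by rewrite ei.
  have [l] := cn0 i id ed; rewrite ei leqn0 => /eqP -> /=; rewrite subnn => /eqP; apply.
  have z0 : cabs (0 : C) <= r1 by rewrite cabs0 ltW.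
  have [_ _ /(_ ed)] := hord i id 0 0 z0 z0.
  rewrite ei a00 // sub0r cabsN /hsum big_ord_recr big_ord0 /= add0r subnn !expr0 !mulr1.
  rewrite /cmax cabs0 maxxx expr1 mulr0 => h.
  by apply/eqP; rewrite -cabs_eq0 eq_le h cabs_ge0.
have hord' i : (i < d)%N -> forall t p, cabs t <= r -> cabs p <= r ->
      [/\ hol (a i t) p, cabs (a i t p) <= M * cmax t p ^+ e i
        & (e i < d.+1)%N -> cabs (a i t p - hsum (c i) (e i) t p) <= M * cmax t p ^+ (e i).+1].
  by move=> id t p tr pr_; exact: (hord i id t p (le_trans tr rr1) (le_trans pr_ rr1)).
exists c, e, r, M; split => //; first by rewrite r_gt0.
apply: (@slope_dichotomy _ d k a pw c e r M eps K) => //.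
- by move=> i id t p tr pr_; have [] := hord' i id t p tr pr_.
- by move=> i id t p tr pr_; have [] := hord' i id t p tr pr_.
- by move=> i id ed t p tr pr_; have [_ _ ->] := hord' i id t p tr pr_.
- by move=> t p; exact: plane_coef_top.
Qed.

(** The leading form is found in the coordinates [space_mx] and pulled back. Norms grow by at most
    the factor [3 * K3], which enters the constants. *)
Lemma tangent_cone_lines : line_or_union_of_lines (proj_tangent_cone X).
Proof.
have [c [e [r [M [/andP[r_gt0 r1] M1 cn0 hord dich]]]]] := arc_tangent_order.
have [rb [Mb [rb0 hb]]] := bihol_germ D (root_shift_hol Fh).
have be0 : root_shift F d (plane_pt D 0 0) = 0 by rewrite plane_pt00 root_shift0.
have [b1 [b2 [r2 [M2 [r20 M20 hlin]]]]] := linear_part rb0 hb be0.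
pose r' := Num.min r r2.
have r'0 : 0 < r' by rewrite lt_min r_gt0.
have r'r : r' <= r by rewrite ge_min lexx.
have r'r2 : r' <= r2 by rewrite ge_min lexx orbT.
clearbody r'.
have hord' i : (i < d)%N -> forall t p, cabs t <= r' -> cabs p <= r' ->
      cabs (a i t p) <= M * cmax t p ^+ e i /\ ((e i < d.+1)%N ->
      cabs (a i t p - hsum (c i) (e i) t p) <= M * cmax t p ^+ (e i).+1).
  by move=> id t p tr pr_; have [] := hord i id t p (le_trans tr r'r) (le_trans pr_ r'r).
have [|||cols [kap [K' [scols cols0 kap0 K'0 spec]]]] :=
  @leading_form _ d a c e r' M M2 b1 b2 d0 _ M1 M20 _ _ cn0 dich.
- lra.
- by move=> i id t p tr pr_; have [] := hord' i id t p tr pr_.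
- by move=> i id ed t p tr pr_; have [_ ->] := hord' i id t p tr pr_.
pose S := space_mx A D.
have uS : S \in unitmx by exact: space_mx_unit.
have [K3 K30 hK3] := coord_mulmx_le S.
have vS (x : 'rV[C]_3) : vsum (x *m S) <= (3 * K3) * vsum x.
  apply: (@le_trans _ _ (\sum_(j < 3) K3 * vsum x)); first by apply: ler_sum => j _; exact: hK3.
  by rewrite sumr_const card_ord -[_ *+ 3]mulr_natl mulrA.
have K31 : 0 < 3 * K3 + 1 by clra.
apply: (@tangent_cone_leading_form _ (surface_eq pr A F d) X [seq S *m l | l <- cols] kap
  (K' * (3 * K3) ^+ (size cols).+1) (r' / (3 * K3 + 1))).
- exact: (surface_eq_hol prE uD Fh).
- have XE' : \forall x \near (0 : 'rV[C]_3), X x <-> weierstrass_fun F (x *m A) = 0 by exact: XE.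
  have XS : \forall x \near (0 : 'rV[C]_3), X x <-> surface_eq pr A F d x = 0.
    by apply: filterS2 XE' (surface_eqE prE uD Fm) => x XEx SEx; rewrite XEx SEx.
  exact: XS.
- move=> _ /mapP[l lc ->]; apply: contra_neq (cols0 l lc) => Sl.
  by rewrite -[l](mulKmx uS) Sl mulmx0.
- by rewrite size_map.
- exact: kap0.
- by rewrite mulr_ge0 // exprn_ge0 // mulr_ge0.
- by rewrite divr_gt0.
move=> x; rewrite ltr_pdivlMr // => xr.
have v0 := vsum_ge0 x; have vx := vS x.
have ur : vsum (x *m S) < r' by clra.
have [hT hP hZ] := space_coords D prE x.
have prx : pr x = plane_pt D ((x *m S) 0 0) ((x *m S) 0 1) by rewrite hT hP plane_ptE.
have t0 := coord_le_vsum (x *m S) 0; have p0 := coord_le_vsum (x *m S) 1.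
have := spec (x *m S) (root_shift F d (pr x)) ur.
have -> : form_prod [seq S *m l | l <- cols] x = form_prod cols (x *m S).
  by rewrite /form_prod big_map; apply: eq_bigr => l _; rewrite mulmxA.
have -> : gpoly d (fun i => a i ((x *m S) 0 0) ((x *m S) 0 1)) = centered d (monic_of F d (pr x)).
  by rewrite /plane_coef -prx gpoly_reduced.
rewrite hZ -/(shifted_coord pr A F d x) -/(surface_eq pr A F d x) size_map => h.
apply: le_trans (h _) _.
  rewrite prx; apply: le_trans (hlin _ _ _ _) _.
  - exact: le_trans t0 (le_trans (ltW ur) r'r2).
  - exact: le_trans p0 (le_trans (ltW ur) r'r2).
  apply: ler_wpM2l => //; apply: lerXn2r; rewrite ?nnegrE ?cmax_ge0 ?vsum_ge0 //.
  exact: cmax_le.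
rewrite -mulrA; apply: ler_wpM2l => //; rewrite -exprMn.
by apply: lerXn2r; rewrite ?nnegrE ?vsum_ge0 // mulr_ge0 // mulr_ge0.
Qed.

End Irreducibility.

Theorem corollary5p7 (R : realType) (X : set 'rV[Cplx R]_3)
    (pr : {linear 'rV[Cplx R]_3 -> 'rV[Cplx R]_2})
    (Delta : set 'rV[Cplx R]_2) (gamma : Cplx R -> 'rV[Cplx R]_2) :
  surface_germ X ->
  (forall y : 'rV[Cplx R]_2, exists x : 'rV[Cplx R]_3, pr x = y) ->
  finite_projection pr X ->
  is_discriminant pr X Delta ->
  ~ line_or_union_of_lines (proj_tangent_cone X) ->
  arc_germ gamma ->
  (exists2 r : R, arc_disk gamma Delta r
     & irreducible_germ (arc_section pr X gamma r)) ->
  arc_tangent gamma Delta.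
Proof.
move=> _ _ _ [A [F [[uA prE] [d [Fm Fh F0]] _ XE DE]]] no_lines [_ g0 _].
move=> [r [r0 gd ginj _] irr].
(* In degree 0 the equation would be the constant 1, but an irreducible germ contains 0. *)
have d0 : (0 < d)%N.
  rewrite lt0n; apply/eqP => dz; have [_ /= X0] := irr.1.
  have [Fm0 sF] := nbhs_singleton Fm; have := (nbhs_singleton XE).1 X0.
  rewrite /= /weierstrass_fun -prE linear0 [F 0]size1_polyC ?sF ?dz // hornerC.
  have := monicP Fm0; rewrite lead_coefE sF dz /= => -> /eqP.
  by rewrite oner_eq0.
have gd' u : cabs u <= r -> differentiable gamma u.
  by move=> /diskE/gd/nbhs_singleton.
have ginj' u u' : cabs u <= r -> cabs u' <= r -> gamma u = gamma u' -> u = u'.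
  by move=> /diskE ur /diskE ur'; apply: ginj; apply: mem_set.
have [v [D [k [pw [rho [K [tv uD vD an]]]]]]] := arc_normal_form r0 gd' g0 ginj'.
(* In the coordinates [D] the tangent is the first unit vector. Were it outside the tangent cone of
   [Delta], the projectivized tangent cone of [X] would be a line or a union of lines. *)
exists v => //; apply: contrapT; rewrite (tangent_cone_germ DE) => /(not_tangent_coneP uD)[e0 e00 nD].
apply: no_lines; rewrite vD in nD.
exact: (tangent_cone_lines uA prE uD d0 Fm Fh F0 XE an irr e00 nD).
Qed.
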